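(* Let $d\in\mathbb{N}$ and let $A\subset\mathbb{R}^d$ be a compact convex finite polytope. Let $\mu$ be a Borel probability measure on $A$ with probability density function $f$, and let $X_1,X_2,\ldots$ be independent random vectors with common distribution $\mu$. Assume that $f|_A$ is continuous at $x$ for all $x\in\partial A$, and that $f_0>0$. Let $\beta\in[0,\infty]$ and let $k:\mathbb{N}\to\mathbb{N}$ satisfy $\lim_{n\to\infty}k(n)/\log n=\beta$ and $\lim_{n\to\infty}k(n)/n=0$. Then, almost surely, $$\lim_{n\to\infty}\frac{nL_{n,k(n)}^d}{k(n)}=\max_{\varphi\in\Phi^*(A)}\left(\frac{1}{f_\varphi\rho_\varphi}\right)\quad\text{if }\beta=\infty;$$ $$\lim_{n\to\infty}\frac{nL_{n,k(n)}^d}{\log n}=\max_{\varphi\in\Phi^*(A)}\left(\frac{\hat H_\beta(D(\varphi)/d)}{f_\varphi\rho_\varphi}\right)\quad\text{if }\beta<\infty.$$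
   Context: $\mathbb{N}=\{1,2,\ldots\}$; $\|\cdot\|$ is the Euclidean norm; $B(x,r)=\{y\in\mathbb{R}^d:\|y-x\|\le r\}$; $o$ is the origin. $\mathcal{X}_n=\{X_1,\ldots,X_n\}$, and $\mathcal{X}_n(D)$ is the number of points of $\mathcal{X}_n$ in $D$. The largest $k$-nearest neighbour link is $L_{n,k}=\inf\{r>0:\mathcal{X}_n(B(x,r))\ge k+1\ \forall x\in\mathcal{X}_n\}$, with $\inf\varnothing=+\infty$. $f_0=\operatorname{ess\,inf}_{x\in A}f(x)$. $\partial A$ is the topological boundary of $A$. $\Phi(A)$ is the set of all faces of $A$ of all dimensions $0,1,\ldots,d-1$, and $\Phi^*(A)=\Phi(A)\cup\{A\}$. For $\varphi\in\Phi^*(A)$, $D(\varphi)$ is the dimension of $\varphi$ (so $D(A)=d$), and $\varphi^o$ is its relative interior (with $\varphi^o=\varphi$ if $D(\varphi)=0$). If $\varphi\in\Phi(A)$, $f_\varphi=\inf_{x\in\varphi}f(x)$; if $\varphi=A$, $f_\varphi=f_0$. For each $\varphi\in\Phi^*(A)$ there is a cone $\mathcal{K}_\varphi\subset\mathbb{R}^d$ such that every $x\in\varphi^o$ has a neighbourhood $U_x$ with $A\cap U_x=(x+\mathcal{K}_\varphi)\cap U_x$; the angular volume $\rho_\varphi$ is the $d$-dimensional Lebesgue measure of $\mathcal{K}_\varphi\cap B(o,1)$. $H(t)=1-t+t\log t$ for $t>0$ and $H(0)=1$. For $a\in[0,\infty)$, the function $\hat H_a:[0,\infty)\to[a,\infty)$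 is defined by: $y=\hat H_a(x)$ if and only if $yH(a/y)=x$ and $y\ge a$, with $\hat H_0(0)=0$. (Thus $\hat H_0(x)=x$ and $\hat H_a(0)=a$.) *)

(* Defs.v *)
From HB Require Import structures.
From mathcomp Require Import all_boot all_order all_algebra finmap.
From mathcomp Require Import all_classical all_reals all_analysis.
From mathcomp Require Import measurable_realfun ess_sup_inf.

Set Implicit Arguments.
Unset Strict Implicit.
Unset Printing Implicit Defensive.

Import Order.TTheory GRing.Theory Num.Theory.
Import numFieldNormedType.Exports.

Local Open Scope classical_set_scope.
Local Open Scope ring_scope.

Definition mx_borel_display : measure_display. Proof. exact. Qed.

Section matrix_borel.
Variables (R : realType) (m n : nat).

Let borel : set (set 'M[R]_(m, n)) := <<s @open 'M[R]_(m, n) >>.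

Let borel0 : borel set0. Proof. exact: sigma_algebra0. Qed.

Let borelC (B : set 'M[R]_(m, n)) : borel B -> borel (~` B).
Proof. exact: sigma_algebraC. Qed.

Let borel_bigcup (F : (set 'M[R]_(m, n))^nat) :
  (forall i, borel (F i)) -> borel (\bigcup_i F i).
Proof. exact: sigma_algebra_bigcup. Qed.

HB.instance Definition _ := @isMeasurable.Build mx_borel_display
  'M[R]_(m, n) borel borel0 borelC borel_bigcup.

End matrix_borel.

Lemma measurable_mxP (R : realType) (m n : nat) d (T : measurableType d)
    (g : T -> 'M[R]_(m, n)) :
  (forall i j, measurable_fun setT (fun t => g t i j)) ->
  measurable_fun setT g.
Proof.
move=> mg; apply: (@measurability _ _ _ _ _ _ (@open 'M[R]_(m, n))) => //.
move=> _ [U oU <-]; rewrite setTI.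
pose Q : set ('M[rat]_(m, n) * nat) :=
  [set q | ball (map_mx ratr q.1 : 'M[R]_(m, n)) q.2.+1%:R^-1 `<=` U].
have -> : g @^-1` U = \bigcup_q (if q \in Q then
    g @^-1` (ball (map_mx ratr q.1 : 'M[R]_(m, n)) q.2.+1%:R^-1) else set0).
  apply/seteqP; split => [t Ut|t [q _]]; last first.
    by case: ifPn => // /set_mem; apply.
  have /nbhs_ballP[e /= e0 eU] : nbhs (g t) U by exact: open_nbhs_nbhs.
  have [k ke] : exists k, k.+1%:R^-1 < e / 2.
    have /ltr_add_invr[k] : 0 < e / 2 by rewrite divr_gt0.
    by rewrite add0r => ke; exists k.
  have k0 : 0 < k.+1%:R^-1 :> R by rewrite invr_gt0.
  have qe i j : exists q : rat, ball (g t i j) k.+1%:R^-1 (ratr q).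
    have [|_ [/[swap] [[q _ <-]] b]] := @dense_rat R (ball (g t i j) k.+1%:R^-1) _
      (ball_open _ _); first by exists (g t i j); exact: ballxx.
    by exists q.
  have [q qP] := choice (fun ij => qe ij.1 ij.2).
  exists (\matrix_(i, j) q (i, j), k) => //=.
  have Bt : ball (map_mx ratr (\matrix_(i, j) q (i, j)) : 'M[R]_(m, n))
      k.+1%:R^-1 (g t).
    split=> // i j; rewrite !mxE; apply: ball_sym; exact: (qP (i, j)).
  rewrite mem_set//= => z Bz; apply: eU.
  have zt : ball (g t : 'M[R]_(m, n)) (e / 2) (map_mx ratr (\matrix_(i, j) q (i, j))).
    by apply: (le_ball (ltW ke)); exact: ball_sym.
  rewrite (splitr e); apply: (ball_triangle zt).
  by apply: le_ball Bz; exact: ltW.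
apply: countable_bigcupT_measurable; first exact: countableP.
move=> q; case: ifPn => // _.
rewrite (_ : _ @^-1` _ = \bigcap_(ij : 'I_m * 'I_n)
  ((fun t => g t ij.1 ij.2) @^-1`
     ball (ratr (q.1 ij.1 ij.2) : R) q.2.+1%:R^-1)).
  apply: fin_bigcap_measurable => // -[i j] _ /=.
  by rewrite -[X in measurable X]setTI; apply: mg => //; exact: measurable_ball.
apply/seteqP; split => [t [_ h] [i j] _ /=|t h].
  by have := h i j; rewrite mxE.
by split=> [|i j]; rewrite ?invr_gt0// mxE; exact: (h (i, j)).
Qed.

Lemma measurable_mx_coord (R : realType) (m n : nat) i j :
  measurable_fun setT (fun M : 'M[R]_(m, n) => M i j).
Proof.
apply: (measurability _ (RGenOpens.measurableE R)).
move=> _ [_ [a [b ->]] <-]; rewrite setTI; apply: sub_sigma_algebra => /=.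
by apply: open_comp; [move=> M _; exact: coord_continuous|exact: interval_open].
Qed.


Section lebesgue_row.
Variable R : realType.

Definition row_cons n (p : measurableTypeR R * 'rV[R]_n) : 'rV[R]_n.+1 :=
  row_mx (p.1%:M : 'rV_1) p.2.

Definition row_uncons n (v : 'rV[R]_n.+1) : measurableTypeR R * 'rV[R]_n :=
  (v 0 0, @rsubmx R 1 1 n v).

Lemma row_cons0 n p : @row_cons n p 0 0 = p.1.
Proof.
apply: (etrans (y := @row_mx R 1 1 n (p.1%:M) p.2 0 (lshift n 0))).
  by congr (@row_mx R 1 1 n _ _ _ _); exact/val_inj.
by rewrite row_mxEl mxE.
Qed.

Lemma row_consS n p k : @row_cons n p 0 (lift ord0 k) = p.2 0 k.
Proof.
apply: (etrans (y := @row_mx R 1 1 n (p.1%:M) p.2 0 (rshift 1 k))).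
  by congr (@row_mx R 1 1 n _ _ _ _); exact/val_inj.
by rewrite row_mxEr.
Qed.

Lemma row_consK n : cancel (@row_cons n) (@row_uncons n).
Proof.
by move=> [x v]; rewrite /row_uncons row_cons0; congr pair; exact: row_mxKr.
Qed.

Lemma row_unconsK n : cancel (@row_uncons n) (@row_cons n).
Proof.
move=> v; apply: etrans (@hsubmxK R 1 1 n v); congr (@row_mx R 1 1 n _ _).
apply/matrixP => i j; rewrite !ord1 !mxE/= mulr1n; congr (v _ _).
exact/val_inj.
Qed.

Lemma measurable_row_cons n : measurable_fun setT (@row_cons n).
Proof.
apply: measurable_mxP => i j; rewrite (ord1 i).
case: (unliftP ord0 j) => [k|] ->; last first.
  by under eq_fun do rewrite row_cons0; exact: measurable_fst.
under eq_fun do rewrite row_consS.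
exact: (measurableT_comp (measurable_mx_coord 0 k) measurable_snd).
Qed.

Lemma measurable_row_uncons n : measurable_fun setT (@row_uncons n).
Proof.
apply/measurable_fun_pairP; split; first exact: measurable_mx_coord.
apply: measurable_mxP => i j.
under eq_fun do rewrite mxE; exact: measurable_mx_coord.
Qed.

Section lebesgue_rowS.
Variables (n : nat) (mu : {sigma_finite_measure set 'rV[R]_n -> \bar R}).

Definition lebesgue_rowS : set 'rV[R]_n.+1 -> \bar R :=
  pushforward (@lebesgue_measure R \x mu)%E (@row_cons n).

Let lebesgue_rowS0 : lebesgue_rowS set0 = 0%E.
Proof. by rewrite /lebesgue_rowS /pushforward preimage_set0 measure0. Qed.

Let lebesgue_rowS_ge0 B : (0 <= lebesgue_rowS B)%E.
Proof. by rewrite /lebesgue_rowS /pushforward measure_ge0. Qed.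

Let lebesgue_rowS_semi_sigma_additive : semi_sigma_additive lebesgue_rowS.
Proof.
move=> F mF tF mUF; rewrite /lebesgue_rowS /pushforward preimage_bigcup.
have mpre B : measurable B -> measurable (@row_cons n @^-1` B).
  by move=> mB; rewrite -[X in measurable X]setTI; exact: measurable_row_cons.
apply: measure_semi_sigma_additive => [k||]; first exact: mpre.
- apply/trivIsetP => i j _ _ ij; rewrite -preimage_setI.
  by move/trivIsetP : tF => ->//; rewrite preimage_set0.
- by rewrite -preimage_bigcup; exact: mpre.
Qed.

HB.instance Definition _ := isMeasure.Build _ _ _ lebesgue_rowS
  lebesgue_rowS0 lebesgue_rowS_ge0 lebesgue_rowS_semi_sigma_additive.

Let lebesgue_rowS_sigma_finite : sigma_finite setT lebesgue_rowS.
Proof.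
have /sigma_finiteP[F [FT ndF Foo]] := sigma_finiteT (@lebesgue_measure R).
have /sigma_finiteP[G [GT ndG Goo]] := sigma_finiteT mu.
exists (fun k => @row_uncons n @^-1` (F k `*` G k)) => [|k].
  rewrite -preimage_bigcup -[LHS](@preimage_setT _ _ (@row_uncons n)).
  congr preimage; rewrite -setXTT FT GT; apply/seteqP; split=> -[x y].
    move=> [/= [i _ Fx] [j _ Gy]]; exists (maxn i j) => //; split => /=.
      by move: x Fx; exact/subsetPset/ndF/leq_maxl.
    by move: y Gy; exact/subsetPset/ndG/leq_maxr.
  by move=> [k _ [/= ? ?]]; split; exists k.
have [mF Fk] := Foo k; have [mG Gk] := Goo k; split.
  rewrite -[X in measurable X]setTI; apply: measurable_row_uncons => //.
  exact: measurableX.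
rewrite /lebesgue_rowS /pushforward -comp_preimage.
rewrite (_ : _ \o _ = id) ?preimage_id; last exact/funext/row_consK.
by rewrite product_measure1E// lte_mul_pinfty// ge0_fin_numE.
Qed.

HB.instance Definition _ := Measure_isSigmaFinite.Build _ _ _ lebesgue_rowS
  lebesgue_rowS_sigma_finite.

End lebesgue_rowS.

(* Iterated product of the Lebesgue measure on R, transported to row vectors. *)
Fixpoint lebesgue_row n : {sigma_finite_measure set 'rV[R]_n -> \bar R} :=
  if n is n'.+1 then lebesgue_rowS (lebesgue_row n') else \d_(0 : 'rV[R]_0).

Lemma lebesgue_row_box n (a b : 'I_n -> R) : (forall i, a i <= b i) ->
  lebesgue_row n [set v | forall i, a i <= v 0 i <= b i] =
  (\prod_(i < n) (b i - a i))%:E.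
Proof.
elim: n a b => [|n IH] a b ab.
  by rewrite big_ord0 /= diracE mem_set// => -[].
rewrite big_ord_recl EFinM -IH => [|i]; last exact: ab.
transitivity ((@lebesgue_measure R \x lebesgue_row n)%E (`[a ord0, b ord0] `*`
    [set v : 'rV[R]_n | forall i : 'I_n,
       a (lift ord0 i) <= v 0 i <= b (lift ord0 i)])).
  apply: (congr1 (@lebesgue_measure R \x lebesgue_row n)%E).
  apply/seteqP; split => -[x v] /=.
    move=> h; split => [|i].
      by have := h 0; rewrite row_cons0 in_itv.
    by have := h (lift ord0 i); rewrite row_consS.
  move=> [xab vab] i; case: (unliftP ord0 i) => [j|] ->.
    by rewrite row_consS.
  by rewrite row_cons0; move: xab; rewrite in_itv.
rewrite product_measure1E//; last first.
  rewrite (_ : mkset _ = \bigcap_i ((fun v : 'rV[R]_n => v 0 i) @^-1`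
      `[a (lift ord0 i), b (lift ord0 i)])).
    apply: fin_bigcap_measurable => // i _.
    rewrite -[X in measurable X]setTI.
    by apply: measurable_mx_coord => //; exact: measurable_itv.
  apply/seteqP; split => v /= h i; first by move=> _ /=; rewrite in_itv/=.
  by have := h i Logic.I; rewrite /= in_itv.
congr (_ * _)%E; apply: (etrans (lebesgue_measure_itv _)).
rewrite /= lte_fin.
by case: ltgtP (ab ord0) => // ->; rewrite subrr.
Qed.

End lebesgue_row.

Section euclid.
Variables (R : realType) (d : nat).
Implicit Types (A F K : set 'rV[R]_d) (x y v : 'rV[R]_d).

Definition dot x y : R := \sum_i x 0 i * y 0 i.

(* The norm `|x| that MathComp puts on matrices is the sup norm. *)
Definition enorm x : R := Num.sqrt (dot x x).

Definition eball x (r : R) : set 'rV[R]_d := [set y | enorm (y - x) <= r].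

Definition boundary A : set 'rV[R]_d := closure A `\` A°.

Definition convex_polytope A : Prop :=
  compact A /\ exists (m : nat) (a : 'I_m -> 'rV[R]_d) (b : 'I_m -> R),
    A = [set x | forall i, dot (a i) x <= b i].

Definition affine_hull F : set 'rV[R]_d :=
  [set y | exists (m : nat) (p : 'I_m -> 'rV[R]_d) (w : 'I_m -> R),
    [/\ forall i, F (p i), \sum_i w i = 1 & y = \sum_i w i *: p i]].

(* Largest m such that F contains m + 1 affinely independent points. *)
Definition affine_dim F : nat :=
  \max_(m < d.+1 | `[< exists (x : 'rV[R]_d) (p : 'I_m -> 'rV[R]_d),
      [/\ F x, forall i, F (p i) & row_free (\matrix_i (p i - x))] >]) m.

Definition relative_interior F : set 'rV[R]_d :=
  [set x | F x /\ \forall y \near x, affine_hull F y -> F y].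

Definition is_face A F : Prop :=
  F !=set0 /\ exists (c : 'rV[R]_d) (b : R),
    (forall x, A x -> dot c x <= b) /\ F = A `&` [set x | dot c x = b].

(* The bound on the dimension removes A itself, which is_face allows (c = 0). *)
Definition faces A : set (set 'rV[R]_d) :=
  [set F | is_face A F /\ (affine_dim F < d)%N].

Definition faces_star A : set (set 'rV[R]_d) := faces A `|` [set A].

Definition cone K : Prop := forall (t : R) v, 0 < t -> K v -> K (t *: v).

Definition is_face_cone A F K : Prop :=
  cone K /\ forall x, relative_interior F x ->
    exists2 U, nbhs x U & A `&` U = [set x + v | v in K] `&` U.

(* For a face F of a polytope the cone exists and is unique: it is determined
   near 0 by A, and everywhere by scaling. *)
Definition face_cone A F : set 'rV[R]_d := get (is_face_cone A F).

Definition angular_volume A F : R :=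
  fine (lebesgue_row R d (face_cone A F `&` eball 0 1)).

(* +oo off A leaves the infimum over A unchanged. *)
Definition ess_inf_on A (f : 'rV[R]_d -> R) : \bar R :=
  ess_inf (lebesgue_row R d) (fun x => if x \in A then (f x)%:E else +oo%E).

Definition face_inf A (f : 'rV[R]_d -> R) F : R :=
  if F == A then fine (ess_inf_on A f) else inf [set f x | x in F].

End euclid.

Section sample.
Variables (R : realType) (d : nat).

Definition is_density (mu : set 'rV[R]_d -> \bar R) (f : 'rV[R]_d -> R) : Prop :=
  [/\ measurable_fun setT f, forall x, 0 <= f x &
    forall B, measurable B ->
      mu B = (\int[lebesgue_row R d]_(x in B) (f x)%:E)%E].

Definition mutually_independent dO (Omega : measurableType dO)
    (P : probability Omega R) (X : nat -> Omega -> 'rV[R]_d) : Prop :=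
  forall (J : {fset nat}) (B : nat -> set 'rV[R]_d),
    (forall i, measurable (B i)) ->
    P (\bigcap_(i in [set` J]) (X i @^-1` B i)) =
    (\prod_(i <- J) P (X i @^-1` B i))%E.

Variables (Omega : Type) (X : nat -> Omega -> 'rV[R]_d).

(* The indices are shifted by one: X 0 is the first point of the sample. *)
Definition sample (n : nat) (w : Omega) : set 'rV[R]_d :=
  [set X i w | i in `I_n].

Definition sample_count n w (D : set 'rV[R]_d) : nat :=
  #|` fset_set (sample n w `&` D) |%fset.

Definition knn_link (n k : nat) (w : Omega) : \bar R :=
  ereal_inf [set r%:E | r in [set r : R | 0 < r /\
    forall x, sample n w x -> (k.+1 <= sample_count n w (eball x r))%N]].

End sample.

Section limit_constant.
Variable R : realType.

Definition Hfun (t : R) : R := if t == 0 then 1 else 1 - t + t * ln t.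

(* The equation defining y has exactly one solution when a >= 0, x >= 0 and
   (a, x) != (0, 0); for a = 0 it is y = x. *)
Definition Hhat (a x : R) : R :=
  if (a == 0) && (x == 0) then 0
  else get [set y | a <= y /\ y * Hfun (a / y) = x].

(* The greatest element of S, not its supremum. *)
Definition maximum (S : set R) : R := get [set M | S M /\ ubound S M].

End limit_constant.

(* Main.v *)
Require Import Defs.
From mathcomp Require Import all_boot all_order all_algebra finmap.
From mathcomp Require Import all_classical all_reals all_analysis.
From mathcomp Require Import measurable_realfun ess_sup_inf ring lra zify.

Set Implicit Arguments.
Unset Strict Implicit.
Unset Printing Implicit Defensive.

Import Order.TTheory GRing.Theory Num.Theory.
Import numFieldNormedType.Exports.

Local Open Scope classical_set_scope.
Local Open Scope ring_scope.

(** The link length [L] is at most [r] as soon as every ball [eball x r] with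
    [x] in the polytope holds more than [k] sample points, and at least [r] as
    soon as the ball of radius [r] about some sample point holds at most [k] of
    them ([link_le], [link_ge]; almost surely the sample points are distinct and
    lie in the polytope). Both events are decided by the least populated small
    balls. Near a point of the relative interior of a face [F] the polytope is a
    cone of angular volume [rho], so a ball of radius [r] centred there has mass
    about [f * rho * r ^ d], and at the best places of [F] the value [f] is
    [face_inf A f F]. About [r ^- j] disjoint balls fit along a face of dimension
    [j]. With [r ^ d = u * ln n / n] this leaves [n ^ (j / d)] places, each
    expecting [y * ln n] points with [y = u * f * rho]; a place holds at most
    [b * ln n < y * ln n] of them with probability
    [n ^ (- Psi y b + o(1))], where [Psi y b = y * Hfun (b / y)]. Such places
    exist when [Psi y b < j / d] and are absent when [Psi y b > j / d], and the
    critical value of [y] is by definition [Hhat b (j / d)]. The slowest face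
    decides, whence the maximum. If [k] grows faster than [ln n], the deviations
    are negligible against [k], and the critical value of [y] is [1] when [k]
    replaces [ln n] in the normalisation.

    Upper bound. The set [I] of constraints that a ball about [x] can violate
    determines a set [pface a b I], which is a face or empty; it cannot be empty
    for small [r], and by an error bound of Hoffman type ([pface_error_bound])
    [x] is within [O(r)] of it. So [O(r ^- j)] smaller balls suffice for the
    centres of type [I] ([polytope_cover]), and the cone at [x] cut out by [I]
    contains the cone of the face, which bounds the mass from below
    ([face_ball_mass]). A union bound with the binomial lower tail gives
    [upper_event].

    Lower bound. [location] provides [c * r ^- j] disjoint balls of mass at most
    [(f * rho + eps) * r ^ d]. On a proper face continuity of the density there
    yields them; in the interior the density is only measurable, and one finds
    instead a dyadic cell with average density close to the essential infimum
    ([good_cell], by approximating a level set by dyadic cells in mass), in which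
    half of the packed balls cannot have much larger mass. A second moment
    computation ([many_locations]) shows that one of the balls receives the
    prescribed number of points, one of them close to its centre; the expected
    number of such balls is bounded below by a Stirling estimate
    ([binomial_lower]). For vertices, and whenever [y] is below the limit of
    [k / ln n] itself, a single location and the upper tail suffice
    ([lower_event_single]).

    Almost sure statements. For finite [beta] the probabilities obtained are of
    order [n ^ (- delta)], with [delta] arbitrarily small. They are made summable
    by treating together all sample sizes between [m ^ K] and [(m + 1) ^ K]
    ([blocks]); the counts are monotone in the sample size, and the consecutive
    powers have ratio tending to one, so that this costs only an arbitrarily
    small change of [u]. *)

(** * Euclidean geometry of row vectors *)

Section euclidean.
Variables (R : realType) (d : nat).
Implicit Types (x y z v a : 'rV[R]_d).

Lemma dotC x y : dot x y = dot y x.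
Proof. by apply: eq_bigr => i _; rewrite mulrC. Qed.

Lemma dotDr a x y : dot a (x + y) = dot a x + dot a y.
Proof. by rewrite -big_split; apply: eq_bigr => i _; rewrite mxE mulrDr. Qed.

Lemma dotZr a (t : R) x : dot a (t *: x) = t * dot a x.
Proof. by rewrite mulr_sumr; apply: eq_bigr => i _; rewrite mxE mulrCA. Qed.

Lemma dotNr a x : dot a (- x) = - dot a x.
Proof. by rewrite -scaleN1r dotZr mulN1r. Qed.

Lemma dotBr a x y : dot a (x - y) = dot a x - dot a y.
Proof. by rewrite dotDr dotNr. Qed.

Lemma dot0r a : dot a 0 = 0.
Proof. by apply: big1 => i _; rewrite mxE mulr0. Qed.

Lemma dot_sumr a (I : Type) (r : seq I) (P : pred I) (F : I -> 'rV[R]_d) :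
  dot a (\sum_(i <- r | P i) F i) = \sum_(i <- r | P i) dot a (F i).
Proof. by apply: (big_morph _ (dotDr a) (dot0r a)). Qed.

Lemma dot_suml (I : Type) (r : seq I) (P : pred I) (F : I -> 'rV[R]_d) a :
  dot (\sum_(i <- r | P i) F i) a = \sum_(i <- r | P i) dot (F i) a.
Proof. by rewrite dotC dot_sumr; apply: eq_bigr => i _; rewrite dotC. Qed.

Lemma dot_ge0 x : 0 <= dot x x.
Proof. by apply: sumr_ge0 => i _; rewrite -expr2 sqr_ge0. Qed.

Lemma dot_eq0 x : dot x x = 0 -> x = 0.
Proof.
move=> /eqP; rewrite psumr_eq0 => [/allP h|i _]; last by rewrite -expr2 sqr_ge0.
apply/rowP => i; have := h i (mem_index_enum i).
by rewrite -expr2 sqrf_eq0 mxE => /eqP.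
Qed.

Lemma enorm_ge0 x : 0 <= enorm x.
Proof. exact: sqrtr_ge0. Qed.

Lemma enorm_sqr x : enorm x ^+ 2 = dot x x.
Proof. by rewrite sqr_sqrtr// dot_ge0. Qed.

Lemma enormZ (t : R) x : enorm (t *: x) = `|t| * enorm x.
Proof.
by rewrite /enorm dotZr dotC dotZr mulrA -expr2 sqrtrM ?sqr_ge0// sqrtr_sqr.
Qed.

Lemma enormN x : enorm (- x) = enorm x.
Proof. by rewrite -scaleN1r enormZ normrN1 mul1r. Qed.

Lemma enorm_distC x y : enorm (x - y) = enorm (y - x).
Proof. by rewrite -enormN opprB. Qed.

Lemma enorm0 : enorm (0 : 'rV[R]_d) = 0.
Proof. by rewrite /enorm dot0r sqrtr0. Qed.

Lemma enorm_eq0 x : enorm x = 0 -> x = 0.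
Proof. by move=> h; apply: dot_eq0; rewrite -enorm_sqr h expr0n. Qed.

(** Cauchy-Schwarz, from the nonnegativity of
    [dot w w] with [w = dot y y *: x - dot x y *: y]. *)
Lemma ler_dot_enorm x y : `|dot x y| <= enorm x * enorm y.
Proof.
have [y0|y0] := eqVneq (dot y y) 0.
  by rewrite (dot_eq0 y0) dot0r normr0 mulr_ge0// enorm_ge0.
have yp : 0 < dot y y by rewrite lt_neqAle eq_sym y0 dot_ge0.
rewrite -(ler_pXn2r (n := 2))// ?nnegrE ?mulr_ge0 ?enorm_ge0//.
rewrite real_normK ?num_real// exprMn !enorm_sqr.
have := dot_ge0 (dot y y *: x - dot x y *: y).
rewrite dotBr !dotZr ![dot (_ - _) _]dotC !dotBr !dotZr (dotC y x) => h.
have {}h : 0 <= dot y y * (dot x x * dot y y - dot x y ^+ 2).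
  by apply: le_trans h _; rewrite le_eqVlt; apply/orP; left; apply/eqP; ring.
by rewrite pmulr_rge0// subr_ge0 in h.
Qed.

Lemma ler_enormD x y : enorm (x + y) <= enorm x + enorm y.
Proof.
rewrite -(ler_pXn2r (n := 2))// ?nnegrE ?addr_ge0 ?enorm_ge0//.
rewrite sqrrD !enorm_sqr dotDr ![dot (_ + _) _]dotC !dotDr (dotC y x).
have := ler_dot_enorm x y; have := ler_norm (dot x y); lra.
Qed.

Lemma ler_dist_enormD z x y : enorm (x - y) <= enorm (x - z) + enorm (z - y).
Proof. by rewrite -{1}(subrK z x) -addrA ler_enormD. Qed.

Lemma ler_enorm_sum (I : Type) (r : seq I) (P : pred I) (F : I -> 'rV[R]_d) :
  enorm (\sum_(i <- r | P i) F i) <= \sum_(i <- r | P i) enorm (F i).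
Proof.
elim/big_rec2: _ => [|i u v _ h]; first by rewrite enorm0.
by apply: le_trans (ler_enormD _ _) _; rewrite lerD2l.
Qed.

Lemma ler_coord_enorm x i : `|x 0 i| <= enorm x.
Proof.
rewrite -(ler_pXn2r (n := 2))// ?nnegrE ?enorm_ge0// enorm_sqr.
rewrite real_normK ?num_real// /dot (bigD1 i)//= -expr2 lerDl.
by apply: sumr_ge0 => j _; rewrite -expr2 sqr_ge0.
Qed.

Lemma ler_enorm_coord x c : (forall i, `|x 0 i| <= c) -> enorm x <= d%:R * c.
Proof.
move=> h.
have -> : x = \sum_i x 0 i *: 'e_i by rewrite -row_sum_delta.
apply: le_trans (ler_enorm_sum _ _ _) _.
apply: (@le_trans _ _ (\sum_(i < d) c)); last first.
  by rewrite sumr_const card_ord mulr_natl.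
apply: ler_sum => i _; rewrite enormZ.
have -> : enorm ('e_i : 'rV[R]_d) = 1.
  rewrite /enorm /dot (bigD1 i)//= big1 => [|j ji]; first by rewrite !mxE !eqxx /= mulr1 addr0 sqrtr1.
  by rewrite !mxE eqxx (negbTE ji) mulr0.
by rewrite mulr1.
Qed.

Lemma eballE x r y : eball x r y = (enorm (y - x) <= r) :> Prop.
Proof. by []. Qed.

Lemma eball_sub x y (r s : R) : enorm (x - y) + r <= s ->
  eball x r `<=` eball y s.
Proof.
move=> h z /= zr; apply: le_trans (ler_dist_enormD x _ _) _.
by apply: le_trans h; rewrite addrC lerD2l.
Qed.

Lemma nbhs_eball x U : nbhs x U -> exists2 r : R, 0 < r & eball x r `<=` U.
Proof.
move=> /nbhs_ballP[e /= e0 eU]; exists (e / 2); first by rewrite divr_gt0.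
move=> y /= h; apply: eU; split=> // i j; rewrite !ord1.
rewrite /ball /= -normrN opprB; have := ler_coord_enorm (y - x) j.
by rewrite !mxE => h'; apply: le_lt_trans h' _; apply: le_lt_trans h _; lra.
Qed.

(** The topology on row vectors is defined by the sup norm, hence the
    comparison of norms. *)
Lemma eball_nbhs x (r : R) : 0 < r -> nbhs x (eball x r).
Proof.
move=> r0; have e0 : 0 < r / (d%:R + 1) by rewrite divr_gt0// ltr_wpDl.
apply/nbhs_ballP; exists (r / (d%:R + 1)) => // y [_ h] /=.
have := @ler_enorm_coord (y - x) (r / (d%:R + 1)) _.
move=> H; apply: le_trans (H _) _.
  by move=> i; rewrite !mxE -normrN opprB; apply/ltW; apply: (h 0 i).
by rewrite mulrCA ler_piMr ?(ltW r0)// ler_pdivrMr ?ltr_wpDl// mul1r lerDl.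
Qed.

Lemma measurable_dot a : measurable_fun setT (dot a).
Proof.
apply: measurable_sum => i.
by apply: measurable_funM => //; exact: measurable_mx_coord.
Qed.

Lemma measurable_dotx : measurable_fun setT (fun x => dot x x).
Proof.
apply: measurable_sum => i.
by apply: measurable_funM => //; exact: measurable_mx_coord.
Qed.

Lemma measurable_trans v (c : R) :
  measurable_fun setT (fun x : 'rV[R]_d => c *: (x - v)).
Proof.
apply: measurable_mxP => i j; rewrite (ord1 i); under eq_fun do rewrite !mxE.
by apply: measurable_funM => //; apply: measurable_funB => //; exact: measurable_mx_coord.
Qed.

Lemma measurable_preimageT d1 d2 (T1 : measurableType d1) (T2 : measurableType d2)
  (g : T1 -> T2) B : measurable_fun setT g -> measurable B -> measurable (g @^-1` B).
Proof. by move=> mg mB; rewrite -[X in measurable X]setTI; exact: mg. Qed.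

Lemma measurable_eball x r : measurable (eball x r).
Proof.
have -> : eball x r = (fun y => 1 *: (y - x)) @^-1`
    ((fun z => dot z z) @^-1` (@Num.sqrt R @^-1` `]-oo, r])).
  by apply/seteqP; split => y /=; rewrite in_itv/= scale1r.
apply: measurable_preimageT; first exact: measurable_trans.
apply: measurable_preimageT; first exact: measurable_dotx.
apply: measurable_preimageT; last exact: measurable_itv.
exact: (continuous_measurable_fun (@sqrt_continuous R)).
Qed.

Lemma measurable_halfspace a (b : R) : measurable [set x | dot a x <= b].
Proof.
have -> : [set x | dot a x <= b] = dot a @^-1` `]-oo, b].
  by apply/seteqP; split => y /=; rewrite in_itv.
by apply: measurable_preimageT; [exact: measurable_dot|exact: measurable_itv].
Qed.

Lemma measurable_hyperplane a (b : R) : measurable [set x | dot a x = b].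
Proof. by apply: (measurable_preimageT (B := [set b])); [exact: measurable_dot|]. Qed.

End euclidean.

(** * Lebesgue measure under homotheties *)

Section lebesgue_homothety.
Variables (R : realType) (n : nat).

Definition cbox (a b : 'I_n -> R) : set 'rV[R]_n :=
  [set v | forall i, a i <= v 0 i <= b i].

Definition cboxes : set (set 'rV[R]_n) := [set B | exists a b, B = cbox a b].

Lemma measurable_cbox a b : measurable (cbox a b).
Proof.
rewrite (_ : cbox a b = \bigcap_(i in [set: 'I_n]) ((fun v : 'rV[R]_n => v 0 i) @^-1` `[a i, b i])).
  apply: fin_bigcap_measurable => // i _.
  by rewrite -[X in measurable X]setTI; apply: measurable_mx_coord => //.
apply/seteqP; split => v /= h i; first by move=> _ /=; rewrite in_itv/=.
by have := h i Logic.I; rewrite /= in_itv.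
Qed.

Lemma cboxes_setI : setI_closed cboxes.
Proof.
move=> _ _ [a [b ->]] [a' [b' ->]].
exists (fun i => Num.max (a i) (a' i)), (fun i => Num.min (b i) (b' i)).
apply/seteqP; split => v /=.
  by move=> [h h'] i; rewrite ge_max le_min; move: (h i) (h' i) => /andP[-> ->] /andP[-> ->].
by move=> h; split => i; move: (h i); rewrite ge_max le_min => /andP[/andP[? ?] /andP[? ?]]; apply/andP.
Qed.

Lemma bigcup_cbox : \bigcup_k cbox (fun=> - k%:R) (fun=> k%:R) = setT.
Proof.
rewrite -subTset => v _; exists (Num.truncn (enorm v)).+1 => // i.
rewrite -ler_norml; apply: le_trans (ler_coord_enorm v i) _.
by apply/ltW/truncnS_gt.
Qed.

Lemma measurable_cboxesE : @measurable _ 'rV[R]_n = <<s cboxes >>.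
Proof.
apply/seteqP; split; last first.
  by apply: smallest_sub => [|_ [a [b ->]]]; [exact: sigma_algebra_measurable|exact: measurable_cbox].
move=> B mB.
have mid : measurable_fun setT (id : g_sigma_algebraType cboxes -> 'rV[R]_n).
  apply: measurable_mxP => i j; rewrite (ord1 i).
  apply: (measurability _ (RGenCInfty.measurableE R)) => _ [_ [x ->] <-].
  rewrite setTI (_ : _ @^-1` _ = \bigcup_k
    cbox (fun l => if l == j then x else - k%:R) (fun=> k%:R)).
    by apply: bigcupT_measurable => k; apply: sub_sigma_algebra; do 2 eexists.
  apply/seteqP; split => [v /=|v [k _ /(_ j)]]; last first.
    by rewrite eqxx /= in_itv/= andbT => /andP[].
  rewrite in_itv/= andbT => xv; exists (Num.truncn (enorm v)).+1 => // l.
  have := ler_coord_enorm v l; have := truncnS_gt (enorm v).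
  move=> /ltW h /le_trans/(_ h); rewrite ler_norml => /andP[h1 ->]; rewrite andbT.
  by case: eqP => // ->.
have := mid measurableT B mB.
by rewrite setTI preimage_id.
Qed.

Lemma lebesgue_row_box_fin a b : (lebesgue_row R n (cbox a b) < +oo)%E.
Proof.
have [ab|/existsNP[i abi]] := pselect (forall i, a i <= b i).
  by rewrite lebesgue_row_box// ltry.
rewrite (_ : cbox a b = set0) ?measure0 ?ltry//.
rewrite -subset0 => v /(_ i) /andP[h1 h2]; apply: abi.
exact: le_trans h1 h2.
Qed.

(** A homothety multiplies the volume of boxes by [r ^ n], and boxes form a
    pi-system generating the Borel sets. *)
Lemma lebesgue_row_homothety (x : 'rV[R]_n) (r : R) B : 0 < r -> measurable B ->
  lebesgue_row R n ((fun v => r^-1 *: (v - x)) @^-1` B) =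
  ((r ^+ n)%:E * lebesgue_row R n B)%E.
Proof.
move=> r0 mB; have rn0 : 0 <= r ^+ n by apply/exprn_ge0/ltW.
have H := measure_unique cboxes (fun k => cbox (fun=> - k%:R) (fun=> k%:R))
  measurable_cboxesE cboxes_setI _ bigcup_cbox
  (pushforward (lebesgue_row R n) (fun v => r^-1 *: (v - x)))
  (mscale (NngNum rn0) (lebesgue_row R n)).
have pre a b : (fun v : 'rV[R]_n => r^-1 *: (v - x)) @^-1` cbox a b =
    cbox (fun i => x 0 i + r * a i) (fun i => x 0 i + r * b i).
  apply/seteqP; split => v /= h i; move: (h i); rewrite !mxE.
    by rewrite mulrC ler_pdivlMr// ler_pdivrMr// lerBrDl lerBlDl ![_ * r]mulrC.
  by rewrite [X in _ -> _ <= X <= _]mulrC ler_pdivlMr// ler_pdivrMr// lerBrDl lerBlDl ![_ * r]mulrC.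
apply: H => //.
- by move=> i; do 2 eexists.
- exact: measurable_trans.
- move=> mf _ [a [b ->]]; rewrite /= /pushforward pre /mscale /=.
  have [ab|/existsNP[i abi]] := pselect (forall i, a i <= b i).
    rewrite !lebesgue_row_box// => [|i]; last by rewrite lerD2l ler_pM2l.
    rewrite -EFinM; congr EFin.
    have -> : r ^+ n = \prod_(i < n) r by rewrite prodr_const card_ord.
    rewrite -big_split/=; apply: eq_bigr => i _; ring.
  rewrite (_ : cbox a b = set0); last first.
    rewrite -subset0 => v /(_ i) /andP[h1 h2]; apply: abi.
    exact: le_trans h1 h2.
  rewrite measure0 mule0 (_ : cbox _ _ = set0) ?measure0//.
  rewrite -subset0 => v /(_ i) /andP[h1 h2]; apply: abi.
  by have := le_trans h1 h2; rewrite lerD2l ler_pM2l.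
- by move=> mf k; rewrite /= /pushforward pre; exact: lebesgue_row_box_fin.
Qed.

Lemma eball_fin x r : (lebesgue_row R n (eball x r) < +oo)%E.
Proof.
apply: le_lt_trans (lebesgue_row_box_fin (fun i => x 0 i - r) (fun i => x 0 i + r)).
apply: le_measure; rewrite ?inE; [exact: measurable_eball|exact: measurable_cbox|].
move=> y /= h i; have := le_trans (ler_coord_enorm (y - x) i) h.
by rewrite !mxE ler_norml; lra.
Qed.

(** [M] disjoint translates of a bounded piece of the hyperplane fit in a
    bounded region, for every [M]. *)
Lemma lebesgue_row_hyperplane (a : 'rV[R]_n) (b : R) (T : R) : a != 0 ->
  lebesgue_row R n (eball 0 T `&` [set x | dot a x = b]) = 0%E.
Proof.
move=> a0; set E := _ `&` _.
have mE : measurable E.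
  by apply: measurableI; [exact: measurable_eball|exact: measurable_hyperplane].
have aa : dot a a != 0 by apply: contra_neq a0; exact: dot_eq0.
pose C := eball (0 : 'rV[R]_n) (T + enorm a).
have E_fin : (lebesgue_row R n E < +oo)%E.
  apply: le_lt_trans (eball_fin 0 T); apply: le_measure; rewrite ?inE//; last by move=> v [].
  exact: measurable_eball.
have Ef : lebesgue_row R n E \is a fin_num by rewrite ge0_fin_numE.
have C_fin : (lebesgue_row R n C < +oo)%E by exact: eball_fin.
pose S (M i : nat) := (fun v : 'rV[R]_n => 1^-1 *: (v - (i%:R / M.+1%:R) *: a)) @^-1` E.
have mS M i : measurable (S M i).
  by apply: measurable_preimageT => //; exact: measurable_trans.
have SE M i : lebesgue_row R n (S M i) = lebesgue_row R n E.
  by rewrite lebesgue_row_homothety// expr1n mul1e.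
have key M : (M.+1%:R%:E * lebesgue_row R n E <= lebesgue_row R n C)%E.
  have -> : (M.+1%:R%:E * lebesgue_row R n E = lebesgue_row R n (\bigcup_(i in `I_M.+1) S M i))%E.
    rewrite bigcup_mkord measure_semi_additive//; first last.
    - by apply: bigsetU_measurable.
    - move=> i j _ _ [v [/= [_ hi] [_ hj]]].
      move: hi hj => /=; rewrite invr1 !scale1r !dotBr !dotZr => <- /eqP.
      rewrite [_ == _]eq_sym -subr_eq0.
      have -> : dot a v - i%:R / M.+1%:R * dot a a - (dot a v - j%:R / M.+1%:R * dot a a) =
        (j%:R - i%:R) * (dot a a / M.+1%:R) by ring.
      by rewrite mulf_eq0 mulf_eq0 (negbTE aa) invr_eq0 pnatr_eq0 !orbF subr_eq0 eqr_nat => /eqP.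
    rewrite (eq_bigr (fun=> lebesgue_row R n E)) => [|i _]; last exact: SE.
    by rewrite -(fineK Ef) sumEFin sumr_const card_ord -EFinM mulr_natl.
  apply: le_measure; rewrite ?inE.
  - exact: bigcup_measurable.
  - exact: measurable_eball.
  - move=> v [i /= iM [+ _]] /=; rewrite invr1 scale1r /C !eballE !subr0 => h.
    rewrite -[v](subrK ((i%:R / M.+1%:R) *: a)).
    apply: le_trans (ler_enormD _ _) _; apply: lerD => //.
    rewrite enormZ ler_piMl ?enorm_ge0// ger0_norm ?divr_ge0// ler_pdivrMr ?ltr0n//.
    by rewrite mul1r ler_nat ltnW.
have Cf : lebesgue_row R n C \is a fin_num by rewrite ge0_fin_numE// measure_ge0.
rewrite -(fineK Ef); congr EFin; apply/eqP; apply/contraT => E0.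
have Ep : 0 < fine (lebesgue_row R n E) by rewrite lt_neqAle eq_sym E0 fine_ge0.
have := key (Num.truncn (fine (lebesgue_row R n C) / fine (lebesgue_row R n E))).
rewrite -(fineK Ef) -(fineK Cf) -EFinM lee_fin -ler_pdivlMr// leNgt.
by rewrite truncnS_gt.
Qed.

Lemma lebesgue_row_point (x : 'rV[R]_n) : (0 < n)%N -> lebesgue_row R n [set x] = 0%E.
Proof.
move=> n0; pose e : 'rV[R]_n := 'e_(Ordinal n0).
have e0 : e != 0.
  by apply/eqP => /rowP /(_ (Ordinal n0)); rewrite !mxE !eqxx => /eqP; rewrite oner_eq0.
apply: (@subset_measure0 _ _ _ (lebesgue_row R n) _
    (eball 0 (enorm x) `&` [set y | dot e y = dot e x])).
- rewrite (_ : [set x] = eball x 0); first exact: measurable_eball.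
  apply/seteqP; split => [_ ->|y]; rewrite eballE; first by rewrite subrr enorm0.
  move=> h; apply/eqP; rewrite -subr_eq0; apply/eqP/enorm_eq0/eqP.
  by rewrite eq_le h enorm_ge0.
- by apply: measurableI; [exact: measurable_eball|exact: measurable_hyperplane].
- by move=> _ ->; split => //=; rewrite eballE subr0.
- exact: lebesgue_row_hyperplane.
Qed.

End lebesgue_homothety.

(** * Polytopes: vertices, error bounds and faces *)

(** Finitely many statements, each true for all small [e], hold simultaneously
    for small [e]; the sum of inverses serves as a maximum. *)
Lemma uniform_lower_pos (R : realType) (T : finType) (Q : T -> R -> Prop) :
  (forall i, exists2 e0, 0 < e0 & forall e, 0 < e <= e0 -> Q i e) ->
  exists2 e0, 0 < e0 & forall i e, 0 < e <= e0 -> Q i e.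
Proof.
move=> h; have [e0 e0P] := choice (fun i => let: ex_intro2 x p q := h i in ex_intro _ x (conj p q)).
have ge0 i : 0 <= (e0 i)^-1 by rewrite invr_ge0 ltW//; have [] := e0P i.
exists (1 + \sum_i (e0 i)^-1)^-1; first by rewrite invr_gt0 ltr_wpDr// sumr_ge0.
move=> i e /andP[ep eP]; have [p0 q] := e0P i; apply: q; rewrite ep/=.
apply: (le_trans eP); rewrite invf_ple ?posrE//; last by rewrite ltr_wpDr// sumr_ge0.
by rewrite (bigD1 i)//= addrCA lerDl addr_ge0// sumr_ge0.
Qed.

Lemma uniform_upper (R : realType) (T : finType) (Q : T -> R -> Prop) :
  (forall i, exists2 C0, 0 <= C0 & forall C, C0 <= C -> Q i C) ->
  exists2 C0, 0 <= C0 & forall i C, C0 <= C -> Q i C.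
Proof.
move=> h; have [e0 e0P] := choice (fun i => let: ex_intro2 x p q := h i in ex_intro _ x (conj p q)).
have ge0 i : 0 <= e0 i by have [] := e0P i.
exists (\sum_i e0 i); first by rewrite sumr_ge0.
move=> i C CP; have [p0 q] := e0P i; apply: q; apply: le_trans CP.
by rewrite (bigD1 i)//= lerDl sumr_ge0.
Qed.

Section polytope.
Variables (R : realType) (d m : nat) (a : 'I_m -> 'rV[R]_d) (b : 'I_m -> R).
Implicit Types (x y z v : 'rV[R]_d) (I J : {set 'I_m}).

Definition polyhedron : set 'rV[R]_d := [set x | forall i, dot (a i) x <= b i].
Local Notation A := polyhedron.

Definition active x : {set 'I_m} := [set i | dot (a i) x == b i]%SET.

(** Vanishes on [A] exactly on [pface I], and is affine; it measures how far a
    point of [A] is from satisfying the constraints of [I] with equality. *)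
Definition slack I x : R := \sum_(i in I) (b i - dot (a i) x).

Definition pface I : set 'rV[R]_d :=
  A `&` [set x | forall i, i \in I -> dot (a i) x = b i].

Definition pcone I : set 'rV[R]_d :=
  [set v | forall i, i \in I -> dot (a i) v <= 0].

(** Linear-algebraic form of extremality: the active constraints have full
    rank. *)
Definition extreme x := A x /\
  forall v, (forall i, i \in active x -> dot (a i) v = 0) -> v = 0.

Hypothesis compactA : compact A.

Lemma polyhedron_bounded : exists2 T : R, 0 < T & A `<=` eball 0 T.
Proof.
have [M [_ hM]] := compact_bounded compactA.
have M1 : M < `|M| + 1 by rewrite ltr_pwDr// ler_norm.
exists (d%:R * (`|M| + 1) + 1) => [|x Ax]; first by rewrite ltr_wpDl// mulr_ge0// addr_ge0.
rewrite eballE subr0; apply: (@le_trans _ _ (d%:R * (`|M| + 1))); last by rewrite lerDl.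
apply: ler_enorm_coord => i.
apply: le_trans (hM _ M1 _ Ax).
rewrite [in leRHS]/Num.norm /= mx_normrE.
exact: (le_bigmax _ (fun ij : 'I_1 * 'I_d => `|x ij.1 ij.2|) (0, i)).
Qed.

Lemma slack_ge0 I x : A x -> 0 <= slack I x.
Proof. by move=> Ax; apply: sumr_ge0 => i _; rewrite subr_ge0; exact: Ax. Qed.

Lemma slack_eq0 I x : A x -> slack I x = 0 -> pface I x.
Proof.
move=> Ax /eqP; rewrite psumr_eq0 => [/allP h|i _]; last by rewrite subr_ge0; exact: Ax.
split=> // i iI; have := h i (mem_index_enum i).
by rewrite iI/= subr_eq0 => /eqP.
Qed.

Lemma slackD I (t s : R) x y : t + s = 1 ->
  slack I (t *: x + s *: y) = t * slack I x + s * slack I y.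
Proof.
move=> ts; rewrite !mulr_sumr -big_split; apply: eq_bigr => i _ /=.
rewrite dotDr !dotZr; have -> : b i = (t + s) * b i by rewrite ts mul1r.
have -> : s = 1 - t by rewrite -ts addrAC subrr add0r.
ring.
Qed.

Lemma polyhedron_convex x y (t s : R) : A x -> A y -> 0 <= t -> 0 <= s ->
  t + s = 1 -> A (t *: x + s *: y).
Proof.
move=> Ax Ay t0 s0 ts i; rewrite dotDr !dotZr -[leRHS]mul1r -ts mulrDl.
by apply: lerD; exact: ler_wpM2l.
Qed.

Lemma pface_convex I x y (t s : R) : pface I x -> pface I y -> 0 <= t -> 0 <= s ->
  t + s = 1 -> pface I (t *: x + s *: y).
Proof.
move=> [Ax hx] [Ay hy] t0 s0 ts; split; first exact: polyhedron_convex.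
by move=> i iI; rewrite dotDr !dotZr hx// hy// -mulrDl ts mul1r.
Qed.

(** Moving from [x] along a direction that keeps the active constraints
    active, one must hit a new constraint, as [A] is bounded. *)
Lemma exit_point x v : A x -> v != 0 ->
  (forall i, i \in active x -> dot (a i) v = 0) ->
  exists2 t, 0 < t & A (x + t *: v) /\ active x \proper active (x + t *: v).
Proof.
move=> Ax v0 hv.
have [i0 i0P] : exists i, 0 < dot (a i) v.
  apply: contrapT => /forallNP h.
  have {}h i : dot (a i) v <= 0 by rewrite leNgt; apply/negP/h.
  have [T T0 hT] := polyhedron_bounded.
  have nv : 0 < enorm v.
    by rewrite lt_neqAle enorm_ge0 andbT eq_sym; apply: contra_neq v0; exact: enorm_eq0.
  pose t := (T + enorm x + 1) / enorm v.
  have t0 : 0 <= t by rewrite divr_ge0 ?enorm_ge0// !addr_ge0 ?enorm_ge0 ?(ltW T0).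
  have : A (x + t *: v).
    move=> i; rewrite dotDr dotZr -[leRHS]addr0; apply: lerD; first exact: Ax.
    exact: mulr_ge0_le0.
  move=> /hT; rewrite eballE subr0 => h1.
  have := ler_enormD (x + t *: v) (- x); rewrite addrAC subrr add0r enormN enormZ.
  rewrite ger0_norm// /t divfK ?gt_eqF//; lra.
pose g i := (b i - dot (a i) x) / dot (a i) v.
case: (@arg_minP _ _ _ i0 (fun i => 0 < dot (a i) v) g i0P) => i1 i1P hmin.
have s0 i : i \notin active x -> 0 < b i - dot (a i) x.
  by rewrite inE => h; rewrite subr_gt0 lt_neqAle h; exact: Ax.
have nact i : 0 < dot (a i) v -> i \notin active x.
  by move=> h; apply/negP => /hv h0; rewrite h0 ltxx in h.
have g0 : 0 < g i1 by rewrite divr_gt0// s0// nact.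
exists (g i1) => //; split.
  move=> i; rewrite dotDr dotZr.
  have [h|h] := leP (dot (a i) v) 0.
    rewrite -[leRHS]addr0; apply: lerD; first exact: Ax.
    by apply: mulr_ge0_le0 => //; exact: ltW.
  have := hmin i h; rewrite {2}/g ler_pdivlMr// => ?; lra.
apply/properP; split.
  apply/fintype.subsetP => i ia; rewrite inE dotDr dotZr hv// mulr0 addr0.
  by move: ia; rewrite inE.
exists i1; last exact: nact.
by rewrite inE dotDr dotZr /g divfK ?(gt_eqF i1P)// addrC subrK.
Qed.

(** A polytope is the convex hull of its extreme points: a point that is not
    extreme lies between two points with more active constraints. *)
Lemma polyhedron_ind (P : 'rV[R]_d -> Prop) :
  (forall x y t s, A x -> A y -> P x -> P y -> 0 <= t -> 0 <= s -> t + s = 1 ->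
    P (t *: x + s *: y)) ->
  (forall x, extreme x -> P x) -> forall x, A x -> P x.
Proof.
move=> Pconv Pext x; move: {2}(m - #|active x|)%N (leqnn (m - #|active x|)%N) => k.
have cardm I : (#|I| <= m)%N by rewrite -[leqRHS]card_ord max_card.
elim: k x => [|k IH] x xk Ax.
  apply: Pext; split=> // v hv; apply/eqP; apply: contraT => v0.
  have [t _ [_ /proper_card]] := exit_point Ax v0 hv.
  have := cardm (active (x + t *: v)); lia.
have [ex|] := pselect (extreme x); first exact: Pext.
move=> nex; have [v [hv v0]] : exists v,
    (forall i, i \in active x -> dot (a i) v = 0) /\ v != 0.
  apply: contrapT => h; apply: nex; split => // v hv.
  by apply/eqP; apply: contraT => v0; exfalso; apply: h; exists v.
have [t t0 [At /proper_card ct]] := exit_point Ax v0 hv.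
have [||s s0 [As /proper_card cs]] := exit_point (v := - v) Ax.
- by rewrite oppr_eq0.
- by move=> i /hv; rewrite dotNr => ->; rewrite oppr0.
have ts : t + s != 0 by rewrite gt_eqF// addr_gt0.
have -> : x = (s / (t + s)) *: (x + t *: v) + (t / (t + s)) *: (x + s *: - v).
  by apply/rowP => i; rewrite !mxE; field.
apply: Pconv => //.
- by apply: IH => //; rewrite -ltnS (leq_trans _ xk)// ltn_sub2l// (leq_trans ct).
- by apply: IH => //; rewrite -ltnS (leq_trans _ xk)// ltn_sub2l// (leq_trans cs).
- by rewrite divr_ge0// ltW// addr_gt0.
- by rewrite divr_ge0// ltW// addr_gt0.
- by field.
Qed.

(** An extreme point is determined by its active set, so there are finitely
    many of them. *)
Lemma extreme_uniform (Q : 'rV[R]_d -> R -> Prop) :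
  (forall x, extreme x -> exists2 C0, 0 <= C0 & forall C, C0 <= C -> Q x C) ->
  exists2 C0, 0 <= C0 & forall x, extreme x -> Q x C0.
Proof.
move=> h.
have [I|C0 C00 hC] := @uniform_upper R {set 'I_m}
    (fun I C => forall x, extreme x -> active x = I -> Q x C).
  have [[x [ex xI]]|no] := pselect (exists x, extreme x /\ active x = I); last first.
    by exists 0 => // C _ x ex xI; exfalso; apply: no; exists x.
  have [C0 C00 hC] := h x ex; exists C0 => // C CC y ey yI.
  suff -> : y = x by exact: hC.
  apply/eqP; rewrite -subr_eq0; apply/eqP; apply: ey.2 => i iy.
  have ix : i \in active x by rewrite xI -yI.
  by move: ix iy; rewrite !inE dotBr => /eqP -> /eqP ->; rewrite subrr.
by exists C0 => // x ex; exact: hC ex erefl.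
Qed.

(** Hoffman's error bound: both sides are convex in [x], so only the finitely
    many extreme points matter. *)
Lemma pface_error_bound I : pface I !=set0 ->
  exists2 C, 0 <= C & forall x, A x -> exists2 y, pface I y & enorm (x - y) <= C * slack I x.
Proof.
move=> [y0 y0F].
have [x ex|C C0 hC] := extreme_uniform
    (Q := fun x C => exists2 y, pface I y & enorm (x - y) <= C * slack I x).
  have [s0|s0] := eqVneq (slack I x) 0.
    exists 0 => // C C0; exists x; first exact: (slack_eq0 ex.1).
    by rewrite subrr enorm0 s0 mulr0.
  have sp : 0 < slack I x by rewrite lt_neqAle eq_sym s0 slack_ge0//; exact: ex.1.
  exists (enorm (x - y0) / slack I x); first by rewrite divr_ge0 ?enorm_ge0 ?ltW.
  by move=> C CC; exists y0 => //; rewrite -ler_pdivrMr.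
exists C => //; apply: polyhedron_ind => // x y t s Ax Ay [x' x'F hx] [y' y'F hy] t0 s0 ts.
exists (t *: x' + s *: y'); first exact: pface_convex.
have -> : t *: x + s *: y - (t *: x' + s *: y') = t *: (x - x') + s *: (y - y').
  by rewrite !scalerBr opprD addrACA.
apply: le_trans (ler_enormD _ _) _; rewrite !enormZ !ger0_norm// slackD// mulrDr.
by apply: lerD; rewrite mulrCA; apply: ler_wpM2l.
Qed.

(** The same argument when the face is empty: the slack, positive at the
    finitely many extreme points, is bounded away from zero. *)
Lemma pface_empty_bound I : pface I = set0 ->
  exists2 C, 0 <= C & forall x, A x -> 1 <= C * slack I x.
Proof.
move=> F0.
have [x ex|C C0 hC] := extreme_uniform (Q := fun x C => 1 <= C * slack I x).
  have sp : 0 < slack I x.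
    rewrite lt_neqAle slack_ge0 ?andbT//; last exact: ex.1.
    apply/eqP => /esym /(slack_eq0 ex.1); by rewrite F0.
  exists (slack I x)^-1; first by rewrite invr_ge0 ltW.
  by move=> C CC; rewrite -ler_pdivrMr// div1r.
exists C => //; apply: polyhedron_ind => // x y t s Ax Ay hx hy t0 s0 ts.
rewrite slackD// mulrDr -ts; apply: lerD; rewrite mulrCA -[leLHS]mulr1; exact: ler_wpM2l.
Qed.

Lemma is_face_refl : A !=set0 -> is_face A A.
Proof.
move=> A0; split => //; exists 0, 0.
have d0 x : dot 0 x = 0 by rewrite dotC dot0r.
by split=> [x _|]; [rewrite d0|apply/seteqP; split => [x Ax|x []//]; split=> //=; rewrite d0].
Qed.

Lemma pface_is_face I : pface I !=set0 -> is_face A (pface I).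
Proof.
move=> F0; split => //; exists (\sum_(i in I) a i), (\sum_(i in I) b i).
have h x : \sum_(i in I) b i - dot (\sum_(i in I) a i) x = slack I x.
  by rewrite /slack sumrB dot_suml.
split=> [x Ax|]; first by rewrite -subr_ge0 h slack_ge0.
apply/seteqP; split => [x [Ax hx]|x [Ax /= hx]].
  split=> //=; apply/eqP; rewrite eq_sym -subr_eq0 h; apply/eqP.
  by apply: big1 => i iI; rewrite hx// subrr.
by apply: slack_eq0 => //; rewrite -h hx subrr.
Qed.

(** The barycentre of points of [F] chosen, for each constraint, off the
    constraint whenever possible. *)
Lemma face_generic_point F : is_face A F -> exists2 z, F z &
  forall i, i \in active z -> forall x, F x -> dot (a i) x = b i.
Proof.
move=> [[w0 w0F] [c [e [hc FE]]]].
have wP i : exists w, F w /\ (dot (a i) w = b i -> forall x, F x -> dot (a i) x = b i).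
  have [h|/existsNP[w /not_implyP[wF hw]]] := pselect (forall x, F x -> dot (a i) x = b i).
    by exists w0; split.
  by exists w; split => // /hw.
have [w {}wP] := choice wP.
have FA x : F x -> A x by rewrite FE => -[].
have Fc x : F x -> dot c x = e by rewrite FE => -[].
have wA i : A (w i) by apply: FA; have [] := wP i.
have wc i : dot c (w i) = e by apply: Fc; have [] := wP i.
pose M : R := m.+1%:R; have M0 : 0 < M by rewrite ltr0n.
pose z := M^-1 *: (w0 + \sum_i w i).
have zE v : dot v z = M^-1 * (dot v w0 + \sum_i dot v (w i)).
  by rewrite dotZr dotDr dot_sumr.
have cst (r : R) : M^-1 * (r + \sum_(i < m) r) = r.
  by rewrite sumr_const card_ord -mulrS -mulr_natl mulrA mulVf ?mul1r// gt_eqF.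
exists z.
  rewrite FE; split=> [i|] /=; last by rewrite zE (Fc w0)// (eq_bigr (fun=> e)).
  rewrite zE -[leRHS]cst; apply: ler_wpM2l; first by rewrite invr_ge0 ltW.
  apply: lerD; first exact: (FA _ w0F).
  by apply: ler_sum => j _; exact: wA.
move=> i; rewrite inE => /eqP iz; apply: (wP i).2.
apply/eqP; rewrite eq_le wA/= leNgt; apply/negP => lt; move: iz.
apply/eqP; rewrite lt_eqF// zE -[ltRHS]cst ltr_pM2l ?invr_gt0//.
apply: ler_ltD; first exact: (FA _ w0F).
rewrite (bigD1 i)//= [ltRHS](bigD1 i)//=; apply: ltr_leD => //.
by apply: ler_sum => j _; exact: wA.
Qed.

Lemma active_margin z : A z -> exists2 e, 0 < e &
  forall y i, enorm (y - z) <= e -> i \notin active z -> dot (a i) y + e <= b i.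
Proof.
move=> Az.
have [i|e e0 he] := @uniform_lower_pos R 'I_m (fun i e =>
    forall y, enorm (y - z) <= e -> i \notin active z -> dot (a i) y + e <= b i).
  have ap : 0 < enorm (a i) + 1 by rewrite ltr_wpDl// enorm_ge0.
  have [ia|ia] := boolP (i \in active z); first by exists 1.
  have sp : 0 < b i - dot (a i) z.
    by rewrite subr_gt0 lt_neqAle (Az i) andbT; move: ia; rewrite inE.
  exists ((b i - dot (a i) z) / (enorm (a i) + 1)) => [|e /andP[e0 ee] y ye _].
    by rewrite divr_gt0.
  rewrite ler_pdivlMr// in ee.
  have -> : y = z + (y - z) by rewrite addrC subrK.
  rewrite dotDr; have := ler_dot_enorm (a i) (y - z); have := ler_norm (dot (a i) (y - z)).
  have : enorm (a i) * enorm (y - z) <= enorm (a i) * e by rewrite ler_wpM2l// enorm_ge0.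
  nra.
by exists e => // y i ye; apply: he => //; rewrite e0/=.
Qed.

(** A point of the right-hand side outside [F] would allow to continue the
    segment towards [z] slightly beyond [z] inside [A], and the functional
    that defines [F] would exceed its maximum. *)
Lemma face_pface F z : is_face A F -> F z ->
  (forall i, i \in active z -> forall x, F x -> dot (a i) x = b i) ->
  F = pface (active z).
Proof.
move=> [_ [c [e [hc FE]]]] Fz hz.
have [Az cz] : A z /\ dot c z = e by move: Fz; rewrite FE => -[].
apply/seteqP; split=> [x Fx|x [Ax hx]].
  by split=> [|i iz]; [move: Fx; rewrite FE => -[]|exact: hz].
rewrite FE; split => //=; apply/eqP; rewrite eq_le hc//= leNgt; apply/negP => lt.
have [e1 e10 he1] := active_margin Az.
pose t := e1 / (enorm (z - x) + 1).
have np : 0 < enorm (z - x) + 1 by rewrite ltr_wpDl// enorm_ge0.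
have t0 : 0 < t by rewrite divr_gt0.
have : A (z + t *: (z - x)).
  move=> i; have [ia|ia] := boolP (i \in active z).
    rewrite dotDr dotZr dotBr hx//; move: ia; rewrite inE => /eqP ->.
    by rewrite subrr mulr0 addr0.
  apply: le_trans (_ : dot (a i) (z + t *: (z - x)) + e1 <= _); first by rewrite lerDl ltW.
  apply: he1 => //; rewrite addrAC subrr add0r enormZ gtr0_norm// /t mulrAC.
  by rewrite ler_pdivrMr// ler_pM2l// lerDl.
move=> /hc; rewrite dotDr dotZr dotBr cz gerDl pmulr_rle0//; lra.
Qed.

Lemma affine_hull_hyperplane F c (e : R) y : (forall x, F x -> dot c x = e) ->
  affine_hull F y -> dot c y = e.
Proof.
move=> h [k [p [w [pF w1 ->]]]]; rewrite dot_sumr.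
rewrite (eq_bigr (fun i => w i * e)) => [|i _]; last by rewrite dotZr h.
by rewrite -mulr_suml w1 mul1r.
Qed.

Lemma face_relint F z : is_face A F -> F z ->
  (forall i, i \in active z -> forall x, F x -> dot (a i) x = b i) ->
  relative_interior F z.
Proof.
move=> FF Fz hz; split => //.
have Az : A z by move: FF Fz => [_ [c [e [hc ->]]]] [].
have [e e0 he] := active_margin Az.
apply: filterS (eball_nbhs z e0) => y ye yF.
rewrite (face_pface FF Fz hz); split.
  move=> i; have [ia|ia] := boolP (i \in active z).
    by rewrite (affine_hull_hyperplane (hz i ia) yF).
  by apply: le_trans (he _ _ ye ia); rewrite lerDl ltW.
by move=> i ia; exact: (affine_hull_hyperplane (hz i ia) yF).
Qed.

(** From a relative interior point [x] one can move slightly away from [z]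
    within [F]; a constraint active at [x] but not at [z] would then be
    violated. *)
Lemma relint_active F x z : is_face A F -> F z ->
  (forall i, i \in active z -> forall x, F x -> dot (a i) x = b i) ->
  relative_interior F x -> active x = active z.
Proof.
move=> FF Fz hz [Fx xn].
have FA u : F u -> A u by move: FF => [_ [c [e [hc ->]]]] [].
apply/setP => i; apply/idP/idP => [ix|iz]; last first.
  by rewrite inE; apply/eqP; exact: hz.
have [r r0 hr] := nbhs_eball xn.
have np : 0 < enorm (x - z) + 1 by rewrite ltr_wpDl// enorm_ge0.
pose t := r / (enorm (x - z) + 1); have t0 : 0 < t by rewrite divr_gt0.
have /FA /(_ i) : F (x + t *: (x - z)).
  apply: hr.
    rewrite eballE addrAC subrr add0r enormZ gtr0_norm// /t mulrAC.
    by rewrite ler_pdivrMr// ler_pM2l// lerDl.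
  exists 2%N, (fun i : 'I_2 => if i == 0 then x else z),
    (fun i : 'I_2 => if i == 0 then 1 + t else - t); split.
  - by move=> j; case: ifP.
  - by rewrite big_ord_recl big_ord1 /= addrK.
  - rewrite big_ord_recl big_ord1 /= scalerBr scalerDl scale1r scaleNr addrA//.
move: ix; rewrite inE dotDr dotZr dotBr => /eqP ->; rewrite gerDl pmulr_rle0// subr_le0 => h.
by rewrite inE eq_le h andbT; exact: (FA _ Fz).
Qed.

Lemma pcone_cone I : cone (pcone I).
Proof. by move=> t v t0 h i iI; rewrite dotZr pmulr_rle0//; exact: h. Qed.

Lemma pcone_local x : A x -> exists2 U, nbhs x U &
  A `&` U = [set x + v | v in pcone (active x)] `&` U.
Proof.
move=> Ax; have [e e0 he] := active_margin Ax.
exists (eball x e); first exact: eball_nbhs.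
apply/seteqP; split=> y [Ay yU]; split => //.
  exists (y - x); last by rewrite addrC subrK.
  move=> i ia; rewrite dotBr subr_le0; move: ia; rewrite inE => /eqP ->; exact: Ay.
move: Ay yU => [v hv <-] yU i; have [ia|ia] := boolP (i \in active x).
  by rewrite dotDr; have := hv i ia; move: ia; rewrite inE => /eqP ->; lra.
by apply: le_trans (he _ _ yU ia); rewrite lerDl ltW.
Qed.

(** Two cones that describe [A] near the same point agree, by scaling; near
    the generic point [z] the active constraints provide one. *)
Lemma face_cone_pcone F z : is_face A F -> F z ->
  (forall i, i \in active z -> forall x, F x -> dot (a i) x = b i) ->
  face_cone A F = pcone (active z).
Proof.
move=> FF Fz hz; have zr := face_relint FF Fz hz.
have FA u : F u -> A u by move: FF => [_ [c [e [hc ->]]]] [].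
have ex : is_face_cone A F (pcone (active z)).
  split; first exact: pcone_cone.
  move=> x xr; rewrite -(relint_active FF Fz hz xr); apply: pcone_local.
  by apply: FA; have [] := xr.
have [coneK KP] : is_face_cone A F (face_cone A F) by exact: getPex (ex_intro _ _ ex).
have [U Un UE] := KP z zr.
have [V Vn VE] := pcone_local (FA _ Fz).
have [r r0 hr] := nbhs_eball (filterI Un Vn).
have small v : exists2 t, 0 < t & eball z r (z + t *: v).
  have np : 0 < enorm v + 1 by rewrite ltr_wpDl// enorm_ge0.
  exists (r / (enorm v + 1)); first by rewrite divr_gt0.
  rewrite eballE addrAC subrr add0r enormZ gtr0_norm ?divr_gt0// mulrAC.
  by rewrite ler_pdivrMr// ler_pM2l// lerDl.
have scale K1 K2 (U1 U2 : set 'rV[R]_d) : cone K1 -> cone K2 -> A `&` U1 = [set z + v | v in K1] `&` U1 ->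
    A `&` U2 = [set z + v | v in K2] `&` U2 -> eball z r `<=` U1 -> eball z r `<=` U2 ->
    K1 `<=` K2.
  move=> cK1 cK2 E1 E2 h1 h2 v K1v; have [t t0 tb] := small v.
  have Av : A (z + t *: v).
    have : (A `&` U1) (z + t *: v).
      by rewrite E1; split; [exists (t *: v) => //; exact: cK1|exact: h1].
    by case.
  have : (A `&` U2) (z + t *: v) by split => //; exact: h2.
  rewrite E2 => -[[w K2w /addrI wE] _].
  have -> : v = t^-1 *: w by rewrite wE scalerA mulVf ?scale1r// gt_eqF.
  by apply: cK2 => //; rewrite invr_gt0.
have rU : eball z r `<=` U by move=> y /hr [].
have rV : eball z r `<=` V by move=> y /hr [].
apply/seteqP; split.
  exact: (scale _ _ _ _ coneK (@pcone_cone _) UE VE rU rV).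
exact: (scale _ _ _ _ (@pcone_cone _) coneK VE UE rV rU).
Qed.

Lemma pconeS I J : I \subset J -> pcone J `<=` pcone I.
Proof. by move=> /fintype.subsetP IJ v h i /IJ; exact: h. Qed.

Lemma measurable_pcone I : measurable (pcone I).
Proof.
rewrite (_ : pcone I = \bigcap_(i in [set i | i \in I]) [set v | dot (a i) v <= 0]).
  by apply: fin_bigcap_measurable => // i _; exact: measurable_halfspace.
by apply/seteqP; split => v h i; exact: h.
Qed.

Lemma measurable_polyhedron : measurable A.
Proof.
rewrite (_ : A = \bigcap_(i in [set: 'I_m]) [set v | dot (a i) v <= b i]).
  by apply: fin_bigcap_measurable => // i _; exact: measurable_halfspace.
by apply/seteqP; split => v h i; [move=> _; exact: h|exact: h].
Qed.

End polytope.

(** * Affine dimension, covering and packing numbers of faces *)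

Lemma truncn_gt_half (R : realType) (x : R) : 1 <= x -> x / 2 <= (Num.truncn x)%:R.
Proof.
move=> x1; have := truncnS_gt x; rewrite -natr1 => h.
have : 1 <= (Num.truncn x)%:R :> R by rewrite ler1n truncn_gt0.
lra.
Qed.

Section affine_dimension.
Variables (R : realType) (d : nat).
Implicit Types (F : set 'rV[R]_d) (x y z v : 'rV[R]_d).

Definition diff_mx j x (p : 'I_j -> 'rV[R]_d) : 'M[R]_(j, d) := \matrix_i (p i - x).

Lemma affine_dim_ge F j x (p : 'I_j -> 'rV[R]_d) : F x -> (forall i, F (p i)) ->
  row_free (diff_mx x p) -> (j <= affine_dim F)%N.
Proof.
move=> Fx Fp fr; have jd : (j < d.+1)%N.
  by rewrite ltnS; apply: leq_trans (rank_leq_col (diff_mx x p)); move/eqP: fr => ->.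
apply: (@leq_bigmax_cond _ _ (fun i : 'I_d.+1 => nat_of_ord i) (Ordinal jd)).
by apply/asboolP; exists x, p.
Qed.

Lemma affine_dim_le F : (affine_dim F <= d)%N.
Proof. by apply/bigmax_leqP => i _; rewrite -ltnS. Qed.

(** A frame of maximal length spans the differences, otherwise it could be
    extended. *)
Lemma affine_dim_frame F : F !=set0 -> exists x (p : 'I_(affine_dim F) -> 'rV[R]_d),
  [/\ F x, forall i, F (p i), row_free (diff_mx x p) &
      forall y, F y -> (y - x <= diff_mx x p)%MS].
Proof.
move=> [x0 x0F]; pose P (m : 'I_d.+1) := `[< exists (x : 'rV[R]_d) (p : 'I_m -> 'rV[R]_d),
      [/\ F x, forall i, F (p i) & row_free (\matrix_i (p i - x))] >].
have P0 : P ord0.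
  apply/asboolP; exists x0, (fun=> x0); split => //=.
  by rewrite /row_free flatmx0 mxrank0.
have [[k kd] Pk kE] : exists2 k : 'I_d.+1, P k & affine_dim F = k.
  have := @eq_bigmax_cond _ P (fun i : 'I_d.+1 => nat_of_ord i).
  rewrite /affine_dim => h; have [|k kP kE] := h; last by exists k.
  by apply/card_gt0P; exists ord0.
move: Pk kE => /asboolP[x [p [Fx Fp fr]]] /= kE; rewrite kE.
exists x, p; split=> // y Fy; apply/negPn/negP => nsub.
pose p' (i : 'I_k.+1) := if unlift ord0 i is Some i' then p i' else y.
have : (k.+1 <= affine_dim F)%N; last by rewrite kE ltnn.
apply: (@affine_dim_ge F k.+1 x p') => //.
  by move=> i; rewrite /p'; case: unlift => [i'|].
have M'i i : row (lift ord0 i) (diff_mx x p') = row i (diff_mx x p).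
  by rewrite !rowK /p' liftK.
have M'0 : row ord0 (diff_mx x p') = y - x by rewrite rowK /p' unlift_none.
rewrite /row_free eqn_leq rank_leq_row/=.
apply: (@leq_ltn_trans (\rank (diff_mx x p))).
  by move/eqP: fr => ->.
apply: (@leq_trans (\rank (diff_mx x p + (y - x))%MS)).
  apply: rank_ltmx; rewrite ltmxE addsmxSl/=; apply/negP => h.
  by move: nsub; apply/negP/negPn; apply: submx_trans h; exact: addsmxSr.
apply: mxrankS; rewrite addsmx_sub; apply/andP; split.
  by apply/row_subP => i; rewrite -M'i; exact: row_sub.
by rewrite -M'0; exact: row_sub.
Qed.

(** An operator norm up to a constant, used to bound coordinates in a
    frame. *)
Definition mxnorm1 j (B : 'M[R]_(d, j)) : R := \sum_i enorm (row i B^T).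

Lemma mxnorm1_ge0 j (B : 'M[R]_(d, j)) : 0 <= mxnorm1 B.
Proof. by apply: sumr_ge0 => i _; exact: enorm_ge0. Qed.

Lemma coord_mulmx_le j (B : 'M[R]_(d, j)) v i :
  `|(v *m B) 0 i| <= enorm v * mxnorm1 B.
Proof.
have -> : (v *m B) 0 i = dot v (row i B^T).
  by rewrite mxE; apply: eq_bigr => k _; rewrite !mxE.
apply: le_trans (ler_dot_enorm _ _) _; apply: ler_wpM2l; first exact: enorm_ge0.
by rewrite /mxnorm1 (bigD1 i)//= lerDl sumr_ge0// => k _; exact: enorm_ge0.
Qed.

Lemma enorm_mulmx_le j x (p : 'I_j -> 'rV[R]_d) (t : 'rV[R]_j) (c : R) :
  (forall i, `|t 0 i| <= c) ->
  enorm (t *m diff_mx x p) <= c * \sum_i enorm (p i - x).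
Proof.
move=> h; rewrite mulmx_sum_row mulr_sumr; apply: le_trans (ler_enorm_sum _ _ _) _.
by apply: ler_sum => i _; rewrite rowK enormZ ler_wpM2r// enorm_ge0.
Qed.

Lemma floor_grid (h B u : R) : 0 < h -> `|u| <= B ->
  exists k : 'I_(Num.truncn (2 * B / h)).+1, `|u - (- B + k%:R * h)| <= h.
Proof.
move=> h0; rewrite ler_norml => /andP[Bu uB].
have u0 : 0 <= (u + B) / h by rewrite divr_ge0 ?(ltW h0)//; lra.
have lt : (Num.truncn ((u + B) / h) < (Num.truncn (2 * B / h)).+1)%N.
  by rewrite ltnS; apply: le_truncn; rewrite ler_pM2r ?invr_gt0//; lra.
exists (Ordinal lt) => /=; have /andP[] := truncn_itv u0.
rewrite ler_pdivlMr// ltr_pdivrMr// -natr1 => h1 h2.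
rewrite ler_norml; lra.
Qed.

(** Take a grid of mesh of order [r] in the [j] coordinates of the affine
    hull, which has [O(r ^- j)] points as [F] is bounded, times a grid with
    boundedly many points for the displacement of length at most [C * r]. *)
Lemma affine_dim_cover F (T C eta : R) : F !=set0 -> F `<=` eball 0 T -> 0 <= C -> 0 < eta ->
  exists2 N0 : R, 0 < N0 & forall r, 0 < r <= 1 ->
  exists (I : finType) (g : I -> 'rV[R]_d), #|I|%:R * r ^+ affine_dim F <= N0 /\
    forall x, (exists2 y, F y & enorm (x - y) <= C * r) ->
      exists i, enorm (x - g i) <= eta * r.
Proof.
move=> F0 FT C0 eta0; have [x0 [p [Fx0 Fp fr span]]] := affine_dim_frame F0.
set j := affine_dim F in p Fp fr span *; set M := diff_mx x0 p in fr span *.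
have T0 : 0 <= T by apply: le_trans (FT _ Fx0); exact: enorm_ge0.
set K := mxnorm1 (pinvmx M); have K0 : 0 <= K := mxnorm1_ge0 _.
pose S := \sum_i enorm (p i - x0).
have S0 : 0 <= S by apply: sumr_ge0 => i _; exact: enorm_ge0.
pose h := eta / (S + d%:R + 1).
have den : 0 < S + d%:R + 1 by rewrite ltr_wpDl// addr_ge0.
have h0 : 0 < h by rewrite divr_gt0.
have hS : h * S + d%:R * h <= eta.
  by rewrite -mulrC -mulrDl /h mulrA ler_pdivrMr// mulrC ler_pM2l// lerDl.
pose B := 2 * T * K; have B0 : 0 <= B by rewrite !mulr_ge0.
exists ((2 * B / h + 1) ^+ j * ((Num.truncn (2 * C / h)).+1 ^ d)%:R).
  apply: mulr_gt0; last by rewrite ltr0n expn_gt0.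
  by apply/exprn_gt0/ltr_wpDl => //; apply: divr_ge0; [exact: mulr_ge0|exact: ltW].
move=> r /andP[r0 r1].
pose L := (Num.truncn (2 * B / (h * r))).+1.
pose L2 := (Num.truncn (2 * (C * r) / (h * r))).+1.
have hr0 : 0 < h * r by rewrite mulr_gt0.
have L2E : L2 = (Num.truncn (2 * C / h)).+1.
  by congr (Num.truncn _).+1; field; rewrite !gt_eqF.
exists ({ffun 'I_j -> 'I_L} * {ffun 'I_d -> 'I_L2})%type,
  (fun kl : {ffun 'I_j -> 'I_L} * {ffun 'I_d -> 'I_L2} => x0 + (\row_i (- B + (kl.1 i)%:R * (h * r))) *m M +
             \row_i (- (C * r) + (kl.2 i)%:R * (h * r))).
split.
  rewrite card_prod !card_ffun !card_ord natrM mulrAC -L2E ler_pM2r ?ltr0n ?expn_gt0//.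
  have q0 : 0 <= 2 * B / (h * r).
    by apply: divr_ge0; [exact: mulr_ge0|exact: ltW].
  rewrite natrX -exprMn lerXn2r// ?nnegrE; [by apply: mulr_ge0; rewrite ?ltW| |].
    by apply: addr_ge0 => //; apply: divr_ge0; [exact: mulr_ge0|exact: ltW].
  rewrite /L -natr1 mulrDl mul1r.
  have /andP[t1 _] := truncn_itv q0.
  apply: lerD => //; apply: le_trans (ler_wpM2r (ltW r0) t1) _.
  by rewrite invfM mulrA mulfVK// gt_eqF.
move=> x [y Fy xy].
pose t := (y - x0) *m pinvmx M.
have tM : t *m M = y - x0 by rewrite mulmxKpV// span.
have tB i : `|t 0 i| <= B.
  apply: le_trans (coord_mulmx_le _ _ _) _; apply: ler_wpM2r => //.
  apply: le_trans (ler_dist_enormD 0 _ _) _.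
  have := FT _ Fy; have := FT _ Fx0; rewrite !eballE !subr0 sub0r enormN; lra.
have wC i : `|(x - y) 0 i| <= C * r by apply: le_trans xy; exact: ler_coord_enorm.
have [k kP] := choice (fun i => floor_grid hr0 (tB i)).
have [l lP] := choice (fun i => floor_grid hr0 (wC i)).
exists ([ffun i => k i], [ffun i => l i]) => /=.
set tg := \row_i _; set wg := \row_i _.
have -> : x - (x0 + tg *m M + wg) = (t - tg) *m M + ((x - y) - wg).
  by rewrite mulmxBl tM; apply/rowP => i; rewrite !mxE; ring.
apply: le_trans (ler_enormD _ _) _.
apply: le_trans (_ : (h * r) * S + d%:R * (h * r) <= _).
  apply: lerD; first by apply: enorm_mulmx_le => i; have := kP i; rewrite !mxE ffunE.
  by apply: ler_enorm_coord => i; have := lP i; rewrite !mxE ffunE.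
by rewrite mulrAC mulrA -mulrDl ler_pM2r.
Qed.

(** [L] is of order [r^-1]: large enough for the count, and small enough for
    grid points with coordinates in the multiples of [s / (j * L + 1)] to
    remain [2 * r]-separated after the change of coordinates, which costs a
    factor [K]. The term [+ 1] avoids division by zero. *)
Lemma separated_grid (K s r : R) j : 0 < K -> 0 < s -> 0 < r -> r < s / (4 * (j.+1%:R * K)) ->
  let L := Num.truncn (s / (4 * (j.+1%:R * K) * r)) in
  (s / (8 * (j.+1%:R * K))) ^+ j <= (L ^ j)%:R * r ^+ j /\
  (j * L + 1)%:R * K * (2 * r) < s.
Proof.
move=> K0 s0 r0 rs; have j0 : 0 < j.+1%:R * K by rewrite mulr_gt0.
set q := s / _; move=> L.
have q1 : 1 <= q by rewrite /q ler_pdivlMr ?mulr_gt0// mul1r mulrC -ler_pdivlMr ?mulr_gt0// ltW.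
have Lq := truncn_gt_half q1; have /andP[Lq2 _] := truncn_itv (le_trans ler01 q1).
have L1 : (1 <= L)%N by rewrite /L truncn_gt0.
have sE : s = q * (4 * (j.+1%:R * K) * r) by rewrite /q divfK// gt_eqF// !mulr_gt0.
split.
  rewrite natrX -exprMn lerXn2r ?nnegrE//.
  - by rewrite divr_ge0 ?(ltW s0)// mulr_ge0// ltW.
  - by rewrite mulr_ge0// ltW.
  rewrite ler_pdivrMr ?mulr_gt0// {1}sE.
  have -> : q * (4 * (j.+1%:R * K) * r) = q / 2 * (r * (8 * (j.+1%:R * K))).
    have -> : 8 = 4 * 2 :> R by rewrite -natrM.
    by field.
  by rewrite -[leRHS]mulrA ler_pM2r ?mulr_gt0.
have h1 : (j * L + 1)%:R <= j.+1%:R * q.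
  apply: le_trans (_ : (j.+1 * L)%:R <= _); first by rewrite ler_nat mulSn addnC leq_add2r.
  by rewrite natrM ler_wpM2l.
rewrite [ltRHS]sE.
apply: le_lt_trans (_ : j.+1%:R * q * K * (2 * r) < _).
  apply: ler_wpM2r; first by rewrite mulr_ge0// ltW.
  by apply: ler_wpM2r => //; exact: ltW.
have := mulr_gt0 (mulr_gt0 j0 r0) (lt_le_trans ltr01 q1); nra.
Qed.

End affine_dimension.

Section faces_dimension.
Variables (R : realType) (d m : nat) (a : 'I_m -> 'rV[R]_d) (b : 'I_m -> R).
Implicit Types (x y z v : 'rV[R]_d) (I J : {set 'I_m}).
Local Notation A := (polyhedron a b).
Hypothesis compactA : compact A.

Lemma pface_simplex I j x (p : 'I_j -> 'rV[R]_d) (t : 'rV[R]_j) :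
  pface a b I x -> (forall i, pface a b I (p i)) ->
  (forall i, 0 <= t 0 i) -> \sum_i t 0 i <= 1 ->
  pface a b I (x + t *m diff_mx x p).
Proof.
move=> [Ax hx] Fp t0 t1.
have E i : dot (a i) (x + t *m diff_mx x p) =
    (1 - \sum_l t 0 l) * dot (a i) x + \sum_l t 0 l * dot (a i) (p l).
  rewrite dotDr mulmx_sum_row dot_sumr mulrBl mul1r mulr_suml -addrA -sumrN -big_split/=.
  by congr (_ + _); apply: eq_bigr => l _; rewrite rowK dotZr dotBr; ring.
have s1 i : b i = (1 - \sum_l t 0 l) * b i + \sum_l t 0 l * b i.
  by rewrite -mulr_suml -mulrDl subrK mul1r.
split=> [i|i iI].
  rewrite E [leRHS]s1; apply: lerD; first by rewrite ler_wpM2l ?subr_ge0.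
  by apply: ler_sum => l _; rewrite ler_wpM2l//; have [] := Fp l.
rewrite E [RHS]s1 hx//; congr (_ + _); apply: eq_bigr => l _.
by have [_ ->] := Fp l.
Qed.

(** Take a grid in a small copy, shrunk towards [x1], of the simplex spanned
    by [j + 1] affinely independent points of the face. *)
Lemma pface_packing I x1 (e : R) : pface a b I x1 -> 0 < e ->
  exists2 c : R, 0 < c & exists2 r0 : R, 0 < r0 & forall r, 0 < r < r0 ->
  exists (T : finType) (g : T -> 'rV[R]_d),
    [/\ c <= #|T|%:R * r ^+ affine_dim (pface a b I),
        forall t, pface a b I (g t), forall t, enorm (g t - x1) <= e &
        forall t t', t != t' -> 2 * r < enorm (g t - g t')].
Proof.
move=> Fx1 e0; have [T T0 hT] := polyhedron_bounded compactA.
have [x [p [Fx Fp fr _]]] := affine_dim_frame (ex_intro _ _ Fx1).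
set j := affine_dim _ in p Fp fr *; set M := diff_mx x p in fr.
set K := mxnorm1 (pinvmx M) + 1; have K0 : 0 < K by rewrite ltr_wpDl// mxnorm1_ge0.
pose s := Num.min 1 (e / (2 * T)).
have s0 : 0 < s by rewrite lt_min ltr01 divr_gt0// mulr_gt0.
have s1 : s <= 1 by rewrite ge_min lexx.
have se : s * (2 * T) <= e by rewrite -ler_pdivlMr ?mulr_gt0// ge_min lexx orbT.
have j0 : 0 < j.+1%:R * K by rewrite mulr_gt0.
exists ((s / (8 * (j.+1%:R * K))) ^+ j); first by rewrite exprn_gt0// divr_gt0// mulr_gt0.
exists (s / (4 * (j.+1%:R * K))); first by rewrite divr_gt0// mulr_gt0.
move=> r /andP[r0 rr]; have [] := separated_grid K0 s0 r0 rr; set L := Num.truncn _.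
move=> cL sepL; pose D : R := (j * L + 1)%:R.
have D0 : 0 < D by rewrite ltr0n addn1.
pose t (k : {ffun 'I_j -> 'I_L}) : 'rV[R]_j := \row_i ((k i)%:R / D).
pose q k := x + t k *m M.
have Fq k : pface a b I (q k).
  apply: pface_simplex => // [i|]; first by rewrite mxE divr_ge0// ltW.
  rewrite (eq_bigr (fun i => (k i)%:R / D)) => [|i _]; last by rewrite mxE.
  rewrite -mulr_suml ler_pdivrMr// mul1r -natr_sum ler_nat.
  apply: leq_trans (_ : j * L <= _)%N; last by rewrite leq_addr.
  have -> : (j * L = \sum_(i < j) L)%N by rewrite sum_nat_const card_ord.
  by apply: leq_sum => i _; exact: ltnW.
pose g k := (1 - s) *: x1 + s *: q k.
exists {ffun 'I_j -> 'I_L}, g; split.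
- by rewrite card_ffun !card_ord.
- by move=> k; apply: pface_convex; rewrite ?subr_ge0 ?subrK// ltW.
- move=> k; have -> : g k - x1 = s *: (q k - x1).
    by rewrite /g; move: (q k) => u; apply/rowP => l; rewrite !mxE; ring.
  rewrite enormZ gtr0_norm//; apply: le_trans se; rewrite ler_pM2l//.
  apply: le_trans (ler_dist_enormD 0 _ _) _.
  have := lerD (hT _ (Fq k).1) (hT _ Fx1.1); rewrite !subr0 sub0r enormN.
  by rewrite [in X in _ -> _ <= X]mulr_natl mulr2n.
- move=> k k' kk'; have [i ki] : exists i, k i != k' i.
    by apply/existsP; apply: contraR kk' => /existsPn h; apply/eqP/ffunP => i; apply/eqP/negPn/h.
  have gE : g k - g k' = s *: ((t k - t k') *m M).
    by rewrite /g mulmxBl /q; apply/rowP => l; rewrite !mxE; ring.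
  have tE : (t k - t k') = s^-1 *: ((g k - g k') *m pinvmx M).
    rewrite gE -scalemxAl scalerA mulVf ?gt_eqF// scale1r -mulmxA mulmxVp//.
    by rewrite mulmx1.
  have h1 : D^-1 <= `|(t k - t k') 0 i|.
    rewrite !mxE -mulrBl normrM (@gtr0_norm _ D^-1) ?invr_gt0//.
    rewrite ler_peMl ?invr_ge0 ?(ltW D0)//.
    have ge1 (u v : nat) : (u < v)%N -> 1 <= `|v%:R - u%:R : R|.
      by move=> uv; rewrite -natrB ?(ltnW uv)// ger0_norm// ler1n subn_gt0.
    have : (k i : nat) != k' i by [].
    by rewrite neq_ltn => /orP[] h; [rewrite distrC|]; exact: ge1.
  have h2 : `|(t k - t k') 0 i| <= s^-1 * (enorm (g k - g k') * K).
    rewrite tE mxE normrM gtr0_norm ?invr_gt0// ler_pM2l ?invr_gt0//.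
    apply: le_trans (coord_mulmx_le _ _ _) _; apply: ler_wpM2l; first exact: enorm_ge0.
    by rewrite lerDl.
  have := le_trans h1 h2; rewrite [leRHS]mulrC ler_pdivlMr// mulrC ler_pdivrMr// => h3.
  have : D * K * (2 * r) < enorm (g k - g k') * K * D by apply: lt_le_trans h3.
  have -> : D * K * (2 * r) = 2 * r * (K * D) by ring.
  by rewrite -[X in _ < X -> _]mulrA ltr_pM2r// mulr_gt0.
Qed.

(** A face of full dimension is [A] itself, since its constraints vanish on a
    spanning set of directions and are therefore trivial. *)
Lemma pface_faces_star I : pface a b I !=set0 -> faces_star A (pface a b I).
Proof.
move=> F0; have [lt|] := ltnP (affine_dim (pface a b I)) d.
  by left; split=> //; exact: pface_is_face.
move=> ge; right => /=.
have dE : affine_dim (pface a b I) = d by apply/eqP; rewrite eqn_leq ge affine_dim_le.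
have [x [p [Fx Fp fr _]]] := affine_dim_frame F0.
move: p Fp fr; rewrite dE => p Fp fr.
have a0 i : i \in I -> a i = 0.
  move=> iI; have : diff_mx x p *m (a i)^T = 0.
    apply/colP => l; rewrite !mxE; have [_ /(_ i iI) h1] := Fp l; have [_ /(_ i iI) h2] := Fx.
    transitivity (dot (a i) (p l - x)); last by rewrite dotBr h1 h2 subrr.
    by apply: eq_bigr => k _; rewrite !mxE mulrC.
  move: fr; rewrite row_free_unit => u h; apply: trmx_inj.
  by rewrite -(mul1mx (a i)^T) -(mulVmx u) -mulmxA h mulmx0 trmx0.
apply/seteqP; split => [y []//|y Ay]; split=> // i iI.
by have [_ /(_ i iI)] := Fx; rewrite a0// ![dot 0 _]dotC !dot0r.
Qed.

Lemma faces_star_is_face F : A !=set0 -> faces_star A F -> is_face A F.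
Proof. by move=> A0 [[]//|->]; exact: is_face_refl. Qed.

(** Otherwise the polytope would lie in a hyperplane. *)
Lemma polyhedron_interior : (0 < lebesgue_row R d A)%E ->
  exists z, exists2 e, 0 < e & eball z e `<=` A.
Proof.
move=> lA; have A0 : A !=set0.
  apply/set0P/negP => /eqP A0; by rewrite A0 measure0 ltxx in lA.
have [z Az hz] := face_generic_point (is_face_refl A0).
have ai0 i : i \in active a b z -> a i = 0.
  move=> iz; apply/eqP; apply: contraTT lA => ai0; rewrite -leNgt.
  have [T T0 hT] := polyhedron_bounded compactA.
  rewrite -(lebesgue_row_hyperplane (b i) T ai0); apply: le_measure; rewrite ?inE.
  - exact: measurable_polyhedron.
  - by apply: measurableI; [exact: measurable_eball|exact: measurable_hyperplane].
  - by move=> x Ax; split; [exact: hT|exact: hz].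
have [e e0 he] := active_margin Az.
exists z, e => // y ye i; have [iz|iz] := boolP (i \in active a b z).
  have := Az i; by rewrite ai0// ![dot 0 _]dotC !dot0r.
by apply: le_trans (he _ _ ye iz); rewrite lerDl ltW.
Qed.

Lemma affine_dim_interior F z e : 0 < e -> eball z e `<=` F -> affine_dim F = d.
Proof.
move=> e0 h; apply/eqP; rewrite eqn_leq affine_dim_le/=.
apply: (@affine_dim_ge _ _ F d z (fun i => z + e *: 'e_i)).
- by apply: h; rewrite eballE subrr enorm0 ltW.
- move=> i; apply: h; rewrite eballE addrAC subrr add0r enormZ gtr0_norm//.
  rewrite ler_piMr ?(ltW e0)// /enorm /dot (bigD1 i)//= big1 => [|k ki].
    by rewrite !mxE !eqxx/= mulr1 addr0 sqrtr1.
  by rewrite !mxE eqxx (negbTE ki) mulr0.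
- rewrite row_free_unit; have -> : diff_mx z (fun i => z + e *: 'e_i) = e%:M.
    apply/row_matrixP => i; rewrite rowK addrAC subrr add0r.
    by apply/rowP => k; rewrite !mxE eqxx/= eq_sym; case: eqP; rewrite ?mulr1 ?mulr0.
  by rewrite unitmxE det_scalar unitfE expf_neq0// gt_eqF.
Qed.

End faces_dimension.

(** * Mass of small balls, and the covering of the polytope *)

Section density.
Variables (R : realType) (d : nat).
Variables (mu : probability 'rV[R]_d R) (f : 'rV[R]_d -> R).
Hypothesis mu_density : is_density mu f.
Local Notation lam := (lebesgue_row R d).

Let mf : measurable_fun setT f. Proof. by have [] := mu_density. Qed.
Let f_ge0 x : 0 <= f x. Proof. by have [_ ->] := mu_density. Qed.
Let muE B : measurable B -> mu B = (\int[lam]_(x in B) (f x)%:E)%E.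
Proof. by move=> mB; have [_ _ ->] := mu_density. Qed.

Lemma density_ge B (c : R) : measurable B -> 0 <= c ->
  {ae lam, forall x, B x -> c <= f x} -> (c%:E * lam B <= mu B)%E.
Proof.
move=> mB c0 h; rewrite muE// -(integral_cst lam mB) ; apply: ae_ge0_le_integral => //.
- by move=> x _; rewrite lee_fin.
- by apply/measurable_EFinP; exact: measurable_funS mf.
Qed.

Lemma density_le B (c : R) : measurable B -> 0 <= c ->
  {ae lam, forall x, B x -> f x <= c} -> (mu B <= c%:E * lam B)%E.
Proof.
move=> mB c0 h; rewrite muE// -(integral_cst lam mB) ; apply: ae_ge0_le_integral => //.
- by move=> x _; rewrite lee_fin.
- by apply/measurable_EFinP; exact: measurable_funS mf.
Qed.

Lemma density_null B : measurable B -> lam B = 0%E -> mu B = 0%E.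
Proof.
move=> mB B0; apply/eqP; rewrite eq_le measure_ge0 andbT.
have := @density_le B 0 mB (lexx _); rewrite B0 mule0; apply.
by exists B; split=> // x /= h; apply: contrapT => nB; apply: h => /nB.
Qed.

(** The density may be positive outside [A], but only on a null set. *)
Lemma density_setI A B : measurable A -> mu A = 1%E -> measurable B ->
  mu B = mu (B `&` A).
Proof.
move=> mA muA mB; apply/eqP; rewrite eq_le; apply/andP; split; last first.
  by apply: le_measure; rewrite ?inE//; exact: measurableI.
have CA : mu (~` A) = 0%E by rewrite probability_setC// muA subee.
have BE : B = (B `&` A) `|` (B `&` ~` A) by rewrite -setIUr setUv setIT.
have mBA : measurable (B `&` A) by exact: measurableI.
have mBC : measurable (B `&` ~` A) by apply: measurableI => //; exact: measurableC.
rewrite {1}BE; apply: (le_trans (measureU2 mu mBA mBC)).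
rewrite [X in (_ + X <= _)%E](_ : _ = 0%E) ?adde0//.
by apply: (@subset_measure0 _ _ _ mu _ (~` A)) => //; exact: measurableC.
Qed.

End density.

Section cone_volume.
Variables (R : realType) (d : nat).
Local Notation lam := (lebesgue_row R d).

Lemma lebesgue_row_unit_ball : (0 < lam (eball 0 1))%E.
Proof.
pose e : R := (d%:R + 1)^-1; have e0 : 0 < e by rewrite invr_gt0 ltr_wpDl.
apply: (@lt_le_trans _ _ (lam (cbox (fun=> - e) (fun=> e)))).
  rewrite lebesgue_row_box => [|i]; last by rewrite ge0_cp// ltW.
  by rewrite lte_fin prodr_gt0// => i _; rewrite opprK addr_gt0.
apply: le_measure; rewrite ?inE; [exact: measurable_cbox|exact: measurable_eball|].
move=> v h; rewrite eballE subr0.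
apply: le_trans (ler_enorm_coord (c := e) _) _; first by move=> i; rewrite ler_norml.
by rewrite ler_pdivrMr ?mul1r ?lerDl// ltr_wpDl.
Qed.

(** A cone is invariant under scaling, so the homothety from [x] with ratio
    [r] carries the truncated cone to its translate. *)
Lemma lebesgue_row_cone_ball K x (r : R) : measurable K -> cone K -> 0 < r ->
  lam ([set y | K (y - x)] `&` eball x r) = ((r ^+ d)%:E * lam (K `&` eball 0 1))%E.
Proof.
move=> mK cK r0; rewrite -(lebesgue_row_homothety x)//; last first.
  by apply: measurableI => //; exact: measurable_eball.
congr (lam _); apply/seteqP; split=> y /= [Ky yr].
  split; first by apply: cK => //; rewrite invr_gt0.
  by rewrite eballE subr0 enormZ gtr0_norm ?invr_gt0// ler_pdivrMl// mulr1.
split.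
  have -> : y - x = r *: (r^-1 *: (y - x)) by rewrite scalerA divff ?gt_eqF// scale1r.
  exact: cK.
by move: yr; rewrite !eballE subr0 enormZ gtr0_norm ?invr_gt0// ler_pdivrMl// mulr1.
Qed.

Lemma lebesgue_row_ball x (r : R) : 0 < r ->
  lam (eball x r) = ((r ^+ d)%:E * lam (eball 0 1))%E.
Proof.
move=> r0; rewrite -[eball 0 1]setTI -(lebesgue_row_cone_ball x)//.
by congr (lam _); apply/seteqP; split => [y yr|y []].
Qed.

Lemma eball_gt0 x (r : R) : 0 < r -> (0 < lam (eball x r))%E.
Proof.
move=> r0; rewrite lebesgue_row_ball// mule_gt0 ?lebesgue_row_unit_ball//.
by rewrite lte_fin exprn_gt0.
Qed.

Variables (m : nat) (a : 'I_m -> 'rV[R]_d) (b : 'I_m -> R).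
Local Notation A := (polyhedron a b).

Definition cone_volume (I : {set 'I_m}) : R := fine (lam (pcone a I `&` eball 0 1)).

Lemma cone_volumeE I : lam (pcone a I `&` eball 0 1) = (cone_volume I)%:E.
Proof.
rewrite fineK// ge0_fin_numE ?measure_ge0//; apply: le_lt_trans (eball_fin 0 1).
apply: le_measure; rewrite ?inE; [|exact: measurable_eball|exact: subIsetr].
by apply: measurableI; [exact: measurable_pcone|exact: measurable_eball].
Qed.

Lemma cone_volumeS (I J : {set 'I_m}) : I \subset J -> cone_volume J <= cone_volume I.
Proof.
move=> IJ; rewrite -lee_fin -!cone_volumeE; apply: le_measure; rewrite ?inE.
- by apply: measurableI; [exact: measurable_pcone|exact: measurable_eball].
- by apply: measurableI; [exact: measurable_pcone|exact: measurable_eball].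
- by apply: setSI; exact: pconeS.
Qed.

(** The cone contains the directions from [x] to the ball inside [A]. *)
Lemma cone_volume_gt0 z (e : R) (I : {set 'I_m}) x : 0 < e -> eball z e `<=` A -> A x ->
  I \subset active a b x -> 0 < cone_volume I.
Proof.
move=> e0 zA Ax IJ; apply: lt_le_trans (cone_volumeS IJ).
pose s := (enorm (z - x) + e)^-1.
have s0 : 0 < s by rewrite invr_gt0 ltr_wpDl// enorm_ge0.
rewrite -lte_fin -cone_volumeE; apply: (@lt_le_trans _ _ (lam (eball (s *: (z - x)) (s * e)))).
  by apply: eball_gt0; rewrite mulr_gt0.
apply: le_measure; rewrite ?inE; first exact: measurable_eball.
  by apply: measurableI; [exact: measurable_pcone|exact: measurable_eball].
move=> v; rewrite eballE => vb.
have Av : A (x + s^-1 *: v).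
  apply: zA; rewrite eballE.
  have -> : x + s^-1 *: v - z = s^-1 *: (v - s *: (z - x)).
    by rewrite scalerBr scalerA mulVf ?gt_eqF// scale1r; apply/rowP => i; rewrite !mxE; ring.
  rewrite enormZ gtr0_norm; last by rewrite invr_gt0.
  by rewrite (ler_pdivrMl _ _ s0).
split.
  move=> i; rewrite inE => /eqP ia; have := Av i.
  by rewrite dotDr dotZr ia gerDl pmulr_rle0// invr_gt0.
rewrite eballE subr0 -[v](subrK (s *: (z - x))).
apply: le_trans (ler_enormD _ _) _; rewrite enormZ gtr0_norm//.
apply: le_trans (lerD vb (lexx _)) _.
by rewrite -mulrDr [e + _]addrC /s mulVf// gt_eqF// ltr_wpDl// enorm_ge0.
Qed.

(** A constraint outside [I] cannot be violated within distance [r] of [x]. *)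
Lemma pcone_ball_sub (I : {set 'I_m}) x (r : R) : A x ->
  (forall i, i \notin I -> dot (a i) x + r * enorm (a i) <= b i) ->
  [set y | pcone a I (y - x)] `&` eball x r `<=` A.
Proof.
move=> Ax h y [Ky yr] i; have [iI|iI] := boolP (i \in I).
  by apply: le_trans (Ax i); rewrite -subr_le0 -dotBr; exact: Ky.
rewrite -[y](subrK x) addrC dotDr; apply: le_trans (h i iI); rewrite lerD2l.
apply: le_trans (ler_norm _) _; apply: le_trans (ler_dot_enorm _ _) _.
by rewrite mulrC ler_wpM2r// enorm_ge0.
Qed.

Lemma ball_pcone_sub (I : {set 'I_m}) x (r : R) : (forall i, i \in I -> dot (a i) x = b i) ->
  A `&` eball x r `<=` [set y | pcone a I (y - x)] `&` eball x r.
Proof.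
move=> h y [Ay yr]; split => // i iI /=.
by rewrite dotBr h// subr_le0; exact: Ay.
Qed.

End cone_volume.

(** * The density near the faces *)

Lemma bernoulli_expr (R : realType) (d : nat) (x : R) : 0 <= x <= 1 ->
  1 - d%:R * x <= (1 - x) ^+ d.
Proof.
move=> /andP[x0 x1]; elim: d => [|k IH]; first by rewrite expr0 mul0r subr0.
rewrite exprS; apply: le_trans (ler_wpM2l _ IH); last by rewrite subr_ge0.
rewrite -natr1; have : 0 <= k%:R * x ^+ 2 by rewrite mulr_ge0// sqr_ge0.
rewrite expr2; lra.
Qed.

(** The loss from shrinking a ball by the factor [1 - 2 * eta] is paid by the
    margin [eps / 2], by Bernoulli's inequality. *)
Lemma shrunken_mass (R : realType) (d : nat) (g eps eta : R) : 0 < g -> 0 < eps ->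
  0 < eta -> eta <= 4^-1 -> 4 * (d%:R + 1) * g * eta <= eps ->
  0 < 1 - 2 * eta <= 1 /\ g - eps <= (g - eps / 2) * (1 - 2 * eta) ^+ d.
Proof.
move=> g0 eps0 eta0 eta1 eta2; split; first by apply/andP; split; lra.
have bern : 1 - d%:R * (2 * eta) <= (1 - 2 * eta) ^+ d by apply: bernoulli_expr; lra.
have p1 : (1 - 2 * eta) ^+ d <= 1 by apply: exprn_ile1; lra.
have p0 : 0 <= (1 - 2 * eta) ^+ d by apply: exprn_ge0; lra.
have de : 0 <= g * (d%:R * (2 * eta)).
  by rewrite mulr_ge0 ?(ltW g0)// mulr_ge0// mulr_ge0// ltW.
have ge : 0 <= g * eta by rewrite mulr_ge0// ltW.
have : (g - eps / 2) * (1 - (1 - 2 * eta) ^+ d) <= g * (d%:R * (2 * eta)).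
  have [gs|gs] := lerP 0 (g - eps / 2); last first.
    by apply: le_trans de; apply: mulr_le0_ge0; [exact: ltW|rewrite subr_ge0].
  by apply: ler_pM => //; [rewrite subr_ge0|lra|lra].
move: eta2; have -> : 4 * (d%:R + 1) * g * eta = 2 * (g * (d%:R * (2 * eta))) + 4 * (g * eta) by ring.
move: (g * (d%:R * _)) ((1 - 2 * eta) ^+ d) p0 p1 => u v p0 p1; lra.
Qed.

Section density_near_faces.
Variables (R : realType) (d : nat) (m : nat) (a : 'I_m -> 'rV[R]_d) (b : 'I_m -> R).
Local Notation A := (polyhedron a b).
Local Notation lam := (lebesgue_row R d).
Hypothesis compactA : compact A.
Variables (mu : probability 'rV[R]_d R) (f : 'rV[R]_d -> R).
Hypothesis mu_A : mu A = 1%E.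
Hypothesis mu_density : is_density mu f.
Hypothesis f_cont : forall x, boundary A x -> f y @[y --> within A (nbhs x)] --> f x.
Hypothesis f0_gt0 : (0 < ess_inf_on A f)%E.
Implicit Types (x y z : 'rV[R]_d).

Let mA : measurable A. Proof. exact: measurable_polyhedron. Qed.

Lemma lebesgue_polytope_gt0 : (0 < lam A)%E.
Proof.
rewrite lt_neqAle measure_ge0 andbT; apply/eqP => /esym A0.
have := density_null mu_density mA A0; rewrite mu_A => /eqP.
by rewrite onee_eq0.
Qed.

Lemma polytope_ball : exists z, exists2 e : R, 0 < e & eball z e `<=` A.
Proof. exact: polyhedron_interior compactA lebesgue_polytope_gt0. Qed.

Lemma polytope_neq0 : A !=set0.
Proof. by have [z [e e0 h]] := polytope_ball; exists z; apply: h; rewrite eballE subrr enorm0 ltW. Qed.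

Lemma affine_dim_polytope : affine_dim A = d.
Proof. by have [z [e e0 h]] := polytope_ball; exact: affine_dim_interior e0 h. Qed.

Definition f0 : R := fine (ess_inf_on A f).

Lemma ess_inf_onE : ess_inf_on A f = f0%:E.
Proof.
rewrite /f0 fineK// fin_numE; apply/andP; split; first by rewrite gt_eqF// (lt_trans _ f0_gt0).
apply/eqP => /ess_inf_eqyP[N [mN N0 sN]].
have : (lam A <= lam N)%E.
  apply: le_measure; rewrite ?inE// => x Ax; apply: sN => /=.
  by rewrite mem_set.
by rewrite N0 leNgt lebesgue_polytope_gt0.
Qed.

Lemma f0_pos : 0 < f0.
Proof. by rewrite -lte_fin -ess_inf_onE. Qed.

Lemma f0_ae : {ae lam, forall x, A x -> f0 <= f x}.
Proof.
have := ess_inf_le lam (fun x => if x \in A then (f x)%:E else +oo%E).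
rewrite -/(ess_inf_on A f) ess_inf_onE; apply: filterS => x + Ax.
by rewrite mem_set.
Qed.

Lemma f0_max c : {ae lam, forall x, A x -> c <= f x} -> c <= f0.
Proof.
move=> h; rewrite -lee_fin -ess_inf_onE; apply/ess_infP; apply: filterS h => x h.
by case: ifPn => [/set_mem/h//|_]; rewrite leey.
Qed.

Lemma faces_neq F : faces A F -> F <> A.
Proof. by move=> [_ lt] FA; move: lt; rewrite FA affine_dim_polytope ltnn. Qed.

Lemma faces_boundary F x : faces A F -> F x -> boundary A x.
Proof.
move=> FF; have FA := faces_neq FF; move: FF => [[_ [c [e [hc FE]]]] _] Fx.
have [Ax cx] : A x /\ dot c x = e by move: Fx; rewrite FE => -[].
split; first exact: subset_closure.
move=> /nbhs_eball[r r0 hr].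
have [c0|c0] := eqVneq c 0.
  apply: FA; rewrite FE; apply/seteqP; split => [y []//|y Ay]; split => //=.
  by rewrite -cx c0 ![dot 0 _]dotC !dot0r.
have nc : 0 < enorm c.
  by rewrite lt_neqAle enorm_ge0 andbT eq_sym; apply: contra_neq c0; exact: enorm_eq0.
have : A (x + (r / enorm c) *: c).
  apply: hr; rewrite eballE addrAC subrr add0r enormZ gtr0_norm ?divr_gt0//.
  by rewrite divfK// gt_eqF.
move=> /hc; rewrite dotDr cx dotZr gerDl pmulr_rle0 ?divr_gt0// -enorm_sqr.
by rewrite leNgt exprn_gt0.
Qed.

Lemma boundary_approx x (e : R) : boundary A x -> 0 < e ->
  exists2 r : R, 0 < r & forall y, A y -> enorm (y - x) <= r -> `|f x - f y| < e.
Proof.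
move=> bx e0; have /cvgrPdist_lt/(_ e e0) := f_cont bx.
by move=> /nbhs_eball[r r0 hr]; exists r => // y Ay yr; exact: hr.
Qed.

Lemma small_ball_gt0 x (r : R) : A x -> 0 < r -> (0 < lam (A `&` eball x r))%E.
Proof.
move=> Ax r0; have [z [e e0 zA]] := polytope_ball.
have [e1 e10 he1] := active_margin Ax.
have [c c0 hc] : exists2 c : R, 0 < c & forall i, c * enorm (a i) <= e1.
  have [i|c c0 hc] := @uniform_lower_pos R 'I_m (fun i c => c * enorm (a i) <= e1).
    exists (e1 / (enorm (a i) + 1)); first by rewrite divr_gt0// ltr_wpDl// enorm_ge0.
    move=> c /andP[c0]; rewrite ler_pdivlMr ?ltr_wpDl ?enorm_ge0//.
    by apply: le_trans; rewrite ler_pM2l// lerDl.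
  by exists c => // i; apply: hc; rewrite c0/=.
pose s := Num.min c r; have s0 : 0 < s by rewrite lt_min c0.
have sub : [set y | pcone a (active a b x) (y - x)] `&` eball x s `<=` A.
  apply: pcone_ball_sub => // i ia.
  apply: le_trans (he1 x i _ ia); last by rewrite subrr enorm0 ltW.
  rewrite lerD2l; apply: le_trans (hc i); apply: ler_wpM2r; first exact: enorm_ge0.
  by rewrite ge_min lexx.
have mK := measurable_pcone a (active a b x).
apply: (@lt_le_trans _ _ (lam ([set y | pcone a (active a b x) (y - x)] `&` eball x s))).
  rewrite lebesgue_row_cone_ball//; last exact: pcone_cone.
  rewrite cone_volumeE -EFinM lte_fin mulr_gt0 ?exprn_gt0//.
  exact: (cone_volume_gt0 e0 zA Ax).
apply: le_measure; rewrite ?inE.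
- apply: measurableI; last exact: measurable_eball.
  rewrite (_ : [set y | _] = (fun v => 1 *: (v - x)) @^-1` pcone a (active a b x)).
    by apply: measurable_preimageT => //; exact: measurable_trans.
  by apply/seteqP; split => y /=; rewrite scale1r.
- by apply: measurableI => //; exact: measurable_eball.
- move=> y [Ky yr]; split; first exact: sub.
  by apply: le_trans yr _; rewrite ge_min lexx orbT.
Qed.

(** If [f] were smaller at a boundary point, then by continuity also on a
    neighbourhood in [A], which has positive measure. *)
Lemma f0_le_boundary x : A x -> boundary A x -> f0 <= f x.
Proof.
move=> Ax bx; rewrite leNgt; apply/negP => lt.
have [||r r0 hr] := @boundary_approx x (f0 - f x); rewrite ?subr_gt0//.
have [N [mN N0 sN]] := f0_ae.
have := small_ball_gt0 Ax r0; rewrite ltNge => /negP; apply.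
rewrite -N0; apply: le_measure; rewrite ?inE//.
  by apply: measurableI => //; exact: measurable_eball.
move=> y [Ay yr]; apply: sN => /= h; have := hr y Ay yr; have := h Ay.
by rewrite ltr_norml => ? /andP[? ?]; lra.
Qed.

Lemma face_infE F : faces A F -> face_inf A f F = inf [set f x | x in F].
Proof. by move=> /faces_neq/eqP/negbTE FA; rewrite /face_inf FA. Qed.

Lemma face_inf_polytope : face_inf A f A = f0.
Proof. by rewrite /face_inf eqxx. Qed.

Lemma faces_has_inf F : faces A F -> has_inf [set f x | x in F].
Proof.
move=> FF; have [[[x Fx] [c [e [_ FE]]]] _] := FF; split; first by exists (f x), x.
exists f0 => _ [y Fy <-]; apply: f0_le_boundary; last exact: faces_boundary FF Fy.
by move: Fy; rewrite FE => -[].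
Qed.

Lemma face_inf_ge F : faces_star A F -> f0 <= face_inf A f F.
Proof.
move=> [FF|->]; last by rewrite face_inf_polytope.
rewrite face_infE//; have [[[x Fx] [c [e [_ FE]]]] _] := FF.
apply: lb_le_inf; first by exists (f x), x.
move=> _ [y Fy <-]; apply: f0_le_boundary; last exact: faces_boundary FF Fy.
by move: Fy; rewrite FE => -[].
Qed.

Lemma face_inf_gt0 F : faces_star A F -> 0 < face_inf A f F.
Proof. by move=> /face_inf_ge; apply: lt_le_trans; exact: f0_pos. Qed.

(** At a generic point of the face the active constraints are those that hold
    on all of it, so that they determine both the face and its cone. *)
Lemma faces_star_generic F : faces_star A F -> exists z, [/\ F z, A z,
  F = pface a b (active a b z), angular_volume A F = cone_volume a (active a b z) &
  forall i, (forall x, F x -> dot (a i) x = b i) -> i \in active a b z].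
Proof.
move=> FF; have F' := faces_star_is_face polytope_neq0 FF.
have [z Fz hz] := face_generic_point F'; exists z.
have FE := face_pface F' Fz hz; split => //.
- by move: F' => [_ [c [e [_ FE']]]]; move: Fz; rewrite FE' => -[].
- by rewrite /angular_volume (face_cone_pcone F' Fz hz).
- by move=> i hi; rewrite inE hi.
Qed.

Lemma angular_volume_gt0 F : faces_star A F -> 0 < angular_volume A F.
Proof.
move=> /faces_star_generic[z [Fz Az _ -> _]]; have [z' [e e0 zA]] := polytope_ball.
exact: (cone_volume_gt0 e0 zA Az).
Qed.

(** By compactness of the face, continuity of the density at its points gives
    a lower bound uniformly close to it; for the polytope itself the bound is
    the essential infimum. *)
Lemma density_near_face F (eps : R) : faces_star A F -> 0 < eps ->
  exists2 r : R, 0 < r & {ae lam, forall y, A y ->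
    (exists2 x, F x & enorm (y - x) <= r) -> face_inf A f F - eps <= f y}.
Proof.
move=> FF eps0; have [z [Fz Az FE _ _]] := faces_star_generic FF.
case: FF => [FF|->]; last first.
  exists 1 => //; apply: filterS f0_ae => y h Ay _; apply: le_trans (h Ay).
  by rewrite face_inf_polytope gerBl ltW.
suff [r r0 hr] : exists2 r : R, 0 < r & forall y, A y ->
    (exists2 x, F x & enorm (y - x) <= r) -> face_inf A f F - eps <= f y.
  by exists r => //; apply: aeW.
have := (compact_near_coveringP A).1 compactA R (0^'+)
  (fun r x => F x -> forall y, A y -> enorm (y - x) <= r -> face_inf A f F - eps <= f y) _.
case=> [x Ax|r /= r0 hr].
  have [Fx|nFx] := pselect (F x).
    have [r r0 hr] := boundary_approx (faces_boundary FF Fx) eps0.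
    exists (eball x (r / 2), [set t | 0 < t <= r / 2]) => /=.
      split; first by apply: eball_nbhs; rewrite divr_gt0.
      near=> t; apply/andP; split; first by near: t; exact: nbhs_right_gt.
      by near: t; apply: nbhs_right_le; rewrite divr_gt0.
    move=> [x' t] /= [xx' /andP[t0 tr]] Fx' y Ay yx'.
    have := hr y Ay; have -> : enorm (y - x) <= r.
      apply: le_trans (ler_dist_enormD x' _ _) _; rewrite [r]splitr.
      by apply: lerD => //; apply: le_trans tr.
    move=> /(_ isT); rewrite ltr_norml => /andP[_ h].
    have : face_inf A f F <= f x.
      by rewrite face_infE//; apply: ge_inf; [exact: (faces_has_inf FF).2|exists x].
    lra.
  have [i iz ix] : exists2 i, i \in active a b z & i \notin active a b x.
    apply: contrapT => h; apply: nFx; rewrite FE; split => // i iz.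
    have : i \in active a b x by apply: contrapT => /negP ix; apply: h; exists i.
    by rewrite inE => /eqP.
  have [e e0 he] := active_margin Ax.
  exists (eball x e, setT) => /=; first by split; [exact: eball_nbhs|exact: filterT].
  move=> [x' t] /= [xx' _] Fx'; exfalso.
  have := he x' i xx' ix; move: Fx'; rewrite FE => -[_ /(_ i iz) ->].
  by rewrite gerDl leNgt e0.
exists (r / 2); first by rewrite divr_gt0.
move=> y Ay [x Fx yx]; apply: (hr (r / 2) _ _ x) => //=.
- by rewrite sub0r normrN gtr0_norm ?divr_gt0// ltr_pdivrMr// ltr_pMr// ltr1n.
- by rewrite divr_gt0.
- by move: Fx; rewrite FE => -[].
Unshelve. all: by end_near. Qed.

Lemma face_mass_gt0 F : faces_star A F -> 0 < face_inf A f F * angular_volume A F.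
Proof. by move=> FF; rewrite mulr_gt0// ?face_inf_gt0// angular_volume_gt0. Qed.

(** The constraints that a ball of radius [r] about [x] can violate. *)
Definition near_active (r : R) x : {set 'I_m} :=
  [set i | b i < dot (a i) x + r * enorm (a i)]%SET.

Lemma measurable_shift_pcone x (I : {set 'I_m}) : measurable [set y | pcone a I (y - x)].
Proof.
rewrite (_ : [set y | _] = (fun v => 1 *: (v - x)) @^-1` pcone a I).
  by apply: measurable_preimageT; [exact: measurable_trans|exact: measurable_pcone].
by apply/seteqP; split => y /=; rewrite scale1r.
Qed.

(** Since a point [x] of [A] satisfies all constraints, the ball around [x]
    contains the truncated cone at [x] of the constraints it can violate, and
    that cone contains the cone of [F]. *)
Lemma face_ball_mass F (eps : R) : faces_star A F -> 0 < eps ->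
  exists2 e1 : R, 0 < e1 & forall x (r : R) (I : {set 'I_m}), 0 < r -> A x ->
    (forall i, i \in I -> forall y, F y -> dot (a i) y = b i) ->
    (forall i, i \notin I -> dot (a i) x + r * enorm (a i) <= b i) ->
    (exists2 y, F y & enorm (x - y) + r <= e1) ->
    (((face_inf A f F * angular_volume A F - eps) * r ^+ d)%:E <= mu (eball x r))%E.
Proof.
move=> FF eps0; have rho0 := angular_volume_gt0 FF.
have fF0 := face_inf_gt0 FF.
have [z [Fz Az FE rhoE hz]] := faces_star_generic FF.
pose eps' := Num.min (eps / angular_volume A F) (face_inf A f F).
have eps'0 : 0 < eps' by rewrite lt_min divr_gt0.
have [e1 e10 he1] := density_near_face FF eps'0.
exists e1 => // x r I r0 Ax IF Ix [y0 Fy0 xy0].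
have IJ : I \subset active a b z by apply/fintype.subsetP => i iI; exact: hz (IF i iI).
pose S := [set y | pcone a I (y - x)] `&` eball x r.
have SA : S `<=` A by exact: pcone_ball_sub.
have mS : measurable S.
  by apply: measurableI; [exact: measurable_shift_pcone|exact: measurable_eball].
have c0 : 0 <= face_inf A f F - eps' by rewrite subr_ge0 ge_min lexx orbT.
apply: (@le_trans _ _ (mu S)); last first.
  by apply: le_measure; rewrite ?inE//; [exact: measurable_eball|exact: subIsetr].
apply: (@le_trans _ _ ((face_inf A f F - eps')%:E * lam S)%E); last first.
  apply: (density_ge mu_density mS c0); apply: filterS he1 => y hy Sy.
  apply: hy; first exact: SA.
  exists y0 => //; apply: le_trans (ler_dist_enormD x _ _) _.
  by apply: le_trans xy0; rewrite addrC lerD2l; have [] := Sy.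
rewrite lebesgue_row_cone_ball//; [|exact: measurable_pcone|exact: pcone_cone].
rewrite cone_volumeE -!EFinM lee_fin [leRHS]mulrA [leRHS]mulrAC.
apply: ler_wpM2r; first by rewrite exprn_ge0// ltW.
apply: (@le_trans _ _ ((face_inf A f F - eps') * angular_volume A F)).
  rewrite mulrBl lerB// -ler_pdivlMr// ge_min lexx//.
by rewrite rhoE; apply: ler_wpM2l => //; exact: cone_volumeS.
Qed.

(** The centres [x] with [near_active r x = I] lie within [O(r)] of
    [pface a b I], so that [O(r ^- j)] slightly smaller balls suffice, where [j]
    is the dimension of that face. *)
Lemma face_cover (I : {set 'I_m}) (eps : R) : 0 < eps ->
  exists2 C : R, 0 < C & exists2 r0 : R, 0 < r0 & forall r, 0 < r <= r0 ->
  exists (T : finType) (D : T -> set 'rV[R]_d),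
    [/\ forall t, measurable (D t), forall t : T, faces_star A (pface a b I),
        #|T|%:R * r ^+ affine_dim (pface a b I) <= C,
        forall t, (((face_inf A f (pface a b I) * angular_volume A (pface a b I) - eps)
                     * r ^+ d)%:E <= mu (D t))%E &
        forall x, A x -> near_active r x = I -> exists t, D t `<=` eball x r].
Proof.
move=> eps0; pose S := \sum_(i in I) enorm (a i).
have S0 : 0 <= S by apply: sumr_ge0 => i _; exact: enorm_ge0.
have slackS r x : A x -> near_active r x = I -> slack a b I x <= r * S.
  move=> Ax xI; rewrite mulr_sumr; apply: ler_sum => i; rewrite -xI inE => h.
  by rewrite lerBlDl ltW.
have [F0|/eqP/set0P F0] := pselect (pface a b I = set0).
  have [C C0 hC] := pface_empty_bound compactA F0.
  exists 1 => //; exists (2 * (C * S + 1))^-1.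
    by rewrite invr_gt0 mulr_gt0// ltr_wpDl// mulr_ge0.
  move=> r /andP[r0 rr]; exists 'I_0, (fun=> set0); split; try by case.
    by rewrite card_ord mul0r.
  move=> x Ax xI; exfalso; have := hC x Ax; apply/negP; rewrite -ltNge.
  apply: (@le_lt_trans _ _ (C * (r * S))); first by apply: ler_wpM2l => //; exact: slackS.
  rewrite mulrCA; have CS : 0 <= C * S by rewrite mulr_ge0.
  apply: (@le_lt_trans _ _ ((2 * (C * S + 1))^-1 * (C * S))); first by rewrite ler_wpM2r.
  rewrite ltr_pdivrMl ?mulr_gt0 ?ltr_wpDl//.
  move: (C * S) CS => u u0; apply: (@lt_le_trans _ _ (u + 1)); first by rewrite ltrDl.
  by rewrite mulr1 ler_peMl ?ler1n// addr_ge0.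
have FF := pface_faces_star F0; set F := pface a b I in F0 FF *.
set g := face_inf A f F * angular_volume A F.
have g0 : 0 < g by exact: face_mass_gt0.
have [C C0 hC] := pface_error_bound compactA F0.
have e20 : 0 < eps / 2 by rewrite divr_gt0.
have [e1 e10 he1] := face_ball_mass FF e20.
pose eta := Num.min 4^-1 (eps / (4 * (d%:R + 1) * g)).
have d1 : 0 < d%:R + 1 :> R by rewrite ltr_wpDl.
have dg : 0 < 4 * (d%:R + 1) * g by apply: mulr_gt0 => //; apply: mulr_gt0.
have eta0 : 0 < eta by rewrite lt_min invr_gt0 ltr0n/= divr_gt0.
have eta1 : eta <= 4^-1 by rewrite ge_min lexx.
have eta2 : 4 * (d%:R + 1) * g * eta <= eps.
  by rewrite mulrC -ler_pdivlMr// ge_min lexx orbT.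
have [/andP[e20' e21] shr] := shrunken_mass g0 eps0 eta0 eta1 eta2.
have [T T0 hT] := polyhedron_bounded compactA.
have FT : F `<=` eball 0 T by move=> y [Ay _]; exact: hT.
have [N0 N00 hN] := affine_dim_cover F0 FT (mulr_ge0 C0 S0) eta0.
exists N0 => //; pose r0 := Num.min 1 (e1 / (C * S + 1)).
have CS1 : 0 < C * S + 1 by rewrite ltr_wpDl// mulr_ge0.
exists r0 => [|r /andP[rp rr0]]; first by rewrite lt_min ltr01 divr_gt0.
have r1 : r <= 1 by apply: le_trans rr0 _; rewrite ge_min lexx.
have re1 : C * S * r + r <= e1.
  rewrite -[X in _ + X]mul1r -mulrDl mulrC -ler_pdivlMr//.
  by apply: le_trans rr0 _; rewrite ge_min lexx orbT.
have [|J [q [cardJ hq]]] := hN r; first by rewrite rp.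
pose good (t : J) := `[< exists x, [/\ A x, near_active r x = I & enorm (x - q t) <= eta * r] >].
exists {t : J | good t}, (fun t => eball (q (val t)) ((1 - eta) * r)); split => //.
- by move=> t; exact: measurable_eball.
- apply: le_trans cardJ; apply: ler_wpM2r; first by rewrite exprn_ge0// ltW.
  by rewrite ler_nat card_sig max_card.
- move=> [t /= /asboolP[x [Ax xI xq]]].
  have r2 : 0 < (1 - 2 * eta) * r by rewrite mulr_gt0.
  have := he1 x ((1 - 2 * eta) * r) I r2 Ax.
  have [y Fy xy] := hC x Ax.
  have le1 : (1 - 2 * eta) * r <= r by rewrite ler_piMl// ltW.
  move=> h; apply: (@le_trans _ _ (mu (eball x ((1 - 2 * eta) * r)))); last first.
    apply: le_measure; rewrite ?inE; [exact: measurable_eball|exact: measurable_eball|].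
    apply: eball_sub; apply: le_trans (lerD xq (lexx _)) _.
    rewrite -mulrDl ler_wpM2r ?(ltW rp)//.
    by rewrite mulr_natl mulr2n opprD addrCA addNKr.
  apply: (le_trans _ (h _ _ _)).
  + rewrite lee_fin exprMn mulrA; apply: ler_wpM2r => //.
    by rewrite exprn_ge0// ltW.
  + by move=> i iI y' [_]; apply.
  + move=> i; rewrite -xI inE -leNgt; apply: le_trans; rewrite lerD2l.
    by apply: ler_wpM2r => //; exact: enorm_ge0.
  + exists y => //; apply: le_trans re1; apply: lerD => //; apply: le_trans xy _.
    by rewrite -mulrA; apply: ler_wpM2l => //; rewrite mulrC; exact: slackS.
- move=> x Ax xI; have [|t tx] := hq x.
    have [y Fy xy] := hC x Ax; exists y => //; apply: le_trans xy _.
    by rewrite -mulrA; apply: ler_wpM2l => //; rewrite mulrC; exact: slackS.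
  have gt : good t by apply/asboolP; exists x.
  exists (exist _ t gt) => /=; apply: eball_sub.
  by rewrite enorm_distC; apply: le_trans (lerD tx (lexx _)) _; rewrite -mulrDl addrC subrK mul1r.
Qed.

(** Sort the centres [x] by the set [near_active r x], apply [face_cover] to
    each of the finitely many classes, and take common constants. *)
Lemma polytope_cover (eps : R) : 0 < eps ->
  exists2 C : R, 0 < C & exists2 r0 : R, 0 < r0 & forall r, 0 < r <= r0 ->
  exists (T : {set 'I_m} -> finType) (D : forall I, T I -> set 'rV[R]_d),
    [/\ forall I t, measurable (D I t), forall I (t : T I), faces_star A (pface a b I),
        forall I, #|T I|%:R * r ^+ affine_dim (pface a b I) <= C,
        forall I t, (((face_inf A f (pface a b I) * angular_volume A (pface a b I) - eps)
                     * r ^+ d)%:E <= mu (D I t))%E &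
        forall x, A x -> exists I t, D I t `<=` eball x r].
Proof.
move=> eps0.
have [C hC] := choice (fun I => let: ex_intro2 x p q := @face_cover I eps eps0 in ex_intro _ x (conj p q)).
have C0 I : 0 < C I by have [] := hC I.
exists (1 + \sum_I C I); first by rewrite ltr_wpDr// sumr_ge0// => I _; exact: ltW.
have [I|r0 r00 hr] := @uniform_lower_pos R {set 'I_m} (fun I r =>
    exists (T : finType) (D : T -> set 'rV[R]_d),
    [/\ forall t, measurable (D t), forall t : T, faces_star A (pface a b I),
        #|T|%:R * r ^+ affine_dim (pface a b I) <= C I,
        forall t, (((face_inf A f (pface a b I) * angular_volume A (pface a b I) - eps)
                     * r ^+ d)%:E <= mu (D t))%E &
        forall x, A x -> near_active r x = I -> exists t, D t `<=` eball x r]).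
  by have [_] := hC I.
exists r0 => // r rr.
have /choice[T hT] : forall I : {set 'I_m}, exists T : finType, exists (D : T -> set 'rV[R]_d),
    [/\ forall t, measurable (D t), forall t : T, faces_star A (pface a b I),
        #|T|%:R * r ^+ affine_dim (pface a b I) <= C I,
        forall t, (((face_inf A f (pface a b I) * angular_volume A (pface a b I) - eps)
                     * r ^+ d)%:E <= mu (D t))%E &
        forall x, A x -> near_active r x = I -> exists t, D t `<=` eball x r].
  by move=> I; exact: hr.
exists T; exists (fun I => projT1 (cid (hT I))).
split=> [I t|I t|I|I t|x Ax].
- by case: (projT2 (cid (hT I))).
- by case: (projT2 (cid (hT I))) => _ h _ _ _; exact: h t.
- case: (projT2 (cid (hT I))) => _ _ h _ _; apply: le_trans h _.
  rewrite (bigD1 I)//= addrCA lerDl addr_ge0// sumr_ge0// => J _; exact: ltW.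
- by case: (projT2 (cid (hT I))).
- exists (near_active r x); case: (projT2 (cid (hT (near_active r x)))) => _ _ _ _; exact.
Qed.

End density_near_faces.

(** * Approximation by dyadic cells *)

Section dyadic.
Variables (R : realType) (d : nat) (M : probability 'rV[R]_d R).
Implicit Types (u v : 'rV[R]_d) (B V : set 'rV[R]_d).

Definition dyadic_label h v : 'rV[int]_d := \row_i Num.floor (v 0 i * 2 ^+ h).

Definition dyadic_union h V := forall u v, dyadic_label h u = dyadic_label h v -> V u -> V v.

Lemma dyadic_label_refine h h' u v : (h <= h')%N ->
  dyadic_label h' u = dyadic_label h' v -> dyadic_label h u = dyadic_label h v.
Proof.
move=> hh' E; have p0 k : 0 < 2 ^+ k :> R by rewrite exprn_gt0.
suff le (u1 v1 : 'rV[R]_d) : dyadic_label h' u1 = dyadic_label h' v1 ->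
    forall i, Num.floor (u1 0 i * 2 ^+ h) <= Num.floor (v1 0 i * 2 ^+ h).
  by apply/rowP => i; rewrite !mxE; apply/eqP; rewrite eq_le !le.
move=> {}E i; rewrite floor_ge_int.
set q := Num.floor _.
have : (q * 2 ^+ (h' - h))%:~R <= v1 0 i * 2 ^+ h'.
  rewrite -floor_ge_int; move/rowP/(_ i) : E; rewrite !mxE => <-.
  rewrite floor_ge_int -(subnKC hh') exprD mulrA intrM rmorphXn/= addnC addnK.
  by rewrite ler_pM2r// floor_le.
rewrite -{2}(subnKC hh') exprD mulrA intrM rmorphXn/=.
by rewrite ler_pM2r.
Qed.

Lemma dyadic_union_le h h' V : (h <= h')%N -> dyadic_union h V -> dyadic_union h' V.
Proof. by move=> hh' hV u v E; apply: hV; exact: dyadic_label_refine E. Qed.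

Lemma measurable_dyadic_cell h k : measurable [set v | dyadic_label h v = k].
Proof.
rewrite (_ : [set v | _] = \bigcap_(i in [set: 'I_d])
    ((fun v : 'rV[R]_d => v 0 i) @^-1` `[(k 0 i)%:~R / 2 ^+ h, (k 0 i + 1)%:~R / 2 ^+ h[)).
  apply: fin_bigcap_measurable => // i _.
  by rewrite -[X in measurable X]setTI; apply: measurable_mx_coord => //.
have p0 : 0 < 2 ^+ h :> R by rewrite exprn_gt0.
apply/seteqP; split => v /=.
  move=> <- i _ /=; rewrite in_itv/= !mxE ler_pdivrMr// ltr_pdivlMr//.
  exact: floor_itv.
move=> H; apply/rowP => i; rewrite mxE; apply: floor_def.
by have := H i Logic.I; rewrite /= in_itv/= ler_pdivrMr// ltr_pdivlMr.
Qed.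

(** Labels are encoded as natural numbers so that sigma-additivity applies to
    the countably many pieces. *)
Definition dyadic_piece h V n : set 'rV[R]_d :=
  V `&` [set v | choice.pickle (dyadic_label h v) = n].

Lemma dyadic_pieceE h V n v : dyadic_union h V -> dyadic_piece h V n v ->
  dyadic_piece h V n = [set u | dyadic_label h u = dyadic_label h v].
Proof.
move=> hV [Vv vn]; apply/seteqP; split => u.
  by move=> [Vu /=]; rewrite -vn => /(pcan_inj choice.pickleK).
by move=> /= uv; split => /=; [exact: hV Vv|rewrite uv].
Qed.

Lemma measurable_dyadic_piece h V n : dyadic_union h V -> measurable (dyadic_piece h V n).
Proof.
move=> hV; have [->|/set0P[v vV]] := eqVneq (dyadic_piece h V n) set0.
  exact: measurable0.
by rewrite (dyadic_pieceE hV vV); exact: measurable_dyadic_cell.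
Qed.

Lemma bigcup_dyadic_piece h V : \bigcup_n dyadic_piece h V n = V.
Proof.
apply/seteqP; split => [v [n _ []]//|v Vv].
by exists (choice.pickle (dyadic_label h v)).
Qed.

Lemma trivIset_dyadic_piece h V : trivIset setT (dyadic_piece h V).
Proof. by move=> i j _ _ [v [[_ /= <-] [_ /= <-]]]. Qed.

Lemma measurable_dyadic_union h V : dyadic_union h V -> measurable V.
Proof.
move=> hV; rewrite -(bigcup_dyadic_piece h V).
by apply: bigcupT_measurable => n; exact: measurable_dyadic_piece.
Qed.

Definition sdiff B V := (B `\` V) `|` (V `\` B).

Lemma measurable_sdiff B V : measurable B -> measurable V -> measurable (sdiff B V).
Proof. by move=> mB mV; apply: measurableU; exact: measurableD. Qed.

Definition dyadic_approx B := measurable B /\ forall eta : R, 0 < eta ->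
  exists h V, dyadic_union h V /\ (M (sdiff B V) < eta%:E)%E.

Lemma dyadic_approx_setC B : dyadic_approx B -> dyadic_approx (~` B).
Proof.
move=> [mB aB]; split; first exact: measurableC.
move=> eta eta0; have [h [V [hV MV]]] := aB eta eta0.
exists h, (~` V); split; first by move=> u v E nV /(hV v u (esym E)).
by rewrite /sdiff !setDE !setCK setIC [X in _ `|` X]setIC setUC.
Qed.

(** Approximate the first [N] sets, with [N] so large that the rest of the
    union has small mass, at a common level. *)
Lemma dyadic_approx_bigcup (F : (set 'rV[R]_d)^nat) :
  (forall n, dyadic_approx (F n)) -> dyadic_approx (\bigcup_n F n).
Proof.
move=> aF; have mF n : measurable (F n) by have [] := aF n.
have mU : measurable (\bigcup_n F n) by exact: bigcupT_measurable.
split=> // eta eta0; pose U N := \big[setU/set0]_(i < N) F i.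
have mUN N : measurable (U N) by exact: bigsetU_measurable.
have [N MN] : exists N, (M (\bigcup_n F n `\` U N) < (eta / 2)%:E)%E.
  have UF : \bigcup_n F n = \bigcup_N U N.
    apply/seteqP; split => v [n _]; first by exists n.+1 => //; rewrite /U -bigcup_mkord; exists n => /=.
    by rewrite /U -bigcup_mkord => -[i _ Fi]; exists i.
  have : (M \o U) x @[x --> \oo] --> M (\bigcup_n U n).
    apply: nondecreasing_cvg_mu => //; first by rewrite -UF.
    by move=> i j ij; apply/subsetPset; exact: subset_bigsetU.
  have fU := fin_num_measure M _ mU.
  rewrite -UF -(fineK fU) => /fine_cvgP[_ /cvgrPdist_lt/(_ (eta / 2))].
  rewrite divr_gt0// => /(_ isT)[N _ /(_ N (leqnn N)) /=] => h; exists N.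
  rewrite measureD//; last by rewrite ltey_eq fin_num_measure.
  rewrite setIidr; last by rewrite UF; exact: bigcup_sup.
  rewrite -(fineK (fin_num_measure M _ mU)) -(fineK (fin_num_measure M _ (mUN N))).
  by rewrite -EFinB lte_fin; apply: le_lt_trans h; rewrite ler_norm.
have e0 : 0 < eta / (2 * N.+1%:R) by rewrite divr_gt0// mulr_gt0.
have [h hP] := choice (fun n => (aF n).2 _ e0).
have [V {}hP] := choice hP.
pose H := (\max_(i < N) h i)%N.
pose W := \big[setU/set0]_(i < N) V i.
have hW : dyadic_union H W.
  move=> u v E; rewrite /W -!bigcup_mkord => -[i /= iN Vu]; exists i => //.
  have [hV _] := hP i; apply: hV Vu; apply: dyadic_label_refine E.
  exact: (@leq_bigmax_cond _ _ (fun i : 'I_N => h i) (Ordinal iN)).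
exists H, W; split => //.
have mS i : measurable (sdiff (F i) (V i)).
  by apply: measurable_sdiff => //; apply: (@measurable_dyadic_union (h i)); have [] := hP i.
have mSS : measurable (\big[setU/set0]_(i < N) sdiff (F i) (V i)) by exact: bigsetU_measurable.
have mUU : measurable (\bigcup_n F n `\` U N) by exact: measurableD.
have sub : sdiff (\bigcup_n F n) W `<=`
    (\bigcup_n F n `\` U N) `|` \big[setU/set0]_(i < N) sdiff (F i) (V i).
  rewrite -(bigcup_mkord N (fun i => sdiff (F i) (V i))) /sdiff => v [[Fv nW]|[Wv nF]].
    have [Uv|nU] := pselect (U N v); last by left.
    right; move: Uv nW; rewrite /U /W -!bigcup_mkord => -[i /= iN Fi] nW.
    by exists i => //; left; split => // Vi; apply: nW; exists i.
  right; move: Wv; rewrite /W -!bigcup_mkord => -[i /= iN Vi].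
  by exists i => //; right; split => // Fi; apply: nF; exists i.
apply: (@le_lt_trans _ _ (M (\bigcup_n F n `\` U N) +
    M (\big[setU/set0]_(i < N) sdiff (F i) (V i)))%E).
  apply: (le_trans _ (measureU2 M mUU mSS)); apply: le_measure; rewrite ?inE//.
    by apply: measurable_sdiff => //; exact: measurable_dyadic_union hW.
  exact: measurableU.
have -> : eta = eta / 2 + eta / 2 by rewrite -splitr.
rewrite EFinD; apply: lte_leD => //; first exact: fin_num_measure.
apply: (le_trans (Boole_inequality M (fun i _ => mS i))).
apply: (@le_trans _ _ (\sum_(i < N) (eta / (2 * N.+1%:R))%:E)%E).
  by apply: lee_sum => i _; apply: ltW; have [] := hP i.
rewrite sumEFin lee_fin sumr_const card_ord -[_ *+ N]mulr_natl.
rewrite invfM mulrCA ler_pM2l// mulrCA ler_piMr// ler_pdivrMr ?ltr0n//.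
by rewrite mul1r ler_nat.
Qed.

Lemma dyadic_approx_halfspace i (x : R) : dyadic_approx [set v : 'rV[R]_d | x <= v 0 i].
Proof.
have mH (y : R) : measurable [set v : 'rV[R]_d | y <= v 0 i].
  rewrite (_ : [set v | _] = (fun v : 'rV[R]_d => v 0 i) @^-1` `[y, +oo[).
    by rewrite -[X in measurable X]setTI; apply: measurable_mx_coord => //.
  by apply/seteqP; split => v /=; rewrite in_itv/= andbT.
split=> // eta eta0.
pose S h := [set v : 'rV[R]_d | x - (2 ^+ h)^-1 <= v 0 i] `\` [set v | x <= v 0 i].
have mS h : measurable (S h) by apply: measurableD; exact: mH.
have p0 k : 0 < 2 ^+ k :> R by rewrite exprn_gt0.
have S0 : \bigcap_h S h = set0.
  rewrite -subset0 => v vS; have [_ /negP] := vS 0%N Logic.I; rewrite -ltNge => vx.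
  have /ltr_add_invr[k] : 0 < x - v 0 i by rewrite subr_gt0.
  rewrite add0r => kx; have [h _] := vS k Logic.I.
  have : (2 ^+ k)^-1 <= k.+1%:R^-1 :> R.
    by rewrite lef_pV2 ?posrE// -natrX ler_nat ltn_expl.
  by move: h => /=; rewrite lerBlDr -lerBlDl => h /(le_trans h) /(lt_le_trans kx); rewrite ltxx.
have : (M \o S) h @[h --> \oo] --> M (\bigcap_h S h).
  apply: nonincreasing_cvg_mu => //.
  - by rewrite ltey_eq fin_num_measure.
  - exact: bigcapT_measurable.
  - move=> h h' hh'; apply/subsetPset => v [/= h1 h2]; split => //=.
    apply: le_trans h1; rewrite lerB// lef_pV2 ?posrE//.
    by rewrite ler_weXn2l// ler1n.
rewrite S0 measure0 => /fine_cvgP[_ /cvgrPdist_lt/(_ eta eta0)].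
move=> [h _ /(_ h (leqnn h)) /=]; rewrite sub0r normrN => lt.
exists h, [set v | Num.floor (x * 2 ^+ h) <= Num.floor (v 0 i * 2 ^+ h)]; split.
  by move=> u v /rowP/(_ i); rewrite !mxE => E /=; rewrite E.
have := fin_num_measure M _ (mS h) => fS.
apply: (@le_lt_trans _ _ (M (S h))); last first.
  by rewrite -(fineK fS) lte_fin; apply: le_lt_trans lt; rewrite ler_norm.
apply: le_measure; rewrite ?inE//.
  apply: measurable_sdiff => //.
  apply: (@measurable_dyadic_union h) => u v /rowP/(_ i); rewrite !mxE => E /=.
  by rewrite E.
rewrite /sdiff => v [[/= xv nV]|[/= fl nx]].
  exfalso; apply: nV; apply: le_floor; rewrite ler_pM2r//.
split=> //=; move: fl; rewrite floor_ge_int => fl.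
rewrite -(ler_pM2r (p0 h)) mulrBl mulVf ?gt_eqF//; apply: le_trans fl.
have /andP[_] := floor_itv (x * 2 ^+ h); rewrite intrD/=; lra.
Qed.

(** The sets that can be approximated form a sigma-algebra and contain the
    half-spaces orthogonal to the axes. *)
Lemma dyadic_approxT B : measurable B -> dyadic_approx B.
Proof.
have sig : sigma_algebra setT dyadic_approx.
  split; last exact: dyadic_approx_bigcup; last first.
    by move=> A aA; rewrite setTD; exact: dyadic_approx_setC.
  split; first exact: measurable0.
  move=> eta eta0; exists 0%N, set0; split; first by move=> u v.
  by rewrite /sdiff !set0D setU0 measure0 lte_fin.
have E : <<s dyadic_approx >> = dyadic_approx by apply: sigma_algebra_id.
move=> mB.
have mid : measurable_fun setT (id : g_sigma_algebraType dyadic_approx -> 'rV[R]_d).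
  apply: measurable_mxP => i j; rewrite (ord1 i).
  apply: (measurability _ (RGenCInfty.measurableE R)) => _ [_ [x ->] <-].
  rewrite setTI (_ : _ @^-1` _ = [set v : 'rV[R]_d | x <= v 0 j]).
    by apply: sub_sigma_algebra; exact: dyadic_approx_halfspace.
  by apply/seteqP; split => v /=; rewrite in_itv/= andbT.
by have := mid measurableT B mB; rewrite setTI preimage_id /measurable/= E.
Qed.

End dyadic.

(** * Packing balls of nearly minimal mass *)

Lemma two_steps (R : realDomainType) (u v w e : R) :
  - e < u - v -> u < w + e -> v <= w + 2 * e.
Proof. by move=> h1 h2; lra. Qed.

Lemma excess_sum (R : realDomainType) (f1 k w S V q : R) :
  q = w + V -> f1 * w + S <= (f1 + k) * q -> S - f1 * V <= k * q.
Proof. by move=> -> h; lra. Qed.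

Lemma quarters (R : realFieldType) (r : R) : r = r / 4 + (r / 4 + r / 2).
Proof. by field. Qed.

Section packing_tools.

Lemma measure_finType_bigcup (R : realType) d' (T : measurableType d')
    (M : {measure set T -> \bar R}) (I : finType) (F : I -> set T) :
  (forall t, measurable (F t)) -> (forall t t', t != t' -> F t `&` F t' = set0) ->
  M (\bigcup_(t in setT) F t) = (\sum_(t : I) M (F t))%E.
Proof.
move=> mF tF; have fI : finite_set [set: I] by exact: finite_finset.
have tI : trivIset setT F by apply/trivIsetP => t t' _ _; exact: tF.
rewrite (measure_fin_bigcup M fI tI)//.
rewrite (fsbigE (index_enum I)) ?index_enum_uniq//.
  by apply: eq_bigl => t; rewrite in_setT.
by move=> t _; rewrite mem_index_enum.
Qed.

(** Markov's inequality: at most half of the terms exceed [k], which is at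
    least twice the mean. *)
Lemma markov_half (R : realType) (I : finType) (e : I -> R) (E k : R) :
  (forall t, 0 <= e t) -> \sum_t e t <= E -> 2 * E <= k * #|I|%:R -> 0 < k ->
  #|I|%:R <= 2 * #|[pred t | e t <= k]|%:R :> R.
Proof.
move=> e0 eE Ek k0; pose Bad := [pred t | ~~ (e t <= k)].
pose Good := [pred t | e t <= k].
have cI : (#|I| = #|Good| + #|Bad|)%N.
  by rewrite -(cardC Good); congr (_ + _)%N; apply: eq_card => t; rewrite !inE.
have h : k * #|Bad|%:R <= E.
  apply: le_trans eE; rewrite (bigID (mem Bad))/= mulrC mulr_natl -sumr_const.
  rewrite -[leLHS]addr0; apply: lerD; last exact: sumr_ge0.
  by apply: ler_sum => t; rewrite inE -ltNge => /ltW.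
have : k * (2 * #|Bad|%:R) <= k * #|I|%:R by apply: le_trans Ek; lra.
rewrite ler_pM2l// cI natrD; lra.
Qed.

Variables (R : realType) (d : nat).

(** The centres of cubes of side [3 * r] that fit in the cell. The side
    exceeds the diameter [2 * r], so that the balls are disjoint. *)
Lemma cell_packing h (k : 'rV[int]_d) (r : R) : 0 < r -> r <= (3 * 2 ^+ h)^-1 ->
  exists (T : finType) (g : T -> 'rV[R]_d),
  [/\ (6 * 2 ^+ h)^-1 ^+ d <= #|T|%:R * r ^+ d,
      forall t, eball (g t) r `<=` [set v | dyadic_label h v = k] &
      forall t t', t != t' -> eball (g t) r `&` eball (g t') r = set0].
Proof.
move=> r0 rs; have p0 : 0 < 2 ^+ h :> R by rewrite exprn_gt0.
set s : R := (2 ^+ h)^-1; have s0 : 0 < s by rewrite invr_gt0.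
have q1 : 1 <= s / (3 * r).
  by rewrite ler_pdivlMr ?mulr_gt0// mul1r -ler_pdivlMl// -invfM.
pose L := Num.truncn (s / (3 * r)); have Lq := truncn_gt_half q1.
have /andP[Lq2 _] := truncn_itv (le_trans ler01 q1).
have Ls : 3 * r * L%:R <= s by rewrite mulrC -ler_pdivlMr// mulr_gt0.
pose c (l : {ffun 'I_d -> 'I_L}) i : R := (k 0 i)%:~R * s + ((l i)%:R + 2^-1) * (3 * r).
pose g l : 'rV[R]_d := \row_i c l i.
have gball l v i : eball (g l) r v -> `|v 0 i - c l i| <= r.
  by move=> h1; have := le_trans (ler_coord_enorm (v - g l) i) h1; rewrite !mxE.
exists {ffun 'I_d -> 'I_L}, g; split.
- rewrite card_ffun !card_ord natrX -exprMn.
  have h1 : (6 * 2 ^+ h)^-1 \is @Num.nneg R by rewrite nnegrE invr_ge0 mulr_ge0// ltW.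
  have h2 : L%:R * r \is @Num.nneg R by rewrite nnegrE mulr_ge0// ltW.
  apply: lerXn2r => //; rewrite invfM -/s; apply: le_trans (ler_wpM2r (ltW r0) Lq).
  by rewrite le_eqVlt; apply/orP; left; apply/eqP; field; rewrite gt_eqF.
- move=> l v vb; apply/rowP => i; rewrite mxE; apply: floor_def.
  have := gball _ _ i vb; rewrite /c ler_norml => /andP[h1 h2].
  have l1 : (l i)%:R + 1 <= L%:R :> R by rewrite natr1 ler_nat.
  have l0 : 0 <= (l i)%:R * r by rewrite mulr_ge0// ltW.
  have l2 : ((l i)%:R + 1) * r <= L%:R * r by rewrite ler_pM2r.
  rewrite -ler_pdivrMr// -ltr_pdivlMr// -/s intrD mulrDl mul1r.
  by move: ((k 0 i)%:~R * s) h1 h2 => u h1 h2; apply/andP; split; lra.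
- move=> l l' ll'; have [i li] : exists i, l i != l' i.
    by apply/existsP; apply: contraR ll' => /existsPn H; apply/eqP/ffunP => i; apply/eqP/negPn/H.
  rewrite -subset0 => v [/(gball _ _ i) + /(gball _ _ i)].
  rewrite /c !ler_norml => /andP[h1 h2] /andP[h3 h4].
  have : (l i : nat) != l' i by [].
  rewrite neq_ltn => /orP[] lt.
    have l2 : ((l i)%:R + 1) * r <= (l' i)%:R * r by rewrite ler_pM2r// natr1 ler_nat.
    by move: ((k 0 i)%:~R * s) h1 h2 h3 h4 => u h1 h2 h3 h4; lra.
  have l2 : ((l' i)%:R + 1) * r <= (l i)%:R * r by rewrite ler_pM2r// natr1 ler_nat.
  by move: ((k 0 i)%:~R * s) h1 h2 h3 h4 => u h1 h2 h3 h4; lra.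
Qed.

Lemma dyadic_cell_le h (k : 'rV[int]_d) :
  (lebesgue_row R d [set v | dyadic_label h v = k] <= ((2 ^+ h)^-1 ^+ d)%:E)%E.
Proof.
have p0 : 0 < 2 ^+ h :> R by rewrite exprn_gt0.
pose s : R := (2 ^+ h)^-1; have s0 : 0 < s by rewrite invr_gt0.
have -> : (2 ^+ h)^-1 ^+ d = \prod_(i < d) (((k 0 i + 1)%:~R * s) - (k 0 i)%:~R * s).
  rewrite (eq_bigr (fun=> s)) => [|i _]; first by rewrite prodr_const card_ord.
  by rewrite intrD mulrDl mul1r addrAC subrr add0r.
rewrite -lebesgue_row_box => [|i]; last by rewrite ler_pM2r// ler_int lerDl.
apply: le_measure; rewrite ?inE; [exact: measurable_dyadic_cell|exact: measurable_cbox|].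
move=> v /= <- i; rewrite !mxE ler_pdivrMr// ler_pdivlMr//.
by have /andP[-> /ltW] := floor_itv (v 0 i * 2 ^+ h).
Qed.

End packing_tools.

Section location.
Variables (R : realType) (d : nat) (m : nat) (a : 'I_m -> 'rV[R]_d) (b : 'I_m -> R).
Local Notation A := (polyhedron a b).
Local Notation lam := (lebesgue_row R d).
Hypothesis compactA : compact A.
Variables (mu : probability 'rV[R]_d R) (f : 'rV[R]_d -> R).
Hypothesis mu_A : mu A = 1%E.
Hypothesis mu_density : is_density mu f.
Hypothesis f_cont : forall x, boundary A x -> f y @[y --> within A (nbhs x)] --> f x.
Hypothesis f0_gt0 : (0 < ess_inf_on A f)%E.
Implicit Types (x y z : 'rV[R]_d).

Let mA : measurable A. Proof. exact: measurable_polyhedron. Qed.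

(** Compare with the finitely many positive masses of [polytope_cover]. *)
Lemma small_ball_mass : exists2 c : R, 0 < c & exists2 r0 : R, 0 < r0 &
  forall x r, A x -> 0 < r <= r0 -> ((c * r ^+ d)%:E <= mu (eball x r))%E.
Proof.
pose G (I : {set 'I_m}) : R := face_inf A f (pface a b I) * angular_volume A (pface a b I).
have [I|c c0 hc] := @uniform_lower_pos R {set 'I_m}
    (fun I c => faces_star A (pface a b I) -> 2 * c <= G I).
  have [FF|nFF] := pselect (faces_star A (pface a b I)); last by exists 1.
  exists (G I / 2); first by rewrite divr_gt0// (face_mass_gt0 compactA mu_A mu_density).
  by move=> c /andP[c0]; rewrite ler_pdivlMr// mulrC.
have [C C0 [r0 r00 hr]] := polytope_cover compactA mu_A mu_density f_cont f0_gt0 c0.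
exists c => //; exists r0 => // x r Ax rr.
have [T [D [mD FF _ low cov]]] := hr r rr.
have [I [t sub]] := cov x Ax.
apply: (@le_trans _ _ (mu (D I t))); last first.
  by apply: le_measure; rewrite ?inE//; exact: measurable_eball.
apply: le_trans (low I t); rewrite lee_fin; apply: ler_wpM2r.
  by rewrite exprn_ge0// ltW//; case/andP: rr.
have := hc I c; rewrite c0 lexx => /(_ isT (FF I t)); rewrite /G; set u := face_inf _ _ _ * _.
by move=> h; rewrite lerBrDl -mulr2n -mulr_natl.
Qed.

(** Enough disjoint places along [F], each of mass within [eps * r ^ d] of the
    asymptotic value for the face; they are used for lower bounds on the link
    length. *)
Definition well_located F (eps c r : R) := exists (T : finType) (g : T -> 'rV[R]_d),
  [/\ c <= #|T|%:R * r ^+ affine_dim F, forall t, A (g t),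
      forall t t', t != t' -> eball (g t) r `&` eball (g t') r = set0,
      forall t, (((face_inf A f F * angular_volume A F - eps) * r ^+ d)%:E <= mu (eball (g t) r))%E &
      forall t, (mu (eball (g t) r) <= ((face_inf A f F * angular_volume A F + eps) * r ^+ d)%:E)%E].

(** Centres on a proper face [F], close to a relative interior point where the
    density is almost minimal on [F]. *)
Lemma location_face F (eps : R) : faces A F -> 0 < eps ->
  exists2 c : R, 0 < c & exists2 r0 : R, 0 < r0 & forall r, 0 < r < r0 ->
  well_located F eps c r.
Proof.
move=> FF eps0; have FS : faces_star A F by left.
have rho0 := angular_volume_gt0 compactA mu_A mu_density FS.
have fF0 := face_inf_gt0 compactA mu_A mu_density f_cont f0_gt0 FS.
have [z [Fz Az FE rhoE hz]] := faces_star_generic compactA mu_A mu_density FS.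
set J := active a b z in FE rhoE hz.
pose e1 := eps / (2 * angular_volume A F).
have e10 : 0 < e1 by rewrite divr_gt0// mulr_gt0.
have [x0 Fx0 fx0] : exists2 x0, F x0 & f x0 < face_inf A f F + e1.
  have hI := faces_has_inf compactA mu_A mu_density f_cont f0_gt0 FF.
  have [_ [x0 Fx0 <-]] := inf_adherent e10 hI.
  by rewrite -(face_infE compactA mu_A mu_density FF); exists x0.
have bx0 := faces_boundary compactA mu_A mu_density FF Fx0.
have [r1 r10 hr1] := boundary_approx f_cont bx0 e10.
have Fx0' : pface a b J x0 by rewrite -FE.
have Fz' : pface a b J z by rewrite -FE.
have nz : 0 < enorm (z - x0) + 1 by rewrite ltr_wpDl// enorm_ge0.
pose tau := Num.min 1 (r1 / (2 * (enorm (z - x0) + 1))).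
have tau0 : 0 < tau by rewrite lt_min ltr01 divr_gt0// mulr_gt0.
have tau1 : tau <= 1 by rewrite ge_min lexx.
have taur : tau * (2 * (enorm (z - x0) + 1)) <= r1.
  by rewrite -ler_pdivlMr ?mulr_gt0// ge_min lexx orbT.
(* Moving [x0] slightly towards the generic point [z] deactivates all constraints
   that do not hold on the whole face. *)
pose x1 := (1 - tau) *: x0 + tau *: z.
have Fx1 : pface a b J x1.
  by apply: pface_convex => //; rewrite ?subr_ge0 ?subrK// ltW.
have x10 : enorm (x1 - x0) <= r1 / 2.
  have -> : x1 - x0 = tau *: (z - x0) by apply/rowP => i; rewrite !mxE; ring.
  rewrite enormZ gtr0_norm// ler_pdivlMr//.
  apply: le_trans taur; rewrite -mulrA; apply: ler_wpM2l; first exact: ltW.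
  by rewrite mulrC; apply: ler_wpM2l => //; rewrite lerDl.
have act1 i : i \notin J -> i \notin active a b x1.
  rewrite !inE => iz; rewrite lt_eqF// dotDr !dotZr.
  have lt : dot (a i) z < b i by rewrite lt_neqAle iz/=; exact: Az.
  have le : dot (a i) x0 <= b i by have [] := Fx0'.
  rewrite -[ltRHS]mul1r -[in ltRHS](subrK tau 1) [ltRHS]mulrDl; apply: ler_ltD.
    by apply: ler_wpM2l => //; rewrite subr_ge0.
  by rewrite ltr_pM2l.
have [e2 e20 he2] := active_margin Fx1.1.
have [e3 e30 he3] := face_ball_mass compactA mu_A mu_density f_cont f0_gt0 FS eps0.
pose e4 := Num.min (r1 / 4) e2; have e40 : 0 < e4 by rewrite lt_min e20 divr_gt0.
have e4r : e4 <= r1 / 4 by rewrite ge_min lexx.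
have e42 : e4 <= e2 by rewrite ge_min lexx orbT.
have [c c0 [r2 r20 hr2]] := pface_packing compactA Fx1 e40.
have [S S0 hS] : exists2 S : R, 0 < S & forall i, enorm (a i) <= S.
  exists (1 + \sum_i enorm (a i)).
    by rewrite ltr_wpDr// sumr_ge0// => i _; exact: enorm_ge0.
  move=> i; rewrite (bigD1 i)//= addrCA lerDl addr_ge0// sumr_ge0// => j _; exact: enorm_ge0.
exists c => //; exists (Num.min (Num.min r2 (e2 / S)) (Num.min e3 (r1 / 4))).
  by rewrite !lt_min r20 e30 !divr_gt0.
move=> r; rewrite !lt_min => /andP[r0 /andP[/andP[rr2 rS] /andP[re3 rr1]]].
have [|T [g [cT Fg ge sep]]] := hr2 r; first by rewrite r0.
exists T, g; split.
- by rewrite [in affine_dim F]FE.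
- by move=> t; have [] := Fg t.
- move=> t t' tt'; rewrite -subset0 => v [v1 v2].
  have := sep _ _ tt'; rewrite ltNge => /negP; apply.
  apply: le_trans (ler_dist_enormD v _ _) _; rewrite enorm_distC mulr_natl mulr2n.
  exact: lerD.
- move=> t; apply: (he3 _ r J) => //.
  + by have [] := Fg t.
  + by move=> i iJ y; rewrite FE => -[_]; apply.
  + move=> i iJ; apply: le_trans (he2 (g t) i _ (act1 i iJ)).
      rewrite lerD2l; apply: (@le_trans _ _ (r * S)); first by apply: ler_wpM2l => //; exact: ltW.
      by rewrite -ler_pdivlMr// ltW.
    exact: le_trans (ge t) e42.
  + exists (g t); first by rewrite FE; exact: Fg.
    by rewrite subrr enorm0 add0r ltW.
- move=> t; rewrite (density_setI mA mu_A (measurable_eball _ _)).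
  have c1 : 0 <= face_inf A f F + 2 * e1 by apply: addr_ge0; [exact: ltW|rewrite mulr_ge0// ltW].
  have mB : measurable (eball (g t) r `&` A) by apply: measurableI => //; exact: measurable_eball.
  apply: (@le_trans _ _ ((face_inf A f F + 2 * e1)%:E * lam (eball (g t) r `&` A))%E).
    apply: (density_le mu_density mB c1); apply: aeW => y [yr Ay].
    have yx0 : enorm (y - x0) <= r1.
      apply: le_trans (ler_dist_enormD (g t) _ _) _.
      have := ler_dist_enormD x1 (g t) x0.
      move: yr; rewrite eballE => yr h.
      have := le_trans (ge t) e4r => h4.
      rewrite [leRHS]quarters.
      apply: lerD; first exact: le_trans yr (ltW rr1).
      by apply: le_trans h _; apply: lerD.
    have := hr1 y Ay yx0; rewrite ltr_norml => /andP[h _]; exact: two_steps h fx0.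
  have -> : (face_inf A f F * angular_volume A F + eps) * r ^+ d =
      (face_inf A f F + 2 * e1) * (angular_volume A F * r ^+ d).
    by rewrite /e1; move: (face_inf A f F) (angular_volume A F) rho0 => u v v0; field; rewrite gt_eqF.
  rewrite EFinM; apply: lee_wpmul2l; first by rewrite lee_fin.
  rewrite rhoE mulrC EFinM -cone_volumeE -(lebesgue_row_cone_ball (g t))//; last first.
  + exact: pcone_cone.
  + exact: measurable_pcone.
  apply: le_measure; rewrite ?inE//.
    by apply: measurableI; [exact: measurable_shift_pcone|exact: measurable_eball].
  by rewrite setIC; apply: ball_pcone_sub => i iJ; have [_] := Fg t; apply.
Qed.

Lemma f0_mass_le B : measurable B -> B `<=` A ->
  ((f0 a b f)%:E * lam B <= mu B)%E.
Proof.
move=> mB BA; have f00 := f0_pos mu_A mu_density f0_gt0.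
apply: (density_ge mu_density mB (ltW f00)).
by apply: filterS (f0_ae mu_A mu_density f0_gt0) => x h /BA.
Qed.

Lemma lam_fin B : measurable B -> B `<=` A -> lam B \is a fin_num.
Proof.
move=> mB BA; have [T T0 hT] := polyhedron_bounded compactA.
rewrite ge0_fin_numE//; apply: le_lt_trans (eball_fin 0 T).
by apply: le_measure; rewrite ?inE//; [exact: measurable_eball|move=> x /BA; exact: hT].
Qed.

(** Depth is measured by constraints so that cells of small diameter around
    such points remain in [A]. *)
Definition deep n : set 'rV[R]_d :=
  [set x | forall i, dot (a i) x + n.+1%:R^-1 * enorm (a i) <= b i].

Lemma deep_sub n x y : deep n x -> enorm (y - x) <= n.+1%:R^-1 -> A y.
Proof.
move=> hx yx i; apply: le_trans (hx i); rewrite -{1}[y](subrK x) addrC dotDr lerD2l.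
apply: le_trans (ler_norm _) _; apply: le_trans (ler_dot_enorm _ _) _.
by rewrite mulrC ler_wpM2r// enorm_ge0.
Qed.

Lemma measurable_deep n : measurable (deep n).
Proof.
rewrite (_ : deep n = \bigcap_(i in [set: 'I_m])
    [set v | dot (a i) v <= b i - n.+1%:R^-1 * enorm (a i)]).
  by apply: fin_bigcap_measurable => // i _; exact: measurable_halfspace.
apply/seteqP; split => v h i; first by move=> _ /=; rewrite lerBrDr; exact: h.
by have := h i Logic.I; rewrite /= lerBrDr.
Qed.

(** A nontrivial constraint is an equality only on a hyperplane, which is
    negligible. *)
Lemma ae_deep : {ae lam, forall x, A x -> exists n, deep n x}.
Proof.
have [T T0 hT] := polyhedron_bounded compactA.
have h : {ae lam, forall x, forall k : nat, forall i : 'I_m, i = k :> nat ->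
    A x -> a i != 0 -> dot (a i) x != b i}.
  apply: ae_foralln => k; have [km|km] := ltnP k m; last first.
    by apply: aeW => x i ik; move: (ltn_ord i); rewrite ik ltnNge km.
  pose i0 := Ordinal km; have [a0|a0] := eqVneq (a i0) 0.
    apply: aeW => x i ik; have -> : i = i0 by exact/val_inj.
    by rewrite a0 eqxx.
  exists (eball 0 T `&` [set x | dot (a i0) x = b i0]); split.
  - by apply: measurableI; [exact: measurable_eball|exact: measurable_hyperplane].
  - exact: lebesgue_row_hyperplane.
  - move=> x /= nx; apply: contrapT => nE; apply: nx => i ik.
    have -> : i = i0 by exact/val_inj.
    by move=> Ax _; apply/eqP => E; apply: nE; split => //; exact: hT.
apply: filterS h => x hx Ax.
have [i|e e0 he] := @uniform_lower_pos R 'I_m (fun i e => dot (a i) x + e * enorm (a i) <= b i).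
  have [a0|a0] := eqVneq (a i) 0.
    by exists 1 => // e _; rewrite a0 enorm0 mulr0 addr0 -(a0); exact: Ax.
  have np : 0 < enorm (a i).
    by rewrite lt_neqAle enorm_ge0 andbT eq_sym; apply: contra_neq a0; exact: enorm_eq0.
  have lt : 0 < b i - dot (a i) x.
    by rewrite subr_gt0 lt_neqAle (hx i i erefl Ax a0); exact: Ax.
  exists ((b i - dot (a i) x) / enorm (a i)); first by rewrite divr_gt0.
  by move=> e /andP[e0]; rewrite ler_pdivlMr// lerBrDl.
have /ltr_add_invr[n] := e0; rewrite add0r => ne.
exists n => i; apply: le_trans (_ : dot (a i) x + e * enorm (a i) <= _).
  by rewrite lerD2l ler_wpM2r ?enorm_ge0// ltW.
by apply: he; rewrite e0/=.
Qed.

Lemma excess_bound (f1 k l eta : R) : 0 < f1 -> 0 < k -> 0 < l ->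
  eta = k / 2 * l / (1 + (f1 + k) / f1) ->
  (f1 + k / 2) * l + eta = (f1 + k) * (l - eta / f1).
Proof.
move=> f10 k0 l0 ->; field; rewrite !gt_eqF//=.
by rewrite addrA -mulr2n addr_gt0// mulrn_wgt0.
Qed.

(** If every dyadic cell inside [A] had excess mass, then so would every Borel
    set, contradicting the definition of the essential infimum. *)
Lemma good_cell (kap : R) : 0 < kap -> exists h (k : 'rV[int]_d),
  [set v | dyadic_label h v = k] `<=` A /\
  (mu [set v | dyadic_label h v = k] <=
     (f0 a b f + kap)%:E * lam [set v | dyadic_label h v = k])%E.
Proof.
move=> kap0; have f10 := f0_pos mu_A mu_density f0_gt0.
set f1 := f0 a b f in f10 *.
have [mf fge0 _] := mu_density.
pose S n := deep n `&` [set x | f x < f1 + kap / 2].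
have mS n : measurable (S n).
  apply: measurableI; first exact: measurable_deep.
  rewrite (_ : [set x | _] = f @^-1` `]-oo, (f1 + kap / 2)[).
    by apply: measurable_preimageT => //; exact: measurable_itv.
  by apply/seteqP; split => x /=; rewrite in_itv.
have deepA n : deep n `<=` A.
  by move=> x dx; apply: deep_sub dx _; rewrite subrr enorm0 invr_ge0.
have [n Sn] : exists n, (0 < lam (S n))%E.
  apply: contrapT => /forallNP no.
  have : f1 + kap / 2 <= f1; last by rewrite gerDl leNgt divr_gt0.
  apply: (f0_max mu_A mu_density f0_gt0).
  have h2 : {ae lam, forall x, forall n, ~ S n x}.
    apply: ae_foralln => n; exists (S n); split => //.
      by apply/eqP; rewrite eq_le measure_ge0 andbT leNgt; apply/negP/no.
    by move=> x /= /contrapT.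
  apply: filterS2 ae_deep h2 => x dx nS Ax.
  by have [n dn] := dx Ax; rewrite leNgt; apply/negP => lt; apply: (nS n).
have SA : S n `<=` A by move=> x [/deepA].
have Lf := lam_fin (mS n) SA; set l := fine (lam (S n)).
have lE : lam (S n) = l%:E by rewrite fineK.
have l0 : 0 < l by rewrite -lte_fin -lE.
(* Chosen so that the mass gained and the volume lost by the approximation
   balance, see [excess_bound]. *)
pose eta := kap / 2 * l / (1 + (f1 + kap) / f1).
have eta0 : 0 < eta by rewrite divr_gt0 ?mulr_gt0// addr_gt0// divr_gt0// addr_gt0.
have ex := excess_bound f10 kap0 l0 (erefl eta).
have [_ /(_ eta eta0)[h0 [V0 [hV0 MV0]]]] := dyadic_approxT mu (mS n).
(* The level is high enough for a cell that meets [deep n] to lie in [A]. *)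
pose h := maxn h0 (d * n.+1); pose V := V0 `&` [set v | exists2 u, deep n u & dyadic_label h u = dyadic_label h v].
have hV : dyadic_union h V.
  move=> u v E [V0u [w dw wu]]; split; last by exists w => //; rewrite -E.
  exact: (dyadic_union_le (leq_maxl _ _) hV0 E).
have cellA u v : deep n u -> dyadic_label h u = dyadic_label h v -> A v.
  move=> du E; apply: (deep_sub du).
  have p0 : 0 < 2 ^+ h :> R by rewrite exprn_gt0.
  apply: le_trans (ler_enorm_coord (c := (2 ^+ h)^-1) _) _.
    move=> i; rewrite !mxE; move/rowP/(_ i) : E; rewrite !mxE => E.
    have := floor_itv (u 0 i * 2 ^+ h); have := floor_itv (v 0 i * 2 ^+ h).
    rewrite E intrD => /andP[h1 h2] /andP[h3 h4].
    rewrite -[_^-1]mul1r ler_pdivlMr// -[X in _ * X](gtr0_norm p0) -normrM ler_norml mulrBl.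
    by move: (_ * 2 ^+ h) (_ * 2 ^+ h) h1 h2 h3 h4 => X Y; move: (_%:~R) => Z h1 h2 h3 h4; apply/andP; split; lra.
  rewrite -[n.+1%:R^-1]mul1r ler_pdivlMr ?ltr0n// mulrAC ler_pdivrMr// mul1r.
  rewrite -natrM -natrX ler_nat; apply: leq_trans (ltnW (ltn_expl h (ltnSn 1))).
  exact: leq_maxr.
have mV : measurable V by exact: measurable_dyadic_union hV.
have VA : V `<=` A by move=> v [_ [u du E]]; exact: cellA du E.
have MV : (mu (sdiff (S n) V) < eta%:E)%E.
  apply: le_lt_trans MV0; apply: le_measure; rewrite ?inE.
  - exact: measurable_sdiff.
  - by apply: measurable_sdiff => //; exact: measurable_dyadic_union hV0.
  - rewrite /sdiff => v [[Sv nV]|[Vv nS]]; last by right; split => //; case: Vv.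
    left; split => // V0v; apply: nV; split => //; exists v => //.
    by case: Sv.
have mSV : measurable (S n `\` V) by exact: measurableD.
have mVS : measurable (V `\` S n) by exact: measurableD.
have muV : (mu V < ((f1 + kap / 2) * l + eta)%:E)%E.
  apply: (@le_lt_trans _ _ (mu (S n) + mu (V `\` S n))%E).
    apply: (le_trans _ (measureU2 mu (mS n) mVS)); apply: le_measure; rewrite ?inE//.
      exact: measurableU.
    by move=> v Vv; have [|] := pselect (S n v); [left|right].
  rewrite EFinD; apply: lee_ltD; first exact: fin_num_measure.
    rewrite EFinM -lE; apply: (density_le mu_density (mS n)).
      by rewrite addr_ge0 ?ltW// divr_gt0.
    by apply: aeW => x [_ /ltW].
  apply: (le_lt_trans _ MV); apply: le_measure; rewrite ?inE//; last by move=> v; right.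
  exact: measurable_sdiff.
have lamV : ((l - eta / f1)%:E <= lam V)%E.
  have h1 : (lam (S n `\` V) <= (eta / f1)%:E)%E.
    have SVA : S n `\` V `<=` A by move=> v [/SA].
    have := f0_mass_le mSV SVA.
    rewrite -(fineK (lam_fin mSV SVA)) => h1.
    rewrite lee_fin ler_pdivlMr// mulrC -lee_fin EFinM; apply: (le_trans h1).
    apply/ltW/(le_lt_trans _ MV); apply: le_measure; rewrite ?inE//; last by move=> v; left.
    exact: measurable_sdiff.
  rewrite EFinB leeBlDr//; apply: (@le_trans _ _ (lam V + lam (S n `\` V))%E).
    rewrite -lE; apply: (le_trans _ (measureU2 lam mV mSV)); apply: le_measure; rewrite ?inE//.
      exact: measurableU.
    by move=> v Sv; have [|] := pselect (V v); [left|right].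
  exact: leeD2l.
apply: contrapT => nocell.
have big k : [set v | dyadic_label h v = k] `<=` A ->
    ((f1 + kap)%:E * lam [set v | dyadic_label h v = k] <= mu [set v | dyadic_label h v = k])%E.
  move=> kA; rewrite leNgt; apply/negP => lt; apply: nocell; exists h, k; split => //.
  exact: ltW.
have c0 : 0 <= f1 + kap by rewrite addr_ge0// ltW.
have lt : (mu V < (f1 + kap)%:E * lam V)%E.
  apply: (lt_le_trans muV); rewrite ex EFinM; exact: lee_wpmul2l.
move: lt; rewrite ltNge => /negP; apply.
have mP k : measurable (dyadic_piece h V k) by exact: measurable_dyadic_piece.
rewrite -(bigcup_dyadic_piece h V) !measure_semi_bigcup//; last 4 first.
- exact: trivIset_dyadic_piece.
- exact: bigcupT_measurable.
- exact: trivIset_dyadic_piece.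
- exact: bigcupT_measurable.
rewrite -nneseriesZl//; apply: lee_nneseries => // k _.
  by rewrite mule_ge0.
have [->|/set0P[v vV]] := eqVneq (dyadic_piece h V k) set0; first by rewrite !measure0 mule0.
rewrite (dyadic_pieceE hV vV); apply: big => w /= wv.
by move: vV => [[_ [u du E]] _]; apply: (cellA u) => //; rewrite wv.
Qed.

Lemma polytope_ball_volume x (r : R) : 0 < r ->
  lam (eball x r) = (angular_volume A A * r ^+ d)%:E.
Proof.
move=> r0; have FS : faces_star A A by right.
have [z [_ Az AE -> _]] := faces_star_generic compactA mu_A mu_density FS.
have [z' [e e0 zA]] := polytope_ball compactA mu_A mu_density.
have a0 i : i \in active a b z -> a i = 0.
  move=> iz; apply/eqP; apply: contraT => ai0.
  have np : 0 < enorm (a i).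
    by rewrite lt_neqAle enorm_ge0 andbT eq_sym; apply: contra_neq ai0; exact: enorm_eq0.
  have on y : A y -> dot (a i) y = b i by rewrite {1}AE => -[_]; apply.
  have t0 : 0 < e / enorm (a i) by rewrite divr_gt0.
  have /on : A (z' + (e / enorm (a i)) *: a i).
    apply: zA; rewrite eballE addrAC subrr add0r enormZ gtr0_norm//.
    by rewrite divfK// gt_eqF.
  rewrite dotDr dotZr on; last by apply: zA; rewrite eballE subrr enorm0 ltW.
  move=> /eqP; rewrite -subr_eq0 addrAC subrr add0r mulf_eq0 gt_eqF//= -enorm_sqr.
  by rewrite sqrf_eq0 gt_eqF.
have KT : pcone a (active a b z) = setT.
  by rewrite -subTset => v _ i /a0 ->; rewrite dotC dot0r.
by rewrite lebesgue_row_ball// mulrC EFinM -cone_volumeE KT setTI.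
Qed.

(** The balls packed in a cell with little excess mass have on average little
    excess mass, hence at least half of them do. *)
Lemma location_polytope (eps : R) : 0 < eps ->
  exists2 c : R, 0 < c & exists2 r0 : R, 0 < r0 & forall r, 0 < r < r0 ->
  well_located A eps c r.
Proof.
move=> eps0; have f10 := f0_pos mu_A mu_density f0_gt0.
set f1 := f0 a b f in f10.
(* A cell of side [2 ^- h] holds at least [(6 * 2 ^+ h * r) ^- d] balls;
   [kap] makes its total excess at most half of [eps * r ^+ d] times their number. *)
pose kap := eps / (2 * 6 ^+ d).
have p6 : 0 < 2 * 6 ^+ d :> R by rewrite mulr_gt0// exprn_gt0.
have kap0 : 0 < kap by rewrite divr_gt0.
have [h [k [QA muQ]]] := good_cell kap0.
set Q := [set v | dyadic_label h v = k] in QA muQ.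
have mQ : measurable Q by exact: measurable_dyadic_cell.
have p0 : 0 < 2 ^+ h :> R by rewrite exprn_gt0.
exists ((6 * 2 ^+ h)^-1 ^+ d / 2); first by rewrite divr_gt0// exprn_gt0// invr_gt0 mulr_gt0.
exists (3 * 2 ^+ h)^-1; first by rewrite invr_gt0 mulr_gt0.
move=> r /andP[r0 /ltW rr].
have [T [g [cT gQ gD]]] := cell_packing k r0 rr.
set rho := angular_volume A A.
pose v := rho * r ^+ d.
have mB t : measurable (eball (g t) r) by exact: measurable_eball.
have BA t : eball (g t) r `<=` A by move=> y /gQ/QA.
have lamB t : lam (eball (g t) r) = v%:E by exact: polytope_ball_volume.
pose W := \bigcup_(t in [set: T]) eball (g t) r.
have mW : measurable W by apply: fin_bigcup_measurable => //; exact: finite_finset.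
have WQ : W `<=` Q by move=> y [t _]; exact: gQ.
have mQW : measurable (Q `\` W) by exact: measurableD.
have QWA : Q `\` W `<=` A by move=> y [/QA].
have lfin := lam_fin mQ QA.
pose mt t := fine (mu (eball (g t) r)).
have mtE t : mu (eball (g t) r) = (mt t)%:E by rewrite fineK// fin_num_measure.
have low t : f1 * v <= mt t.
  by rewrite -lee_fin -mtE EFinM -(lamB t); exact: f0_mass_le.
have muWE : mu W = (\sum_t mt t)%:E.
  by rewrite measure_finType_bigcup// -sumEFin; apply: eq_bigr => t _; exact: mtE.
have lamWE : lam W = (\sum_(t : T) v)%:E.
  by rewrite measure_finType_bigcup// -sumEFin; apply: eq_bigr => t _; exact: lamB.
have lw := lam_fin mQW QWA.
have QE : fine (lam Q) = fine (lam (Q `\` W)) + \sum_(t : T) v.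
  apply: EFin_inj; rewrite EFinD -lamWE (fineK lw) (fineK lfin).
  by rewrite (measureDI lam mQ mW) setIidr.
have low' : f1 * fine (lam (Q `\` W)) + \sum_t mt t <= (f1 + kap) * fine (lam Q).
  rewrite -lee_fin EFinD EFinM [in leRHS]EFinM (fineK lw) (fineK lfin) -muWE.
  apply: le_trans muQ; rewrite (measureDI mu mQ mW) setIidr//.
  by apply: leeD => //; exact: f0_mass_le.
have Qs : fine (lam Q) <= (2 ^+ h)^-1 ^+ d.
  by rewrite -lee_fin fineK//; exact: dyadic_cell_le.
have sumE : \sum_t (mt t - f1 * v) <= kap * (2 ^+ h)^-1 ^+ d.
  rewrite sumrB -mulr_sumr; apply: (@le_trans _ _ (kap * fine (lam Q))); last first.
    by rewrite ler_pM2l.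
  exact: excess_sum QE low'.
have rd0 : 0 < r ^+ d by rewrite exprn_gt0.
have er0 : 0 < eps * r ^+ d by rewrite mulr_gt0.
have half := markov_half (e := fun t => mt t - f1 * v) (E := kap * (2 ^+ h)^-1 ^+ d) (k := eps * r ^+ d).
have {}half : #|T|%:R <= 2 * #|[pred t | mt t - f1 * v <= eps * r ^+ d]|%:R :> R.
  apply: half => // [t|]; first by rewrite subr_ge0.
  rewrite -mulrA [r ^+ d * _]mulrC; apply: (@le_trans _ _ (eps * (6 * 2 ^+ h)^-1 ^+ d)); last first.
    by rewrite ler_pM2l.
  rewrite le_eqVlt; apply/orP; left; apply/eqP.
  rewrite /kap [(6 * 2 ^+ h)^-1]invfM exprMn; move: ((2 ^+ h)^-1 ^+ d) => u.
  rewrite exprVn.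
  by field; rewrite expf_neq0// pnatr_eq0.
have fA : face_inf A f A = f1 by exact: face_inf_polytope.
exists {t : T | mt t - f1 * v <= eps * r ^+ d}, (fun t => g (val t)); split.
- rewrite (affine_dim_polytope compactA mu_A mu_density) card_sig.
  rewrite ler_pdivrMr//; apply: (le_trans cT); rewrite mulrAC; apply: ler_wpM2r; first exact: ltW.
  by rewrite mulrC.
- by move=> t; apply: (BA (val t)); rewrite eballE subrr enorm0 ltW.
- by move=> t t' tt'; apply: gD; apply: contra_neq tt'; exact: val_inj.
- move=> t; rewrite fA mtE lee_fin; apply: le_trans (low _); rewrite mulrBl -mulrA gerBl.
  exact: ltW.
- move=> [t /= ht]; rewrite fA mtE lee_fin mulrDl -mulrA.
  by rewrite -lerBlDl.
Qed.

Lemma location F (eps : R) : faces_star A F -> 0 < eps ->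
  exists2 c : R, 0 < c & exists2 r0 : R, 0 < r0 & forall r, 0 < r < r0 ->
  well_located F eps c r.
Proof. by move=> [FF|->]; [exact: location_face|exact: location_polytope]. Qed.

End location.

(** * Independent samples: binomial tails and a second moment bound *)

Section finite_unions.
Variables (R : realType) (dT : measure_display) (T : measurableType dT).
Variable M : {measure set T -> \bar R}.

Lemma measure_finType_subadd (I : finType) (F : I -> set T) :
  (forall t, measurable (F t)) -> (M (\bigcup_(t in setT) F t) <= \sum_(t : I) M (F t))%E.
Proof.
move=> mF; have -> : \bigcup_(t in setT) F t = \big[setU/set0]_(t : I) F t.
  apply/seteqP; split => x.
    by move=> [t _ Ft]; rewrite (bigD1 t)//=; left.
  by elim/big_rec: _ => // t A _ IH [Ft|/IH//]; exists t.
have [] : measurable (\big[setU/set0]_(t : I) F t) /\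
    (M (\big[setU/set0]_(t : I) F t) <= \sum_(t : I) M (F t))%E; last by [].
elim/big_rec2: _ => [|t A e _ [mA IH]]; first by rewrite measure0.
split; first exact: measurableU.
by apply: (le_trans (measureU2 M (mF t) mA)); exact: leeD2l.
Qed.

Lemma measurable_finType_bigcup (I : finType) (F : I -> set T) :
  (forall t, measurable (F t)) -> measurable (\bigcup_(t in setT) F t).
Proof. by move=> mF; apply: fin_bigcup_measurable => //; exact: finite_finset. Qed.

End finite_unions.

Section second_moment.
Variables (R : realType) (dT : measure_display) (T : measurableType dT).
Variable P : probability T R.

(** Integrate the inequality [1_(N = 0) <= (1 - N / m) ^+ 2] for the number
    [N] of events that occur and its mean [m]. *)
Lemma second_moment (I : finType) (E : I -> set T) (m eta : R) :
  (forall i, measurable (E i)) -> 0 < m ->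
  m <= \sum_i fine (P (E i)) ->
  (\sum_i \sum_j fine (P (E i `&` E j)) <=
    \sum_i fine (P (E i)) + (1 + eta) * (\sum_i fine (P (E i))) ^+ 2)%R ->
  (P (~` \bigcup_(i in setT) E i) <= (m^-1 + eta)%:E)%E.
Proof.
move=> mE m0 mS; set s := \sum_i fine (P (E i)) in mS *; move=> var.
have s0 : 0 < s by exact: lt_le_trans mS.
pose B := ~` \bigcup_(i in [set: I]) E i.
have mB : measurable B by apply: measurableC; exact: measurable_finType_bigcup.
have mEE i j : measurable (E i `&` E j) by exact: measurableI.
have pf A : measurable A -> P A = (fine (P A))%:E by move=> mA; rewrite fineK// fin_num_measure.
pose N (x : T) : R := \sum_i \1_(E i) x.
have N2 x : N x ^+ 2 = \sum_i \sum_j \1_(E i `&` E j) x.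
  rewrite expr2 mulr_suml; apply: eq_bigr => i _; rewrite mulr_sumr; apply: eq_bigr => j _.
  by rewrite indicI.
have pt x : \1_B x + 2 / s * N x <= 1 + s ^- 2 * \sum_i \sum_j \1_(E i `&` E j) x.
  rewrite -N2; have -> : 1 + s ^- 2 * N x ^+ 2 = (1 - N x / s) ^+ 2 + 2 / s * N x.
    by rewrite -exprVn; ring.
  rewrite lerD2r indicE; case: (boolP (x \in B)) => [|_]; last exact: sqr_ge0.
  rewrite inE => Bx; rewrite /N big1 ?mul0r ?subr0 ?expr1n// => i _.
  by rewrite indicE memNset// => Ex; apply: Bx; exists i.
have ind A : measurable A -> (\int[P]_x (\1_A x)%:E = P A)%E.
  by move=> mA; rewrite integral_indic// setIT.
have m1 A : measurable A -> measurable_fun setT (fun x : T => (\1_A x : R)%:E).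
  by move=> mA; apply/measurable_EFinP; exact: measurable_indic.
have c0 : 0 <= 2 / s by rewrite divr_ge0// ltW.
have c1 : 0 <= s ^- 2 by rewrite -exprVn sqr_ge0.
have ge1 A (x : T) : (0 <= (\1_A x : R)%:E)%E by rewrite lee_fin.
have mN : measurable_fun setT (fun x => (2 / s * N x)%:E).
  apply/measurable_EFinP; apply: measurable_funM => //.
  by apply: measurable_sum => i; exact: measurable_indic.
have mNN : measurable_fun setT (fun x => (s ^- 2 * \sum_i \sum_j \1_(E i `&` E j) x)%:E).
  apply/measurable_EFinP; apply: measurable_funM => //.
  by apply: measurable_sum => i; apply: measurable_sum => j; exact: measurable_indic.
have N0 x : 0 <= N x by apply: sumr_ge0 => i _; rewrite indicE.
have NN0 x : 0 <= \sum_i \sum_j (\1_(E i `&` E j) x : R).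
  by apply: sumr_ge0 => i _; apply: sumr_ge0 => j _; rewrite indicE.
have intN : (\int[P]_x (2 / s * N x)%:E = (2 / s * s)%:E)%E.
  under eq_integral do rewrite EFinM.
  rewrite ge0_integralZl//; last 2 first.
  - by apply/measurable_EFinP; apply: measurable_sum => i; exact: measurable_indic.
  - by move=> x _; rewrite lee_fin.
  rewrite [RHS]EFinM; congr (_ * _)%E; under eq_integral do rewrite -sumEFin.
  rewrite ge0_integral_sum//; last by move=> i; exact: m1.
  by rewrite -sumEFin; apply: eq_bigr => i _; rewrite ind// -pf.
have intNN : (\int[P]_x (s ^- 2 * \sum_i \sum_j \1_(E i `&` E j) x)%:E =
    (s ^- 2 * \sum_i \sum_j fine (P (E i `&` E j)))%:E)%E.
  under eq_integral do rewrite EFinM.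
  rewrite ge0_integralZl//; last 2 first.
  - apply/measurable_EFinP; apply: measurable_sum => i.
    by apply: measurable_sum => j; exact: measurable_indic.
  - by move=> x _; rewrite lee_fin.
  rewrite [RHS]EFinM; congr (_ * _)%E; under eq_integral do rewrite -sumEFin.
  rewrite ge0_integral_sum//; last 2 first.
  - move=> i; apply/measurable_EFinP; apply: measurable_sum => j; exact: measurable_indic.
  - by move=> i x _; rewrite lee_fin; apply: sumr_ge0 => j _; rewrite indicE.
  rewrite -sumEFin; apply: eq_bigr => i _; under eq_integral do rewrite -sumEFin.
  rewrite ge0_integral_sum//; last by move=> j; exact: m1.
  by rewrite -sumEFin; apply: eq_bigr => j _; rewrite ind// -pf.
have key : (P B + (2 / s * s)%:E <= 1 + (s ^- 2 * \sum_i \sum_j fine (P (E i `&` E j)))%:E)%E.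
  rewrite -intN -intNN -(ind B mB) -[X in (_ <= X + _)%E](@probability_setT _ _ _ P).
  rewrite -(ind setT measurableT) -ge0_integralD//; [|exact: m1|by move=> x _; rewrite lee_fin mulr_ge0].
  rewrite -ge0_integralD//; [|exact: m1|by move=> x _; rewrite lee_fin mulr_ge0].
  apply: ge0_le_integral => //.
  - by move=> x _; rewrite -EFinD lee_fin addr_ge0// mulr_ge0.
  - by apply: emeasurable_funD => //; exact: m1.
  - by apply: emeasurable_funD => //; exact: m1.
  - by move=> x _; rewrite -!EFinD lee_fin indicT; exact: pt.
rewrite -/B (pf B mB) lee_fin; move: key; rewrite (pf B mB) -!EFinD lee_fin divfK ?gt_eqF// => key /=.
have h2 : s ^- 2 * (\sum_i \sum_j fine (P (E i `&` E j))) <= s^-1 + (1 + eta).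
  rewrite ler_pdivrMl ?exprn_gt0//; apply: (le_trans var).
  rewrite mulrDr expr2 mulfK ?gt_eqF//.
  by rewrite [(1 + eta) * _]mulrC.
have h3 : s^-1 <= m^-1 by rewrite lef_pV2// posrE.
by move: key h2 h3; move: (fine _) (s^-1) (m^-1) (s ^- 2 * _) => x1 x2 x3 x4; lra.
Qed.

End second_moment.

Section sampling.
Variables (R : realType) (d : nat) (mu : probability 'rV[R]_d R).
Variables (dO : measure_display) (Omega : measurableType dO) (P : probability Omega R).
Variable X : nat -> {RV P >-> 'rV[R]_d}.
Hypothesis X_indep : mutually_independent P X.
Hypothesis X_distr : forall (i : nat) (B : set 'rV[R]_d),
  measurable B -> distribution P (X i) B = mu B.
Implicit Types (B D : set 'rV[R]_d).

Definition mass B : R := fine (mu B).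

Lemma massE B : measurable B -> mu B = (mass B)%:E.
Proof. by move=> mB; rewrite fineK// fin_num_measure. Qed.

Lemma mass_ge0 B : 0 <= mass B.
Proof. by rewrite fine_ge0. Qed.

Lemma mass_le1 B : measurable B -> mass B <= 1.
Proof. by move=> mB; rewrite -lee_fin -massE// probability_le1. Qed.

Lemma le_mass B D : measurable B -> measurable D -> B `<=` D -> mass B <= mass D.
Proof. by move=> mB mD BD; rewrite -lee_fin -!massE//; apply: le_measure; rewrite ?inE. Qed.

Lemma mass_setC B : measurable B -> mass (~` B) = 1 - mass B.
Proof.
by move=> mB; apply: EFin_inj; rewrite EFinB -!massE ?probability_setC//; exact: measurableC.
Qed.

Lemma mass_setU B D : measurable B -> measurable D -> B `&` D = set0 ->
  mass (B `|` D) = mass B + mass D.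
Proof.
move=> mB mD BD; apply: EFin_inj; rewrite EFinD -!massE//; last exact: measurableU.
exact: measureU.
Qed.

Lemma measurable_RV i B : measurable B -> measurable (X i @^-1` B).
Proof. by move=> mB; rewrite -[X in measurable X]setTI; apply: measurable_funP. Qed.

(** Independence for an explicit finite range of indices, in the form used for
    products over ordinals. *)
Lemma indep_prefix n (B : 'I_n -> set 'rV[R]_d) : (forall i, measurable (B i)) ->
  measurable (\bigcap_(i in [set: 'I_n]) (X i @^-1` B i)) /\
  P (\bigcap_(i in [set: 'I_n]) (X i @^-1` B i)) = (\prod_(i < n) mass (B i))%:E.
Proof.
move=> mB; split.
  by apply: fin_bigcap_measurable => // i _; exact: measurable_RV.
pose B' (i : nat) := if insub i is Some j then B j else setT.
have B'E (j : 'I_n) : B' j = B j by rewrite /B' valK.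
have mB' i : measurable (B' i) by rewrite /B'; case: insub.
pose J := [fset i in iota 0 n]%fset.
have := X_indep J mB'.
have -> : \bigcap_(i in [set` J]) (X i @^-1` B' i) = \bigcap_(i in [set: 'I_n]) (X i @^-1` B i).
  apply/seteqP; split => w h i.
    by move=> _; rewrite -B'E; apply: h; rewrite /= !inE mem_iota add0n ltn_ord.
  rewrite /= !inE mem_iota add0n => /= lt; have := h (Ordinal lt) Logic.I.
  by rewrite -B'E.
move=> ->; rewrite (perm_big (iota 0 n)); last first.
  apply: uniq_perm; rewrite ?iota_uniq ?fset_uniq// => i.
  by rewrite !inE.
have -> : (\prod_(i <- iota 0 n) P (X i @^-1` B' i) = \prod_(i < n) P (X i @^-1` B i))%E.
  rewrite -{1}[n]subn0 -/(index_iota 0 n) big_mkord; apply: eq_bigr => i _.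
  by rewrite B'E.
have -> : (\prod_(i < n) P (X i @^-1` B i) = \prod_(i < n) (mass (B i))%:E)%E.
  by apply: eq_bigr => i _; rewrite -massE// -(X_distr i).
by elim/big_rec2: _ => // i x y _ ->.
Qed.

Definition hits n D (w : Omega) : nat := (\sum_(i < n) (X i w \in D))%N.

(** The number of hits depends only on which of the points fall in [D];
    summing over the patterns replaces integration on [Omega]. *)
Definition pattern n D (s : {ffun 'I_n -> bool}) : set Omega :=
  \bigcap_(i in [set: 'I_n]) (X i @^-1` (if s i then D else ~` D)).

Lemma hitsE n D (Q : pred nat) : [set w | Q (hits n D w)] =
  \bigcup_(s in [set: {ffun 'I_n -> bool}])
    (if Q (\sum_i s i)%N then pattern D s else set0).
Proof.
apply/seteqP; split => [w /= Qw|w [s _]].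
  exists [ffun i : 'I_n => X i w \in D] => //=.
  rewrite (eq_bigr (fun i : 'I_n => (X i w \in D) : nat)) => [|i _]; last by rewrite ffunE.
  rewrite -/(hits n D w) Qw => i _ /=; rewrite ffunE.
  by case: ifPn; rewrite ?inE ?notin_setE.
case: ifPn => // Qs h /=; rewrite /hits (eq_bigr (fun i : 'I_n => s i : nat)) => [//|i _].
have := h i Logic.I => /=; case: (s i) => h'; first by rewrite mem_set.
by rewrite memNset.
Qed.

Lemma measurable_pattern n D (s : {ffun 'I_n -> bool}) : measurable D -> measurable (pattern D s).
Proof.
move=> mD; apply: (indep_prefix (B := fun i => if s i then D else ~` D) _).1 => i.
by case: ifP => // _; exact: measurableC.
Qed.

Lemma measurable_hits n D (Q : pred nat) : measurable D ->
  measurable [set w | Q (hits n D w)].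
Proof.
move=> mD; rewrite hitsE; apply: measurable_finType_bigcup => s.
by case: ifP => // _; exact: measurable_pattern.
Qed.

(** Exponential Markov inequality for the binomial number of hits. *)
Lemma chernoff n D (Q : pred nat) (th k : R) : measurable D ->
  (forall j, Q j -> 0 <= th * (j%:R - k)) ->
  (P [set w | Q (hits n D w)] <= (expR (n%:R * mass D * (expR th - 1) - th * k))%:E)%E.
Proof.
move=> mD hQ; set p := mass D.
have p0 : 0 <= p by exact: mass_ge0.
have p1 : 0 <= 1 - p by rewrite subr_ge0 mass_le1.
rewrite hitsE; apply: le_trans (measure_finType_subadd _ _) _.
  by move=> s; case: ifP => // _; exact: measurable_pattern.
pose pr (s : {ffun 'I_n -> bool}) := \prod_(i < n) (if s i then p else 1 - p).
have patE s : P (pattern D s) = (pr s)%:E.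
  have [|_ ->] := indep_prefix (B := fun i => if s i then D else ~` D).
    by move=> i; case: ifP => // _; exact: measurableC.
  by congr EFin; apply: eq_bigr => i _; case: ifP => // _; rewrite mass_setC.
pose pw (s : {ffun 'I_n -> bool}) := \prod_(i < n) (if s i then p * expR th else 1 - p).
have bd (s : {ffun 'I_n -> bool}) : (P (if Q (\sum_i s i)%N then pattern D s else set0) <=
    (expR (- (th * k)) * pw s)%:E)%E.
  have pw0 : 0 <= pw s.
    by apply: prodr_ge0 => i _; case: ifP => // _; rewrite mulr_ge0// expR_ge0.
  case: ifPn => Qs; last by rewrite measure0 lee_fin mulr_ge0// expR_ge0.
  rewrite patE lee_fin.
  have -> : pw s = pr s * expR (th * (\sum_i s i)%:R).
    rewrite /pw /pr natr_sum mulr_sumr expR_sum -big_split; apply: eq_bigr => i _ /=.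
    by case: (s i); rewrite ?mulr1// mulr0 expR0 mulr1.
  rewrite mulrCA -expRD; apply: ler_peMr.
    by apply: prodr_ge0 => i _; case: ifP.
  by rewrite -[leLHS]expR0 ler_expR addrC -mulrBr; exact: hQ.
apply: (@le_trans _ _ (\sum_s (expR (- (th * k)) * pw s)%:E)%E); first by apply: lee_sum => s _; exact: bd.
rewrite sumEFin lee_fin -mulr_sumr expRD mulrC; apply: ler_wpM2r; first exact: expR_ge0.
have -> : \sum_s pw s = (p * expR th + (1 - p)) ^+ n.
  rewrite /pw -(bigA_distr_bigA (fun (i : 'I_n) (c : bool) => if c then p * expR th else 1 - p)).
  rewrite (eq_bigr (fun=> p * expR th + (1 - p))) => [|i _]; first by rewrite prodr_const card_ord.
  by rewrite big_bool.
rewrite -mulrA expRM_natl; apply: lerXn2r; rewrite ?nnegrE ?expR_ge0//.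
  by rewrite addr_ge0// mulr_ge0// expR_ge0.
apply: le_trans (expR_ge1Dx _); rewrite le_eqVlt; apply/orP; left; apply/eqP; ring.
Qed.

End sampling.

Section deviations.
Variables (R : realType) (d : nat) (mu : probability 'rV[R]_d R).
Variables (dO : measure_display) (Omega : measurableType dO) (P : probability Omega R).
Variable X : nat -> {RV P >-> 'rV[R]_d}.
Hypothesis X_indep : mutually_independent P X.
Hypothesis X_distr : forall (i : nat) (B : set 'rV[R]_d),
  measurable B -> distribution P (X i) B = mu B.
Implicit Types (B D : set 'rV[R]_d).

(** Equal to [y * Hfun (b / y)]: the rate at which a Poisson variable of mean
    [y * s] is near [b * s], as [s] grows. *)
Definition Psi (y b : R) : R := y - b - b * ln (y / b).

Lemma lower_tail n D (y b s : R) : measurable D -> 0 < b -> b < y -> 0 <= s ->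
  y * s <= n%:R * mass mu D ->
  (P [set w | ((hits X n D w)%:R <= b * s)%R] <= (expR (- (s * Psi y b)))%:E)%E.
Proof.
move=> mD b0 byl s0 yp; have y0 : 0 < y by exact: lt_trans byl.
have yb1 : 1 < y / b by rewrite ltr_pdivlMr// mul1r.
have yb0 : 0 < y / b by exact: lt_trans yb1.
have ln0 : 0 < ln (y / b) by rewrite ln_gt0.
apply: le_trans (chernoff X_indep X_distr n (Q := fun j => j%:R <= b * s)
  (th := - ln (y / b)) (k := b * s) mD _) _.
  move=> j jb; rewrite mulNr -mulrN opprB mulr_ge0 ?(ltW ln0)// subr_ge0//.
rewrite lee_fin ler_expR expRN lnK ?posrE// invf_div.
have h : n%:R * mass mu D * (b / y - 1) <= y * s * (b / y - 1).
  by apply: ler_wnM2r => //; rewrite subr_le0 ler_pdivrMr// mul1r ltW.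
have -> : - (s * Psi y b) = y * s * (b / y - 1) - - ln (y / b) * (b * s).
  by rewrite /Psi; move: (ln _) => u; field; rewrite gt_eqF.
by rewrite lerD2r.
Qed.

Lemma upper_tail n D (y b s : R) : measurable D -> 0 < y -> y < b -> 0 <= s ->
  n%:R * mass mu D <= y * s ->
  (P [set w | (b * s <= (hits X n D w)%:R)%R] <= (expR (- (s * Psi y b)))%:E)%E.
Proof.
move=> mD y0 yb s0 yp; have b0 : 0 < b by exact: lt_trans yb.
have by1 : 1 < b / y by rewrite ltr_pdivlMr// mul1r.
have by0 : 0 < b / y by exact: lt_trans by1.
have ln0 : 0 < ln (b / y) by rewrite ln_gt0.
apply: le_trans (chernoff X_indep X_distr n (Q := fun j => b * s <= j%:R)
  (th := ln (b / y)) (k := b * s) mD _) _.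
  by move=> j jb; rewrite mulr_ge0 ?(ltW ln0)// subr_ge0.
rewrite lee_fin ler_expR lnK ?posrE//.
have h : n%:R * mass mu D * (b / y - 1) <= y * s * (b / y - 1).
  by apply: ler_wpM2r => //; rewrite subr_ge0 ltW.
have -> : - (s * Psi y b) = y * s * (b / y - 1) - ln (b / y) * (b * s).
  have -> : ln (b / y) = - ln (y / b) by rewrite -lnV ?invf_div// posrE divr_gt0.
  by rewrite /Psi; move: (ln _) => u; field; rewrite gt_eqF.
by rewrite lerD2r.
Qed.

Lemma no_hit n D : measurable D ->
  (P [set w | hits X n D w == 0%N] <= (expR (- (n%:R * mass mu D / 2)))%:E)%E.
Proof.
move=> mD; apply: le_trans (chernoff X_indep X_distr n (Q := fun j => j == 0%N)
  (th := - 1) (k := 0) mD _) _.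
  by move=> j /eqP ->; rewrite subrr mulr0.
rewrite lee_fin ler_expR mulr0 subr0 -mulrN; apply: ler_wpM2l.
  by rewrite mulr_ge0// mass_ge0.
have : expR (- 1) <= 2^-1 :> R.
  rewrite expRN lef_pV2 ?posrE ?expR_gt0//.
  by have := expR_ge1Dx (1 : R).
lra.
Qed.

(** The price of replacing joint by product probabilities is a factor close to
    one as long as [k * p] is small. *)
Lemma inv_geometric_bound (p : R) k : 0 <= p -> 4 * (k%:R * p) <= 1 ->
  (1 - p) ^- (2 * k) <= 1 + 4 * (k%:R * p).
Proof.
move=> p0 kp; have [->|k0] := posnP k; first by rewrite muln0 expr0 invr1 mul0r mulr0 addr0.
have k1 : 1 <= k%:R :> R by rewrite ler1n.
have p1 : p <= 1 by have : p <= k%:R * p; [rewrite ler_peMl|lra].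
have := @bernoulli_expr R (2 * k) p; rewrite p0 p1 => /(_ isT); rewrite natrM.
have : 0 <= k%:R * p by rewrite mulr_ge0.
rewrite -mulrA; move: (k%:R * p) kp => u kp u0; move: (_ ^+ _) => v uv.
have v0 : 0 < v by lra.
rewrite -[leLHS]mul1r ler_pdivrMr//; nra.
Qed.

Lemma card_ord_lt lo hi : (lo <= hi)%N -> #|[set i : 'I_hi | (i < lo)%N]%SET| = lo.
Proof.
move=> lh; rewrite cardsE -sum1_card.
by rewrite -(big_ord_widen hi (fun=> 1%N) lh) sum1_card card_ord.
Qed.

Section many_locations.
Variables (T : finType) (S D : T -> set 'rV[R]_d) (lo hi k : nat).
Hypotheses (mS : forall t, measurable (S t)) (mD : forall t, measurable (D t)).
Hypotheses (SD : forall t, S t `<=` D t)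
  (DD : forall t t', t != t' -> D t `&` D t' = set0).
Hypotheses (k0 : (0 < k)%N) (lohi : (lo <= hi)%N).

Definition hit_sets : {set {set 'I_hi}} :=
  [set J : {set 'I_hi} | (J \subset [set i : 'I_hi | (i < lo)%N]%SET) && (#|J| == k)]%SET.

(** One distinguished point of [J] is required to fall near the centre, in
    [S t]; the remaining points of [J] in [D t], and all others outside. *)
Definition target t (J : {set 'I_hi}) (i : 'I_hi) : set 'rV[R]_d :=
  if i \in J then (if [pick j in J] == Some i then S t else D t) else ~` D t.

(** Fixing the index set makes these events disjoint for equal [t] and
    products for independent points, so that their probabilities are
    explicit. *)
Definition hit_event (x : T * {set 'I_hi}) : set Omega :=
  if x.2 \in hit_sets then \bigcap_(i in [set: 'I_hi]) (X i @^-1` target x.1 x.2 i) else set0.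

Lemma measurable_target t J i : measurable (target t J i).
Proof. by rewrite /target; case: ifP => [_|_]; [case: ifP|exact: measurableC]. Qed.

Lemma measurable_hit_event x : measurable (hit_event x).
Proof.
rewrite /hit_event; case: ifP => // _.
exact: (indep_prefix X_indep X_distr (measurable_target _ _)).1.
Qed.

Definition hit_weight t : R :=
  mass mu (S t) * mass mu (D t) ^+ k.-1 * (1 - mass mu (D t)) ^+ (hi - k).

Lemma prod_target t J : J \in hit_sets ->
  \prod_i mass mu (target t J i) = hit_weight t.
Proof.
rewrite inE => /andP[_ /eqP Jk].
have [h hJ hE] : exists2 h, h \in J & [pick j in J] = Some h.
  case: pickP => [h hJ|none]; first by exists h.
  have := k0; rewrite -Jk card_gt0 => /set0Pn[j jJ]; by have := none j; rewrite /= jJ.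
rewrite (bigID (mem J))/= (bigD1 h)//=.
rewrite /target hE; congr (_ * _ * _).
- by rewrite hJ eqxx.
- rewrite (eq_bigr (fun=> mass mu (D t))) => [|i /andP[iJ ih]]; last first.
    by rewrite iJ ifF//; apply/negbTE; apply: contraNneq ih => -[->].
  rewrite prodr_const; congr (_ ^+ _); rewrite -Jk.
  rewrite (cardsD1 h J) hJ/=; apply: eq_card => i; rewrite !inE.
  by rewrite -topredE/= andbC.
- rewrite (eq_bigr (fun=> 1 - mass mu (D t))) => [|i iJ]; last first.
    by rewrite (negbTE iJ) mass_setC.
  rewrite prodr_const; congr (_ ^+ _).
  transitivity #|(~: J)%SET|; first by apply: eq_card => i; rewrite !inE.
  by rewrite cardsCs finset.setCK card_ord Jk.
Qed.

Lemma mass_hit_event x : fine (P (hit_event x)) = if x.2 \in hit_sets then hit_weight x.1 else 0.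
Proof.
rewrite /hit_event; case: ifPn => xJ; last by rewrite measure0.
by rewrite (indep_prefix X_indep X_distr (measurable_target _ _)).2 prod_target.
Qed.

Variable pmax : R.
Hypothesis pmaxP : forall t, mass mu (D t) <= pmax.
Hypothesis pmax1 : 4 * (k%:R * pmax) <= 1.

Lemma pmax_lt1 : T -> pmax < 1.
Proof.
move=> t; have p0 : 0 <= pmax by apply: le_trans (pmaxP t); exact: mass_ge0.
have k1 : 1 <= k%:R :> R by rewrite ler1n.
have : pmax <= k%:R * pmax by rewrite ler_peMl.
by move: (k%:R * pmax) pmax1 => u h1 h2; lra.
Qed.

(** Disjointness of the locations makes the hits nearly independent: only the
    at most [2 * k] indices falling in either location contribute a factor. *)
Lemma joint_hit_event x y : x.1 != y.1 ->
  fine (P (hit_event x `&` hit_event y)) <=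
  (1 - pmax) ^- (2 * k) * (fine (P (hit_event x)) * fine (P (hit_event y))).
Proof.
move=> xy; have pl := pmax_lt1 x.1; have q0 : 0 < 1 - pmax by rewrite subr_gt0.
have nn : 0 <= (1 - pmax) ^- (2 * k) by rewrite invr_ge0 exprn_ge0// ltW.
rewrite !mass_hit_event /hit_event.
case: ifPn => xJ; last by rewrite set0I measure0 mul0r mulr0.
case: ifPn => yJ; last by rewrite setI0 measure0 !mulr0.
have mI i : measurable (target x.1 x.2 i `&` target y.1 y.2 i).
  by apply: measurableI; exact: measurable_target.
have -> : \bigcap_(i in [set: 'I_hi]) (X i @^-1` target x.1 x.2 i) `&`
    \bigcap_(i in [set: 'I_hi]) (X i @^-1` target y.1 y.2 i) =
    \bigcap_(i in [set: 'I_hi]) (X i @^-1` (target x.1 x.2 i `&` target y.1 y.2 i)).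
  by rewrite -bigcapI; apply: eq_bigcapr => i _; rewrite preimage_setI.
rewrite (indep_prefix X_indep X_distr mI).2 /= -(prod_target x.1 xJ) -(prod_target y.1 yJ).
have E : (1 - pmax) ^- (2 * k) =
    \prod_(i < hi) (1 - pmax)^-1 ^+ ((i \in x.2) + (i \in y.2)).
  rewrite prodrXr exprVn; congr (_ ^- _).
  have card (J : {set 'I_hi}) : J \in hit_sets -> (\sum_i (i \in J) = k)%N.
    by rewrite inE => /andP[_ /eqP <-]; rewrite -sum1_card [RHS]big_mkcond.
  by rewrite big_split/= !card// mul2n addnn.
rewrite E -!big_split/=; apply: ler_prod => i _; rewrite mass_ge0/=.
have m1 t J j : mass mu (target t J j) <= 1 by apply: mass_le1; exact: measurable_target.
have mle A C : measurable A -> measurable C -> mass mu (A `&` C) <= mass mu A.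
  by move=> mA mC; apply: le_mass => //; exact: measurableI.
have mle' A C : measurable A -> measurable C -> mass mu (A `&` C) <= mass mu C.
  by move=> mA mC; apply: le_mass => //; exact: measurableI.
have inD t (J : {set 'I_hi}) j : j \in J -> target t J j `<=` D t.
  by rewrite /target => ->; case: ifP => _; [exact: SD|exact: subset_refl].
have dis : D x.1 `&` D y.1 = set0 by exact: DD.
have outE t (J : {set 'I_hi}) j : j \notin J -> mass mu (target t J j) = 1 - mass mu (D t).
  by move=> jJ; rewrite /target (negbTE jJ) mass_setC.
have out1 t : 1 <= (1 - pmax)^-1 * (1 - mass mu (D t)).
  by rewrite ler_pdivlMl// mulr1 lerD2l lerN2.
have [ix|ix] := boolP (i \in x.2); have [iy|iy] := boolP (i \in y.2).
- rewrite (_ : target _ _ _ `&` _ = set0); last first.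
    rewrite -subset0 -dis => v [vx vy]; split; first exact: inD vx.
    exact: inD vy.
  by rewrite /mass measure0 /= mulr_ge0 ?exprn_ge0 ?invr_ge0 ?(ltW q0)// mulr_ge0 ?fine_ge0.
- rewrite addn0 expr1 mulrCA [mass _ (target y.1 _ _)]outE//.
  apply: (le_trans (mle _ _ (measurable_target _ _ _) (measurable_target _ _ _))).
  by rewrite ler_peMr ?mass_ge0.
- rewrite add0n expr1 [_ * mass _ (target y.1 _ _)]mulrC mulrCA [mass _ (target x.1 _ _)]outE//.
  apply: (le_trans (mle' _ _ (measurable_target _ _ _) (measurable_target _ _ _))).
  by rewrite ler_peMr ?mass_ge0.
- rewrite expr0 mul1r !outE//.
  have -> : target x.1 x.2 i `&` target y.1 y.2 i = ~` (D x.1 `|` D y.1).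
    by rewrite /target (negbTE ix) (negbTE iy) setCU.
  rewrite mass_setC; last exact: measurableU.
  rewrite mass_setU//; have := mass_ge0 mu (D x.1); have := mass_ge0 mu (D y.1).
  by move: (mass _ _) (mass _ _) => u v u0 v0; nra.
Qed.

(** Second moment method: the events for the same location are disjoint, and
    for different locations nearly independent. *)
Lemma many_locations (M : R) : 0 < M ->
  M <= ('C(lo, k))%:R * \sum_t hit_weight t ->
  exists2 E : set Omega, measurable E /\ (P E <= (M^-1 + 4 * (k%:R * pmax))%:E)%E &
  forall w, ~ E w -> exists t, hits X hi (D t) w = k /\ exists2 i, (i < lo)%N & S t (X i w).
Proof.
move=> M0 MS; exists (~` \bigcup_(x in setT) hit_event x); first split.
- by apply/measurableC/measurable_finType_bigcup; exact: measurable_hit_event.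
- have sumE : \sum_x fine (P (hit_event x)) = ('C(lo, k))%:R * \sum_t hit_weight t.
    rewrite (eq_bigr (fun x => if x.2 \in hit_sets then hit_weight x.1 else 0)) => [|x _]; last exact: mass_hit_event.
    rewrite -(pair_bigA _ (fun t J => if J \in hit_sets then hit_weight t else 0))/=.
    rewrite mulr_sumr; apply: eq_bigr => t _.
    rewrite -big_mkcond sumr_const -[LHS]mulr_natl; congr (_%:R * _).
    by rewrite cards_draws card_ord_lt.
  apply: second_moment => //; first exact: measurable_hit_event.
    by rewrite sumE.
  set s := \sum_i fine _.
  have F0 x : 0 <= fine (P (hit_event x)) by rewrite fine_ge0.
  case: (pickP (xpredT : pred T)) => [t0 _|noT]; last first.
    by rewrite /s !big1 ?expr0n ?mulr0 ?addr0// => -[t J] _; have := noT t.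
  have p0 : 0 <= pmax by apply: le_trans (pmaxP t0); exact: mass_ge0.
  have rho := inv_geometric_bound p0 pmax1.
  apply: (@le_trans _ _ (\sum_x \sum_y ((if x == y then fine (P (hit_event x)) else 0) +
      (1 + 4 * (k%:R * pmax)) * (fine (P (hit_event x)) * fine (P (hit_event y)))))).
    apply: ler_sum => x _; apply: ler_sum => y _.
    have q0 : 0 <= 1 + 4 * (k%:R * pmax) by rewrite addr_ge0 ?mulr_ge0.
    have [<-|xy] := eqVneq x y.
      by rewrite setIid lerDl !mulr_ge0.
    rewrite add0r; have [xy1|xy1] := eqVneq x.1 y.1; last first.
      by apply: le_trans (joint_hit_event xy1) _; apply: ler_wpM2r => //; exact: mulr_ge0.
    rewrite (_ : hit_event x `&` hit_event y = set0) ?measure0 ?mulr_ge0//.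
    rewrite /hit_event; case: ifPn => xJ; last by rewrite set0I.
    case: ifPn => yJ; last by rewrite setI0.
    have xy2 : x.2 != y.2.
      by apply: contraNneq xy => xy2; rewrite [x]surjective_pairing [y]surjective_pairing xy1 xy2.
    rewrite -subset0 => w [wx wy]; move: xy2; apply/negP/negPn/eqP/setP => i.
    have := wx i Logic.I; have := wy i Logic.I; rewrite /= /target xy1.
    case: (i \in x.2); case: (i \in y.2) => //; first by case: ifP => _ // + /SD.
    by case: ifP => _ // /SD.
  rewrite (eq_bigr (fun x => fine (P (hit_event x)) + (1 + 4 * (k%:R * pmax)) * (fine (P (hit_event x)) * s))).
    by rewrite big_split/= -mulr_sumr -mulr_suml expr2.
  move=> x _; rewrite big_split/= -mulr_sumr -mulr_sumr -big_mkcond/=; congr (_ + _).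
  by rewrite (big_pred1 x)// => y; rewrite eq_sym.
move=> w /contrapT[[t J] _]; rewrite /hit_event /=; case: ifPn => // Jh h.
have [/fintype.subsetP Jlo /eqP Jk] : J \subset [set i : 'I_hi | (i < lo)%N]%SET /\ #|J| == k.
  by move: Jh; rewrite inE => /andP[].
exists t; split.
  rewrite /hits -Jk -sum1_card [RHS]big_mkcond; apply: eq_bigr => i _.
  have := h i Logic.I; rewrite /= /target; case: (i \in J) => [|nD]; last by rewrite memNset.
  by move=> hi'; rewrite mem_set//; move: hi'; case: ifP => // _; exact: SD.
have [j jJ jE] : exists2 j, j \in J & [pick j in J] = Some j.
  case: pickP => [j jJ|none]; first by exists j.
  have := k0; rewrite -Jk card_gt0 => /set0Pn[j jJ]; by have := none j; rewrite /= jJ.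
exists j; first by have := Jlo j jJ; rewrite inE.
by have := h j Logic.I; rewrite /= /target jJ jE eqxx.
Qed.

End many_locations.

Hypothesis mu_point : forall x, mu [set x] = 0%E.

(** By independence the law of a pair of sample points is the product law,
    which gives no mass to the diagonal. *)
Lemma sample_points_distinct :
  {ae P, forall w, forall i j, i != j -> X i w != X j w}.
Proof.
suff H i j : i != j -> {ae P, forall w, X i w != X j w}.
  have : {ae P, forall w, forall i, forall j, i != j -> X i w != X j w}.
    apply: ae_foralln => i; apply: ae_foralln => j.
    have [->|ij] := eqVneq i j; first by apply: aeW => w.
    by apply: filterS (H i j ij) => w + _.
  by [].
move=> ij.
pose Y w := (X i w, X j w).
have mY : measurable_fun setT Y by apply/measurable_fun_pairP; split.
pose diag : set ('rV[R]_d * 'rV[R]_d) := [set x | x.1 = x.2].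
have mdiag : measurable diag.
  rewrite (_ : diag = \bigcap_(k in [set: 'I_d])
      (fun x : 'rV[R]_d * 'rV[R]_d => x.1 0 k - x.2 0 k) @^-1` [set 0]).
    apply: fin_bigcap_measurable => // k _; apply: measurable_preimageT => //.
    apply: measurable_funB.
      exact: (measurableT_comp (@measurable_mx_coord R 1 d 0 k) measurable_fst).
    exact: (measurableT_comp (@measurable_mx_coord R 1 d 0 k) measurable_snd).
  apply/seteqP; split => -[x y]; first by rewrite /diag/= => -> k _ /=; rewrite subrr.
  by rewrite /diag => h /=; apply/rowP => k; apply/eqP; rewrite -subr_eq0; apply/eqP; exact: h.
have prodE B C : measurable B -> measurable C ->
    P (Y @^-1` (B `*` C)) = (mu B * mu C)%E.
  move=> mB mC; have := X_indep [fset i; j]%fset (B := fun k => if k == i then B else C).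
  rewrite big_fsetU1 ?inE//= big_seq_fset1 eqxx [j == i]eq_sym (negbTE ij) => H.
  rewrite -(X_distr i mB) -(X_distr j mC) /distribution /pushforward -H; last by move=> k; case: ifP.
  congr (P _); apply/seteqP; split => w.
    move=> [/= Bw Cw] k; rewrite /= !inE => /orP[]/eqP ->; first by rewrite eqxx.
    by rewrite eq_sym (negbTE ij).
  move=> h; split => /=.
    by have := h i; rewrite /= !inE !eqxx/= => /(_ isT).
  by have := h j; rewrite /= !inE !eqxx orbT/= eq_sym (negbTE ij) => /(_ isT).
have := product_measure_unique (m1 := mu) (m2 := mu) (m' := pushforward P Y) _ mdiag.
move=> /(_ mY prodE) E.
exists (Y @^-1` diag); split.
- exact: measurable_preimageT.
- rewrite -[LHS]/(pushforward P Y diag) -E /product_measure1.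
  rewrite (eq_integral (cst 0%E)) ?integral0// => x _ /=.
  rewrite (_ : xsection diag x = [set x]) ?mu_point//.
  by apply/seteqP; split => y; rewrite xsectionP.
- by move=> w /= /negP; rewrite negbK => /eqP.
Qed.

End deviations.

(** * The rate function and the function [Hhat] *)

Section rate.
Variable R : realType.
Implicit Types (x y b : R).

Lemma ln_le_sub1 x : 0 < x -> ln x <= x - 1.
Proof. by move=> x0; have := @expR_ge1Dx R (ln x); rewrite lnK ?posrE//; lra. Qed.

Lemma ln_lt_sub1 x : 0 < x -> x != 1 -> ln x < x - 1.
Proof.
move=> x0 x1; have l0 : ln x != 0.
  by apply: contra_neq x1 => l; rewrite -(@lnK _ x) ?posrE// l expR0.
by have := @expR_gt1Dx R (ln x) l0; rewrite lnK ?posrE//; lra.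
Qed.

Lemma Psi0 y : Psi y 0 = y.
Proof. by rewrite /Psi mul0r !subr0. Qed.

Lemma Psi_diag b : Psi b b = 0.
Proof.
rewrite /Psi subrr add0r; have [->|b0] := eqVneq b 0; first by rewrite mul0r oppr0.
by rewrite divff// ln1 mulr0 oppr0.
Qed.

Lemma Psi_Hfun y b : 0 < y -> 0 <= b -> y * Hfun (b / y) = Psi y b.
Proof.
move=> y0; rewrite le_eqVlt => /orP[/eqP <-|b0].
  by rewrite Psi0 mul0r /Hfun eqxx mulr1.
rewrite /Hfun mulf_eq0 invr_eq0 !gt_eqF//= /Psi.
have -> : ln (b / y) = - ln (y / b) by rewrite -lnV ?invf_div// posrE divr_gt0.
by move: (ln _) => u; field; rewrite gt_eqF.
Qed.

Lemma Psi_scale y b (s : R) : 0 < s -> Psi (s * y) (s * b) = s * Psi y b.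
Proof.
move=> s0; rewrite /Psi invfM mulrACA divff ?gt_eqF// mul1r.
by ring.
Qed.

(** The derivative in [y] is [1 - b / y], positive beyond [b]. *)
Lemma Psi_lt y1 y2 b : 0 <= b -> b <= y1 -> y1 < y2 -> Psi y1 b < Psi y2 b.
Proof.
rewrite le_eqVlt => /orP[/eqP <-|b0] by1 y12; first by rewrite !Psi0.
have y10 : 0 < y1 by exact: lt_le_trans by1.
have y20 : 0 < y2 by exact: lt_trans y12.
have E : ln (y2 / b) = ln (y1 / b) + ln (y2 / y1).
  by rewrite -lnM ?posrE ?divr_gt0//; congr ln; field; rewrite !gt_eqF.
rewrite /Psi E mulrDr.
have t1 : y2 / y1 != 1 by rewrite gt_eqF// ltr_pdivlMr// mul1r.
have := ln_lt_sub1 (divr_gt0 y20 y10) t1; set l := ln (y2 / y1) => l1.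
have : b * l < y2 - y1.
  apply: (@lt_le_trans _ _ (b * (y2 / y1 - 1))); first by rewrite ltr_pM2l.
  have -> : b * (y2 / y1 - 1) = b / y1 * (y2 - y1) by field; rewrite gt_eqF.
  by rewrite ler_piMl ?subr_ge0 ?(ltW y12)// ler_pdivrMr// mul1r.
by move: (b * ln _) (b * l) => u v; lra.
Qed.

(** [Psi] is convex in its second argument, with slope [- ln (y / b)]. *)
Lemma Psi_tangent y b b' : 0 < y -> 0 < b -> 0 < b' ->
  Psi y b - (b' - b) * ln (y / b) <= Psi y b'.
Proof.
move=> y0 b0 b'0; have E : ln (y / b') = ln (y / b) + ln (b / b').
  by rewrite -lnM ?posrE ?divr_gt0//; congr ln; field; rewrite !gt_eqF.
rewrite /Psi E; have := ln_le_sub1 (divr_gt0 b0 b'0); set l := ln (b / b') => l1.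
have : b' * l <= b - b'.
  apply: (@le_trans _ _ (b' * (b / b' - 1))); first by rewrite ler_pM2l.
  by rewrite le_eqVlt; apply/orP; left; apply/eqP; field; rewrite gt_eqF.
by move: (ln _) => u h; rewrite !mulrDr mulrBl; lra.
Qed.

Lemma Psi_anti y b b' : 0 <= b -> b <= b' -> b' <= y -> 0 < y -> Psi y b' <= Psi y b.
Proof.
move=> b0 bb' b'y y0; have [b'0|b'0] := leP b' 0.
  have -> : b' = b by apply/le_anti; rewrite bb' andbT (le_trans b'0).
  exact: lexx.
have l0 : 0 <= ln (y / b') by rewrite ln_ge0// ler_pdivlMr// mul1r.
move: b0; rewrite le_eqVlt => /orP[/eqP b0|b0].
  rewrite -b0 Psi0 /Psi; have : 0 <= b' * ln (y / b') by rewrite mulr_ge0// ltW.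
  by move: (b' * ln _) => u; lra.
apply: le_trans (Psi_tangent y0 b'0 b0).
by rewrite lerDl -mulNr mulr_ge0// opprB subr_ge0.
Qed.

(** The tangent of the logarithm at [c * b] gives linear growth in [y]. *)
Lemma Psi_lower y b (c : R) : 0 < c -> 0 < b -> 0 < y ->
  y - y / c - b * (1 + ln c) <= Psi y b.
Proof.
move=> c0 b0 y0; have E : ln (y / b) = ln (y / (c * b)) + ln c.
  rewrite -lnM ?posrE ?divr_gt0 ?mulr_gt0//; congr ln; field.
  by rewrite !gt_eqF.
have q0 : 0 < y / (c * b) by rewrite divr_gt0// mulr_gt0.
rewrite /Psi E; have := ln_le_sub1 q0; set l := ln (_ / _) => l1.
have : b * l <= y / c - b.
  apply: (@le_trans _ _ (b * (y / (c * b) - 1))); first by rewrite ler_pM2l.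
  by rewrite le_eqVlt; apply/orP; left; apply/eqP; field; rewrite !gt_eqF.
by move: (ln c) (y / c) => u v h; rewrite !mulrDr; lra.
Qed.

(** Intermediate value theorem between [b], where the rate vanishes, and a
    point where [Psi_lower] makes it exceed [x]. *)
Lemma Psi_surj b x : 0 <= b -> 0 <= x -> exists2 y, b <= y & Psi y b = x.
Proof.
rewrite le_eqVlt => /orP[/eqP <-|b0] x0; first by exists x; rewrite ?Psi0.
pose Y := 4 * (x + b); have bY : b <= Y by rewrite /Y; lra.
have Y0 : 0 < Y by exact: lt_le_trans bY.
have PY : x <= Psi Y b.
  have two : ln 2 <= 1 :> R by have := @ln_le_sub1 2 (ltr0Sn _ _); lra.
  apply: le_trans (Psi_lower (c := 2) _ b0 Y0) => //.
  have : b * ln 2 <= b * 1 by rewrite ler_pM2l.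
  by rewrite [b * (1 + _)]mulrDr /Y; move: (b * ln 2) => u; lra.
have cont : {within `[b, Y], continuous (fun y => Psi y b)}.
  apply: continuous_in_subspaceT => y; rewrite inE/= in_itv/= => /andP[yb _].
  have y0 : 0 < y by exact: lt_le_trans yb.
  rewrite /Psi; apply: cvgB; first by apply: cvgB; [exact: cvg_id|exact: cvg_cst].
  apply: cvgM; first exact: cvg_cst.
  apply: (@cvg_comp _ _ _ (fun z => z / b) (@ln R) _ (nbhs (y / b))).
    by apply: cvgM; [exact: cvg_id|exact: cvg_cst].
  by apply: continuous_ln; rewrite divr_gt0.
have [|y yI <-] := IVT bY cont (v := x).
- by rewrite Psi_diag ge_min x0/= le_max PY orbT.
- by move: yI; rewrite in_itv/= => /andP[by1 _]; exists y.
Qed.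

Lemma Hhat_spec b x : 0 <= b -> 0 <= x -> b <= Hhat b x /\ Psi (Hhat b x) b = x.
Proof.
move=> b0 x0; rewrite /Hhat; case: ifPn => [/andP[/eqP -> /eqP ->]|n0].
  by rewrite Psi0.
have pos y : b <= y -> Psi y b = x \/ y * Hfun (b / y) = x -> 0 < y.
  move=> by1; rewrite lt_neqAle (le_trans b0 by1) andbT => h; apply: contraNneq n0 => y0.
  rewrite -y0 in by1 h; have b00 : b = 0 by apply/le_anti; rewrite by1 b0.
  by move: h; rewrite b00 Psi0 mul0r eqxx => -[] <-; rewrite eqxx.
have ex : exists y, [set y | b <= y /\ y * Hfun (b / y) = x] y.
  have [y by1 Py] := Psi_surj b0 x0; exists y; split => //.
  by rewrite Psi_Hfun//; apply: (pos y) => //; left.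
have [by1 yx] := getPex ex; split => //.
by rewrite -Psi_Hfun//; apply: (pos _ by1); right.
Qed.

(** Beyond the critical value the rate exceeds [x] strictly, and by continuity
    in the second argument this persists for counts slightly above [b]. When
    [b = 0] the rate is not differentiable there, which needs a separate
    choice of [b1]. *)
Lemma Psi_above_Hhat y b x : 0 <= b -> 0 <= x -> Hhat b x < y ->
  exists2 b1, b < b1 & forall b', b < b' <= b1 -> b' < y /\
    x + (Psi y b - x) / 2 <= Psi y b' /\ 0 < Psi y b - x.
Proof.
move=> b0 x0 hy; have [h1 h2] := Hhat_spec b0 x0.
have y0 : 0 < y by apply: le_lt_trans hy; exact: le_trans h1.
have gap : 0 < Psi y b - x by rewrite -[X in _ - X]h2 subr_gt0 Psi_lt.
set g := Psi y b - x in gap *.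
have by1 : b < y by exact: le_lt_trans hy.
move: b0; rewrite le_eqVlt => /orP[/eqP b0|b0].
  have gE : g = y - x by rewrite /g -b0 Psi0.
  pose c := 4 * y / g; have c0 : 0 < c by rewrite divr_gt0// mulr_gt0.
  pose b1 := Num.min (y / 2) (g / (4 * (1 + `|ln c|))).
  have lc : 0 < 1 + `|ln c| by rewrite ltr_pwDl.
  exists b1; first by rewrite -b0 lt_min !divr_gt0// mulr_gt0.
  move=> b'; rewrite -b0 => /andP[b'0]; rewrite le_min => /andP[b'y b'g].
  split; first by apply: le_lt_trans b'y _; rewrite ltr_pdivrMr// ltr_pMr// ltr1n.
  split => //; apply: le_trans (Psi_lower c0 b'0 y0).
  have -> : y / c = g / 4 by rewrite /c; field; rewrite !gt_eqF.
  have : b' * (1 + ln c) <= g / 4.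
    apply: (@le_trans _ _ (b' * (1 + `|ln c|))); first by rewrite ler_pM2l// lerD2l ler_norm.
    rewrite -ler_pdivlMr//; apply: le_trans b'g _; rewrite le_eqVlt; apply/orP; left.
    by apply/eqP; field; rewrite gt_eqF.
  by move: (b' * _) => u; clear -gE; lra.
have l0 : 0 < ln (y / b) by rewrite ln_gt0// ltr_pdivlMr// mul1r.
pose b1 := Num.min ((b + y) / 2) (b + g / (2 * ln (y / b))).
exists b1; first by rewrite lt_min ltrDl divr_gt0 ?mulr_gt0// andbT; lra.
move=> b' /andP[bb']; rewrite le_min => /andP[b'y b'g].
split; first by apply: le_lt_trans b'y _; lra.
split => //; have b'0 : 0 < b' by exact: lt_trans bb'.
apply: le_trans (Psi_tangent y0 b0 b'0).
have : (b' - b) * ln (y / b) <= g / 2.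
  rewrite -ler_pdivlMr// lerBlDl; apply: le_trans b'g _; rewrite le_eqVlt; apply/orP; left.
  by apply/eqP; field; rewrite gt_eqF.
by rewrite /g; move: (_ * ln _) => u; lra.
Qed.

(** Below the critical value the rate is less than [x], with room to lower the
    count to [b'] and to enclose [y] in an interval. The term [y2 - y1]
    accounts for the difference between the bounds on the mass of a location
    from both sides. *)
Lemma Psi_below_Hhat y b x : 0 <= b -> 0 <= x -> b < y -> y < Hhat b x ->
  exists b' y1 y2 dl, [/\ 0 <= b' < y1, b' < b \/ b' = 0 /\ b = 0, y1 < y < y2, 0 < dl &
    y2 - y1 + Psi y1 b' <= x - dl].
Proof.
move=> b0 x0 by1 hy; have [h1 h2] := Hhat_spec b0 x0.
have y0 : 0 < y by exact: le_lt_trans by1.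
have gap : 0 < x - Psi y b by rewrite -{1}h2 subr_gt0 Psi_lt// ltW.
set g := x - Psi y b in gap.
have [b' [b'0 b'b b'y Pb']] : exists b', [/\ 0 <= b', b' < b \/ b' = 0 /\ b = 0, b' < y &
    Psi y b' <= Psi y b + g / 4].
  move: b0; rewrite le_eqVlt => /orP[/eqP b0|b0].
    exists 0; split=> //; first by right.
    by rewrite -b0 lerDl divr_ge0// ltW.
  have yb : 1 < 2 * y / b by rewrite ltr_pdivlMr// mul1r; lra.
  have l0 : 0 < ln (2 * y / b) by rewrite ln_gt0.
  pose b' := Num.max (b / 2) (b - g / (4 * ln (2 * y / b))).
  have b2 : b / 2 <= b' by rewrite le_max lexx.
  have b'0 : 0 < b' by apply: lt_le_trans b2; rewrite divr_gt0.
  have b'b : b' < b.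
    rewrite gt_max ltr_pdivrMr// ltr_pMr// ltr1n/= -subr_gt0 opprB addrC subrK.
    by rewrite divr_gt0// mulr_gt0.
  exists b'; split; [exact: ltW|by left|exact: lt_trans by1|].
  have := Psi_tangent y0 b'0 b0.
  have : (b - b') * ln (y / b') <= g / 4.
    apply: (@le_trans _ _ ((b - b') * ln (2 * y / b))).
      rewrite ler_pM2l ?subr_gt0// ler_ln ?posrE ?divr_gt0 ?mulr_gt0//.
      rewrite ler_pdivrMr// mulrAC ler_pdivlMr// [2 * y]mulrC -mulrA ler_pM2l//.
      by rewrite mulrC -ler_pdivrMr.
    rewrite -ler_pdivlMr// lerBlDl -lerBlDr le_max; apply/orP; right.
    rewrite lerB// le_eqVlt; apply/orP; left; apply/eqP.
    by move: l0; move: (ln _) => l l0; field; rewrite gt_eqF.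
  by move: (_ * ln _) => u; lra.
pose e := Num.min (g / 8) ((y - b') / 2).
have e0 : 0 < e by rewrite lt_min divr_gt0//= divr_gt0// subr_gt0.
have eg : e <= g / 8 by rewrite ge_min lexx.
have eb : e <= (y - b') / 2 by rewrite ge_min lexx orbT.
have b'y1 : b' < y - e by move: e0 eg eb; clearbody e; clear -b'y; lra.
exists b', (y - e), (y + e), (g / 2); split => //.
- by rewrite b'0.
- by rewrite gtrBl e0 ltrDl e0.
- by rewrite divr_gt0.
have P1 : Psi (y - e) b' < Psi y b' by rewrite Psi_lt ?(ltW b'y1)// gtrBl.
have gE : g = x - Psi y b by [].
move: (Psi (y - e) b') (Psi y b') (Psi y b) P1 Pb' gE => u v w P1 Pb' gE.
by clearbody e g; clear -P1 Pb' gE eg; lra.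
Qed.

(** * A Stirling-type lower bound for binomial probabilities *)

(** Stirling's upper bound up to a linear factor, by induction from
    [(1 + 1 / n) ^ (n + 1) >= e]. *)
Lemma fact_le_expR k : (0 < k)%N ->
  (k`!)%:R * expR (k%:R - 1) <= k%:R * k%:R ^+ k :> R.
Proof.
case: k => // k _; elim: k => [|k IH]; first by rewrite subrr expR0 expr1 !mulr1 factS fact0.
set n := k.+1 in IH *.
have n0 : 0 < n%:R :> R by rewrite ltr0n.
have -> : n.+1%:R - 1 = (n%:R - 1) + 1 :> R by rewrite -natr1; ring.
rewrite expRD factS natrM.
have e1 : n%:R ^+ n.+1 * expR 1 <= n.+1%:R ^+ n.+1 :> R.
  have h : expR (n.+1%:R^-1) <= n.+1%:R / n%:R :> R.
    have := @expR_ge1Dx R (- n.+1%:R^-1); rewrite expRN => h.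
    rewrite -[leLHS]invrK -[leRHS]invrK lef_pV2 ?posrE ?invr_gt0 ?expR_gt0 ?divr_gt0 ?ltr0n//.
    apply: le_trans h; rewrite invf_div le_eqVlt; apply/orP; left; apply/eqP.
    by rewrite -natr1; field; rewrite natr1 pnatr_eq0.
  have -> : expR 1 = expR (n.+1%:R^-1) ^+ n.+1 :> R.
    by rewrite -expRM_natl mulrC mulVf// pnatr_eq0.
  rewrite -exprMn; apply: lerXn2r; rewrite ?nnegrE ?mulr_ge0 ?expR_ge0//.
  by rewrite mulrC -ler_pdivlMr.
have -> : n.+1%:R * (n`!)%:R * (expR (n%:R - 1) * expR 1) =
    n.+1%:R * ((n`!)%:R * expR (n%:R - 1)) * expR 1 :> R by ring.
apply: (@le_trans _ _ (n.+1%:R * (n%:R * n%:R ^+ n) * expR 1)).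
  by rewrite ler_wpM2r ?expR_ge0// ler_wpM2l.
by rewrite -mulrA ler_wpM2l// -exprS.
Qed.

(** Each of the [k] factors is at least [n - k]. *)
Lemma ffact_ge n k : ((n - k) ^ k <= n ^_ k)%N.
Proof.
elim: k n => [|k IH] [|n] //; first by rewrite sub0n exp0n.
rewrite ffactnS expnS subSS; apply: leq_mul; first by apply: leq_trans (leq_subr _ _) _.
exact: IH.
Qed.

(** Bound the falling factorial by [(lo - k) ^ k] and the factorial by
    Stirling; the result is the exponential of a Poisson rate, monotone in [k]
    below the mean. *)
Lemma binomial_lower (lo k : nat) (p y b s : R) : 0 < s -> 0 <= b -> 0 <= p -> 0 < y ->
  (0 < k)%N -> b * s <= k%:R -> k%:R <= y * s -> y * s <= (lo - k)%:R * p ->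
  expR (s * (y - Psi y b)) <= 'C(lo, k)%:R * p ^+ k * (k%:R * expR 1).
Proof.
move=> s0 b0 p0 y0 k0 bk ky yp.
have kR : 0 < k%:R :> R by rewrite ltr0n.
have ys : 0 < y * s by rewrite mulr_gt0.
have fk := fact_le_expR k0.
have C1 : (y * s) ^+ k <= 'C(lo, k)%:R * p ^+ k * (k`!)%:R.
  apply: (@le_trans _ _ (((lo - k)%:R * p) ^+ k)).
    by apply: lerXn2r; rewrite ?nnegrE//; [exact: ltW|exact: mulr_ge0].
  rewrite exprMn mulrAC -natrM bin_ffact -natrX ler_wpM2r ?exprn_ge0// ler_nat.
  exact: ffact_ge.
have E1 : expR (s * (y - Psi y b)) <= (y * s) ^+ k / k%:R ^+ k * expR k%:R.
  have -> : (y * s) ^+ k / k%:R ^+ k * expR k%:R = expR (y * s - Psi (y * s) k%:R).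
    rewrite -expr_div_n -[y * s / _]lnK ?posrE ?divr_gt0// -expRM_natl -expRD.
    by congr expR; rewrite /Psi; move: (ln _) => u; ring.
  rewrite ler_expR mulrBr [s * y]mulrC lerD2l lerN2 -Psi_scale// [s * y]mulrC.
  by apply: Psi_anti => //; [rewrite mulr_ge0// ltW|rewrite mulrC].
apply: (le_trans E1).
have kk : 0 < k%:R ^+ k :> R by rewrite exprn_gt0.
rewrite mulrAC ler_pdivrMr//.
have -> : expR k%:R = expR (k%:R - 1) * expR 1 :> R by rewrite -expRD subrK.
apply: (@le_trans _ _ ('C(lo, k)%:R * p ^+ k * ((k`!)%:R * expR (k%:R - 1)) * expR 1)).
  rewrite !mulrA ler_wpM2r ?expR_ge0// ler_wpM2r ?expR_ge0//.
have -> : 'C(lo, k)%:R * p ^+ k * (k%:R * expR 1) * k%:R ^+ k =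
   'C(lo, k)%:R * p ^+ k * (k%:R * k%:R ^+ k) * expR 1 :> R by ring.
rewrite ler_wpM2r ?expR_ge0// ler_wpM2l// mulr_ge0 ?exprn_ge0//.
Qed.

End rate.

(** * Bounds for a fixed range of sample sizes *)

Section block_events.
Variables (R : realType) (d : nat) (m : nat) (a : 'I_m -> 'rV[R]_d) (b : 'I_m -> R).
Local Notation A := (polyhedron a b).
Hypothesis compactA : compact A.
Variables (mu : probability 'rV[R]_d R) (f : 'rV[R]_d -> R).
Hypothesis mu_A : mu A = 1%E.
Hypothesis mu_density : is_density mu f.
Hypothesis f_cont : forall x, boundary A x -> f y @[y --> within A (nbhs x)] --> f x.
Hypothesis f0_gt0 : (0 < ess_inf_on A f)%E.
Variables (dO : measure_display) (Omega : measurableType dO) (P : probability Omega R).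
Variable X : nat -> {RV P >-> 'rV[R]_d}.
Hypothesis X_indep : mutually_independent P X.
Hypothesis X_distr : forall (i : nat) (B : set 'rV[R]_d),
  measurable B -> distribution P (X i) B = mu B.

(** Coefficient of [r ^ d] in the mass of a small ball centred at the sparsest
    points of the face. *)
Definition face_mass F : R := face_inf A f F * angular_volume A F.

Lemma hits_subset n (B D : set 'rV[R]_d) w : B `<=` D -> (hits X n B w <= hits X n D w)%N.
Proof.
move=> BD; apply: leq_sum => i _; case: (boolP (_ \in B)) => // /set_mem/BD h.
by rewrite mem_set.
Qed.

Lemma hits_le_size n n' (D : set 'rV[R]_d) w : (n <= n')%N -> (hits X n D w <= hits X n' D w)%N.
Proof.
move=> nn'; rewrite /hits (big_ord_widen n' (fun i => (X i w \in D) : nat) nn').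
by rewrite big_mkcond; apply: leq_sum => i _; case: ifP.
Qed.

(** Union bound: a ball with few points contains one of the sets of
    [polytope_cover], all of whose expected counts are too large for that. *)
Lemma upper_event (eps : R) : 0 < eps ->
  exists2 C : R, 0 < C & exists2 r0 : R, 0 < r0 & forall lo (r s b1 u : R),
    0 < r <= r0 -> 0 <= s -> 0 < b1 -> 0 <= u ->
    (forall F, faces_star A F -> b1 < (face_mass F - eps) * u) -> u * s <= lo%:R * r ^+ d ->
  exists2 E : set Omega, measurable E /\ (P E <= (\sum_(I : {set 'I_m} | `[< faces_star A (pface a b I) >])
      C * r^-1 ^+ affine_dim (pface a b I) *
      expR (- (s * Psi ((face_mass (pface a b I) - eps) * u) b1)))%:E)%E &
    forall w, ~ E w -> forall x, A x -> b1 * s < (hits X lo (eball x r) w)%:R.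
Proof.
move=> eps0; have [C C0 [r0 r00 hr]] := polytope_cover compactA mu_A mu_density f_cont f0_gt0 eps0.
exists C => //; exists r0 => // lo r s b1 u rr s0 b10 u0 hF us.
have r_gt0 : 0 < r by case/andP: rr.
have [T [D [mD FF card low cov]]] := hr r rr.
have mH I t : measurable [set w | ((hits X lo (D I t) w)%:R <= b1 * s)%R].
  exact: (measurable_hits X_indep X_distr lo (fun j => j%:R <= b1 * s) (mD I t)).
pose EI I := \bigcup_(t in [set: T I]) [set w | ((hits X lo (D I t) w)%:R <= b1 * s)%R].
have mEI I : measurable (EI I) by apply: measurable_finType_bigcup => t.
exists (\bigcup_(I in [set: {set 'I_m}]) EI I); first split.
- exact: measurable_finType_bigcup.
- apply: (le_trans (measure_finType_subadd P mEI)).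
  rewrite -sumEFin [leRHS]big_mkcond/=; apply: lee_sum => I _.
  apply: (le_trans (measure_finType_subadd P (mH I))).
  case: ifPn => [/asboolP FI|nFI]; last first.
    by rewrite big1// => t _; exfalso; move/negP: nFI; apply; apply/asboolP; exact: FF t.
  set e := expR _.
  apply: (@le_trans _ _ (\sum_(t : T I) e%:E)%E).
    apply: lee_sum => t _; have h := hF _ FI.
    have ge : 0 < face_mass (pface a b I) - eps.
      have up : 0 < u by rewrite lt_neqAle u0 andbT; apply: contraTneq h => <-; rewrite mulr0 -leNgt ltW.
      by have := lt_trans b10 h; rewrite pmulr_lgt0.
    apply: (lower_tail X_indep X_distr) => //.
    rewrite -mulrA; apply: (@le_trans _ _ ((face_mass (pface a b I) - eps) * (lo%:R * r ^+ d))).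
      by rewrite ler_pM2l.
    rewrite mulrCA; apply: ler_wpM2l => //.
    by rewrite -lee_fin -massE//; exact: low.
  rewrite sumEFin sumr_const lee_fin -[leLHS]mulr_natl; apply: ler_wpM2r; first exact: expR_ge0.
  by rewrite exprVn ler_pdivlMr ?exprn_gt0//; exact: card.
- move=> w nE x Ax; rewrite ltNge; apply/negP => le.
  have [I [t sub]] := cov x Ax; apply: nE; exists I => //; exists t => //=.
  by apply: le_trans le; rewrite ler_nat; exact: hits_subset.
Qed.

(** A fixed location of small mass attracts few points by the upper tail
    bound. Some sample point lies within [eta * rm] of its centre, except with
    exponentially small probability, and the ball of radius [rp] about it
    stays within [(1 + eta) * rp] of the centre. *)
Lemma lower_event_single F (eps eta : R) : faces_star A F -> 0 < eps -> 0 < eta ->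
  exists2 c1 : R, 0 < c1 & exists2 r0 : R, 0 < r0 & forall lo hi (rm rp s y b1 : R),
    0 < rm -> rm <= rp -> rp < r0 -> 0 <= s -> 0 < y -> y < b1 ->
    hi%:R * ((face_mass F + eps) * ((1 + eta) * rp) ^+ d) <= y * s ->
  exists2 E : set Omega, measurable E /\
    (P E <= (expR (- (s * Psi y b1)) + expR (- (lo%:R * (c1 * rm ^+ d))))%:E)%E &
    forall w, ~ E w -> exists2 i, (i < lo)%N & (hits X hi (eball (X i w) rp) w)%:R < b1 * s.
Proof.
move=> FF eps0 eta0.
have [c c0 [r1 r10 hr1]] := small_ball_mass compactA mu_A mu_density f_cont f0_gt0.
have [c2 c20 [r2 r20 hr2]] := location compactA mu_A mu_density f_cont f0_gt0 FF eps0.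
have e1 : 0 < 1 + eta by rewrite addr_gt0.
exists (c * eta ^+ d / 2); first by rewrite divr_gt0// mulr_gt0// exprn_gt0.
exists (Num.min (r1 / eta) (r2 / (1 + eta))); first by rewrite lt_min !divr_gt0.
move=> lo hi rm rp s y b1 rm0 rmp; rewrite lt_min => /andP[rp1 rp2] s0 y0 yb hy.
have rp0 : 0 < rp by exact: lt_le_trans rmp.
have [|T [g [cT Ag _ _ up]]] := hr2 ((1 + eta) * rp).
  by rewrite mulr_gt0//= mulrC -ltr_pdivlMr.
have [t _|noT] := pickP (xpredT : pred T); last first.
  by move: cT; rewrite (eq_card0 noT) mul0r leNgt c20.
pose D := eball (g t) ((1 + eta) * rp); pose S := eball (g t) (eta * rm).
have mD : measurable D by exact: measurable_eball.
have mS : measurable S by exact: measurable_eball.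
exists ([set w | (b1 * s <= (hits X hi D w)%:R)%R] `|` [set w | hits X lo S w == 0%N]); first split.
- apply: measurableU.
    exact: (measurable_hits X_indep X_distr hi (fun j => b1 * s <= j%:R) mD).
  exact: (measurable_hits X_indep X_distr lo (fun j => j == 0%N) mS).
- apply: (le_trans (measureU2 P _ _)).
  + exact: (measurable_hits X_indep X_distr hi (fun j => b1 * s <= j%:R) mD).
  + exact: (measurable_hits X_indep X_distr lo (fun j => j == 0%N) mS).
  rewrite EFinD; apply: leeD.
    apply: (upper_tail X_indep X_distr) => //; apply: le_trans hy; apply: ler_wpM2l => //.
    by rewrite -lee_fin -massE//; exact: up.
  apply: (le_trans (no_hit X_indep X_distr lo mS)); rewrite lee_fin ler_expR lerN2.
  rewrite -[leRHS]mulrA; apply: ler_wpM2l => //.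
  rewrite ler_pdivlMr// mulrAC divfK// -mulrA -exprMn -lee_fin -massE//.
  apply: hr1 => //; rewrite mulr_gt0//= mulrC -ler_pdivlMr//.
  exact: le_trans rmp (ltW rp1).
- move=> w nE; have nh : hits X lo S w != 0%N by apply/negP => h; apply: nE; right.
  have [i Si] : exists i : 'I_lo, X i w \in S.
    apply/existsP; apply: contraR nh => /existsPn h.
    by rewrite /hits big1// => i _; rewrite (negbTE (h i)).
  exists i => //; rewrite ltNge; apply/negP => le; apply: nE; left => /=.
  apply: le_trans le _; rewrite ler_nat; apply: hits_subset; apply: eball_sub.
  move: Si; rewrite inE /S eballE => Si; rewrite mulrDl mul1r addrC lerD2l.
  by apply: le_trans Si _; rewrite ler_pM2l.
Qed.

Lemma weight_regroup (c2 c e u v r p q : R) :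
  c2 * (c * e) * u * v * r * p * q = v * (c2 * u * (c * e * r * p * q)).
Proof. by ring. Qed.

(** Apply the second moment method to the disjoint places of [location]; [M]
    is a lower bound for the expected number of places with exactly [k] of the
    first [hi] points, one of them near the centre. *)
Lemma lower_event_multi F (eps eta : R) : faces_star A F -> 0 < eps -> 0 < eta ->
  exists2 c : R, 0 < c & exists2 r0 : R, 0 < r0 & forall lo hi k (rm rp : R),
    let rho := (1 + eta) * rp in
    let pmax := (face_mass F + eps) * rho ^+ d in
    let pmin := (face_mass F - eps) * rho ^+ d in
    let M := c * rho^-1 ^+ affine_dim F * 'C(lo, k)%:R * rm ^+ d * pmin ^+ k.-1 *
             (1 - pmax) ^+ hi in
    0 < rm -> rm <= rp -> rp < r0 -> (0 < k)%N -> (k <= lo)%N -> (lo <= hi)%N ->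
    0 < pmin -> 4 * (k%:R * pmax) <= 1 ->
  exists2 E : set Omega, measurable E /\ (P E <= (M^-1 + 4 * (k%:R * pmax))%:E)%E &
    forall w, ~ E w -> exists2 i, (i < lo)%N & (hits X hi (eball (X i w) rp) w <= k)%N.
Proof.
move=> FF eps0 eta0.
have [c c0 [r1 r10 hr1]] := small_ball_mass compactA mu_A mu_density f_cont f0_gt0.
have [c2 c20 [r2 r20 hr2]] := location compactA mu_A mu_density f_cont f0_gt0 FF eps0.
have e1 : 0 < 1 + eta by rewrite addr_gt0.
exists (c2 * (c * eta ^+ d)); first by rewrite !mulr_gt0// exprn_gt0.
exists (Num.min (r1 / eta) (r2 / (1 + eta))); first by rewrite lt_min !divr_gt0.
move=> lo hi k rm rp rho pmax pmin M rm0 rmp; rewrite lt_min => /andP[rp1 rp2] k0 klo lohi pmin0 kp.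
have rp0 : 0 < rp by exact: lt_le_trans rmp.
have rho0 : 0 < rho by rewrite mulr_gt0.
have [|T [g [cT Ag DD low up]]] := hr2 rho.
  by rewrite rho0/= /rho mulrC -ltr_pdivlMr.
have [t0 _|noT] := pickP (xpredT : pred T); last first.
  by move: cT; rewrite (eq_card0 noT) mul0r leNgt c20.
pose D t := eball (g t) rho; pose S t := eball (g t) (eta * rm).
have mD t : measurable (D t) by exact: measurable_eball.
have mS t : measurable (S t) by exact: measurable_eball.
have SD t : S t `<=` D t.
  apply: eball_sub; rewrite subrr enorm0 add0r.
  apply: (@le_trans _ _ (eta * rp)); first by rewrite ler_pM2l.
  by rewrite ler_pM2r// lerDr.
have pD t : mass mu (D t) <= pmax by rewrite -lee_fin -massE//; exact: up.
have pD' t : pmin <= mass mu (D t) by rewrite -lee_fin -massE//; exact: low.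
have pS t : c * eta ^+ d * rm ^+ d <= mass mu (S t).
  rewrite -mulrA -exprMn -lee_fin -massE//; apply: hr1 => //.
  rewrite mulr_gt0//= mulrC -ler_pdivlMr//; exact: le_trans rmp (ltW rp1).
have pl := pmax_lt1 k0 pD kp t0.
have q0 : 0 < 1 - pmax by rewrite subr_gt0.
have pq0 : 0 < (1 - pmax) ^+ hi by exact: exprn_gt0.
have pp0 : 0 < pmin ^+ k.-1 by exact: exprn_gt0.
have ceta0 : 0 < c * eta ^+ d by rewrite mulr_gt0// exprn_gt0.
have rmd0 : 0 < rm ^+ d by exact: exprn_gt0.
have M0 : 0 < M.
  rewrite /M; apply: mulr_gt0 => //; apply: mulr_gt0 => //; apply: mulr_gt0 => //.
  apply: mulr_gt0; last by rewrite ltr0n bin_gt0.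
  by rewrite !mulr_gt0// exprn_gt0// invr_gt0.
have MS : M <= ('C(lo, k))%:R * \sum_t hit_weight mu S D hi k t.
  have w t : c * eta ^+ d * rm ^+ d * pmin ^+ k.-1 * (1 - pmax) ^+ hi <= hit_weight mu S D hi k t.
    apply: ler_pM; [|exact: ltW| |].
    - by apply: mulr_ge0; [apply: mulr_ge0|]; exact: ltW.
    - apply: ler_pM; [|exact: ltW|exact: pS|].
      + by apply: mulr_ge0; exact: ltW.
      + by apply: lerXn2r; rewrite ?nnegrE ?(ltW pmin0)// mass_ge0.
    - apply: (@le_trans _ _ ((1 - pmax) ^+ (hi - k))).
        apply: ler_wiXn2l; rewrite ?leq_subr ?(ltW q0)//.
        by rewrite gerBl; apply: le_trans (pD t0); exact: mass_ge0.
      by apply: lerXn2r; rewrite ?nnegrE ?(ltW q0)// ?subr_ge0 ?mass_le1// lerB.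
  have -> : M = 'C(lo, k)%:R * (c2 * rho^-1 ^+ affine_dim F *
      (c * eta ^+ d * rm ^+ d * pmin ^+ k.-1 * (1 - pmax) ^+ hi)).
    by rewrite /M weight_regroup.
  apply: ler_wpM2l => //.
  apply: (@le_trans _ _ (\sum_(t : T) c * eta ^+ d * rm ^+ d * pmin ^+ k.-1 * (1 - pmax) ^+ hi)).
    rewrite sumr_const -[leRHS]mulr_natl; apply: ler_wpM2r.
      by apply: mulr_ge0; [apply: mulr_ge0; [apply: mulr_ge0|]|]; exact: ltW.
    by rewrite exprVn ler_pdivrMr ?exprn_gt0.
  by apply: ler_sum => t _.
have [E [mE PE] hE] := many_locations X_indep X_distr mS mD SD DD k0 lohi pD kp M0 MS.
exists E => // w /hE[t [hk [i ilo Si]]]; exists i => //.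
rewrite -hk; apply: hits_subset; apply: eball_sub; rewrite /rho mulrDl mul1r addrC lerD2l.
by apply: le_trans Si _; rewrite ler_pM2l.
Qed.

End block_events.

(** * Almost sure statements along the sample size *)

Section radius.
Variables (R : realType) (d : nat).
Hypothesis d_gt0 : (0 < d)%N.
Implicit Types q : R.

(** The exponential form makes negative powers of the radius explicit; the
    [d]-th power of [radius q] is [q] for [q > 0]. *)
Definition radius q : R := expR (ln q / d%:R).

Lemma radius_gt0 q : 0 < radius q. Proof. exact: expR_gt0. Qed.

Lemma radiusX q : 0 < q -> radius q ^+ d = q.
Proof.
move=> q0; rewrite /radius -expRM_natl mulrC divfK ?pnatr_eq0 -?lt0n//.
by rewrite lnK// posrE.
Qed.

Lemma radius_inv q j : (radius q)^-1 ^+ j = expR (- (ln q * (j%:R / d%:R))).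
Proof. by rewrite /radius -expRN -expRM_natl; congr expR; rewrite mulrN mulrCA mulrA. Qed.

Lemma le_radius q q' : 0 < q -> q <= q' -> radius q <= radius q'.
Proof.
move=> q0 qq'; rewrite /radius ler_expR ler_wpM2r ?invr_ge0//.
by rewrite ler_ln ?posrE//; exact: lt_le_trans qq'.
Qed.

Lemma radius_le q (r : R) : 0 < q -> 0 < r -> q <= r ^+ d -> radius q <= r.
Proof.
move=> q0 r0 h; rewrite leNgt; apply/negP => lt; move: h; rewrite leNgt => /negP; apply.
rewrite -[ltRHS]radiusX//; by rewrite ltr_pXn2r// nnegrE ltW// radius_gt0.
Qed.

End radius.

Section almost_surely.
Variables (R : realType) (dO : measure_display) (Omega : measurableType dO).
Variable P : probability Omega R.

(** Telescoping with [2 * C / N]. *)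
Lemma sum_inv_sqr (C : R) N : 0 <= C -> \sum_(0 <= i < N) C / i.+1%:R ^+ 2 <= 2 * C.
Proof.
move=> C0; have H : \sum_(0 <= i < N) C / i.+1%:R ^+ 2 <= 2 * C - 2 * C / N.+1%:R.
  elim: N => [|N IH]; first by rewrite big_geq// divr1 subrr.
  rewrite big_nat_recr//=; apply: (le_trans (lerD IH (lexx _))).
  have n0 : 0 < N.+1%:R :> R by rewrite ltr0n.
  have e : N.+2%:R = N.+1%:R + 1 :> R by rewrite natr1.
  rewrite e; have n1 : 1 <= N.+1%:R :> R by rewrite ler1n.
  move: (N.+1%:R) n0 n1 => x x0 x1; rewrite -subr_ge0.
  have -> : 2 * C - 2 * C / (x + 1) - (2 * C - 2 * C / x + C / x ^+ 2) =
      C * (x - 1) / (x ^+ 2 * (x + 1)).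
    by field; rewrite !gt_eqF//; lra.
  rewrite divr_ge0// mulr_ge0 ?subr_ge0 ?exprn_ge0//; lra.
apply: le_trans H _; rewrite gerBl divr_ge0//; lra.
Qed.

(** The first Borel-Cantelli lemma with a summable bound made explicit. *)
Lemma borel_cantelli (Good : nat -> Omega -> Prop) (C : R) (m0 : nat) : 0 <= C ->
  (forall m, (m0 <= m)%N -> (0 < m)%N -> exists2 E, measurable E /\ (P E <= (C / m%:R ^+ 2)%:E)%E &
     forall w, ~ E w -> Good m w) ->
  {ae P, forall w, \forall m \near \oo, Good m w}.
Proof.
move=> C0 h.
have h' m : exists E, [/\ measurable E, (P E <= (C / m.+1%:R ^+ 2)%:E)%E &
    forall w, ~ E w -> Good (m + m0).+1 w].
  have [|//|E [mE PE] hE] := h (m + m0).+1; first by rewrite ltnW// ltnS leq_addl.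
  exists E; split => //; apply: le_trans PE _; rewrite lee_fin ler_wpM2l//.
  rewrite lef_pV2 ?posrE ?exprn_gt0// lerXn2r ?nnegrE// ler_nat; lia.
have [E hE] := choice h'.
have mE m : measurable (E m) by have [] := hE m.
exists (lim_sup_set E); split.
- apply: bigcap_measurable => // n _; apply: bigcup_measurable => k _; exact: mE.
- apply: lim_sup_set_cvg0 => //; apply: (@le_lt_trans _ _ (2 * C)%:E); last exact: ltry.
  apply: lime_le; first by apply: is_cvg_nneseries.
  apply: nearW => N; apply: (@le_trans _ _ (\sum_(0 <= i < N) (C / i.+1%:R ^+ 2)%:E)%E).
    by apply: lee_sum => i _; have [] := hE i.
  by rewrite sumEFin lee_fin sum_inv_sqr.
- move=> w; apply: contra_notP => /existsNP[N]; rewrite not_implyE => -[_ nE].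
  exists (N + m0).+1 => // m /= Nm; have -> : m = ((m - m0.+1) + m0).+1.
    lia.
  have [_ _] := hE (m - m0.+1)%N; apply => Em; apply: nE; exists (m - m0.+1)%N => //=.
  lia.
Qed.

Lemma pow_block (K : nat) (th : R) : 0 < th ->
  exists m0, forall m, (m0 <= m)%N -> (0 < m)%N -> (m.+1 ^ K)%:R <= (1 + th) * (m ^ K)%:R :> R.
Proof.
move=> th0; have l0 : 0 < ln (1 + th) by rewrite ln_gt0// ltrDl.
exists (Num.truncn (K%:R / ln (1 + th))).+1 => m hm m0.
have mR : 0 < m%:R :> R by rewrite ltr0n.
have hm' : K%:R / ln (1 + th) <= m%:R.
  apply: (@le_trans _ _ (Num.truncn (K%:R / ln (1 + th))).+1%:R); last by rewrite ler_nat.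
  by rewrite ltW// truncnS_gt.
rewrite !natrX -ler_pdivrMr ?exprn_gt0// -expr_div_n.
apply: (@le_trans _ _ (expR (m%:R^-1) ^+ K)).
  apply: lerXn2r; rewrite ?nnegrE ?divr_ge0 ?expR_ge0//.
  have -> : m.+1%:R / m%:R = 1 + m%:R^-1 :> R by rewrite -natr1; field; rewrite gt_eqF.
  exact: expR_ge1Dx.
rewrite -expRM_natl -[leRHS]lnK ?posrE ?addr_gt0// ler_expR.
by rewrite ler_pdivrMr// -ler_pdivrMl// mulrC.
Qed.

Lemma between_powers (K n m1 : nat) : (0 < K)%N -> (m1 ^ K <= n)%N ->
  exists2 m, (m1 <= m)%N & (m ^ K <= n < m.+1 ^ K)%N.
Proof.
move=> K0 h; have ub m : (m ^ K <= n)%N -> (m <= n)%N.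
  by apply: leq_trans; case: m => // m; rewrite -[leqLHS](expn1 m.+1) leq_pexp2l.
case: (ex_maxnP (ex_intro (fun m => m ^ K <= n)%N m1 h) ub) => m mn mmax.
exists m; first exact: mmax.
by rewrite mn/= ltnNge; apply/negP => /mmax; rewrite ltnn.
Qed.

(** Probabilities that decay like an arbitrarily small power of the sample size
    become summable along the sample sizes [m ^ K], whose consecutive ratios
    still tend to one. *)
Lemma blocks (Good : nat -> Omega -> Prop) (C dl th : R) :
  0 <= C -> 0 < dl -> 0 < th ->
  (\forall lo \near \oo, forall hi : nat, (0 < lo)%N -> (lo <= hi)%N -> hi%:R <= (1 + th) * lo%:R ->
    exists2 E, measurable E /\ (P E <= (C * expR (- (dl * ln lo%:R)))%:E)%E &
    forall w, ~ E w -> forall n, (lo <= n <= hi)%N -> Good n w) ->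
  {ae P, forall w, \forall n \near \oo, Good n w}.
Proof.
move=> C0 dl0 th0 [N0 _ /= h].
(* The exponent makes the bound at most [C / m ^+ 2]. *)
pose K := (Num.truncn (2 / dl)).+1.
have Kdl : 2 <= K%:R * dl by rewrite -ler_pdivrMr// ltW// /K truncnS_gt.
have K0 : (0 < K)%N by [].
have [m0 hm0] := pow_block K th0.
pose G m w := forall n, (m ^ K <= n <= m.+1 ^ K)%N -> Good n w.
have : {ae P, forall w, \forall m \near \oo, G m w}.
  apply: (@borel_cantelli _ C (maxn N0 m0) C0) => m; rewrite geq_max => /andP[Nm m0m] mp.
  have mK : (m <= m ^ K)%N by rewrite -[leqLHS](expn1 m) leq_pexp2l.
  have [||| E [mE PE] hE] := h (m ^ K)%N (leq_trans Nm mK) (m.+1 ^ K)%N.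
  - by rewrite expn_gt0 mp.
  - by rewrite leq_exp2r.
  - exact: hm0.
  exists E; last by move=> w /hE.
  split => //; apply: le_trans PE _; rewrite lee_fin ler_wpM2l//.
  have mR : 0 < m%:R :> R by rewrite ltr0n.
  have -> : (m%:R ^+ 2)^-1 = expR (- (2 * ln m%:R)) :> R.
    by rewrite expRN expRM_natl lnK ?posrE.
  rewrite ler_expR lerN2 natrX lnXn// mulrnAr -[leRHS]mulr_natl mulrA.
  by apply: ler_wpM2r => //; apply: ln_ge0; rewrite ler1n.
apply: filterS => w [m1 _ hm1]; exists (m1 ^ K)%N => // n /= m1n.
have [m m1m /andP[h1 h2]] := between_powers K0 m1n.
by apply: (hm1 m m1m); rewrite h1 ltnW.
Qed.

End almost_surely.

Section slack.
Variable R : realType.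

(** Both sides are continuous in [t] and tend to [g * u]; one parameter [t]
    controls all approximations at once. *)
Lemma small_slack (g u y1 y2 : R) (N : nat) : y1 < g * u -> g * u < y2 ->
  \forall t \near 0^'+, y1 < (g - t) * u / (1 + t) /\ (g + t) * (1 + t) ^+ N * u < y2.
Proof.
move=> h1 h2.
have c1 : (fun t => (g - t) * u / (1 + t)) x @[x --> 0^'+] --> (g - 0) * u / (1 + 0).
  apply: cvg_at_right_filter; apply: cvgM; first apply: cvgM; last apply: cvgV.
  - by apply: cvgB; [exact: cvg_cst|exact: cvg_id].
  - exact: cvg_cst.
  - by rewrite addr0 oner_eq0.
  - by apply: cvgD; [exact: cvg_cst|exact: cvg_id].
have c2 : (fun t => (g + t) * (1 + t) ^+ N * u) x @[x --> 0^'+] --> (g + 0) * (1 + 0) ^+ N * u.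
  apply: cvg_at_right_filter; apply: cvgM; first apply: cvgM; last exact: cvg_cst.
  - by apply: cvgD; [exact: cvg_cst|exact: cvg_id].
  - by apply: (continuous_comp _ (@exprn_continuous _ N _)); apply: cvgD; [exact: cvg_cst|exact: cvg_id].
rewrite subr0 addr0 divr1 in c1; rewrite !addr0 expr1n mulr1 in c2.
near=> t; split.
- by near: t; apply: (cvgr_gt _ c1).
- by near: t; apply: (cvgr_lt _ c2).
Unshelve. all: by end_near. Qed.

Lemma mul_exp_le (x dl : R) : 0 < dl -> 0 <= x -> x <= dl^-1 * expR (dl * x).
Proof.
move=> dl0 x0; rewrite ler_pdivlMl//; apply: le_trans (expR_ge1Dx _); lra.
Qed.

End slack.

(** * All balls receive enough points *)

Section growth.
Variable R : realType.

Lemma ln_large (c : R) : \forall n \near \oo, c <= ln (n%:R : R).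
Proof.
have H : \forall n \near \oo, expR c <= n%:R :> R by exact: nbhs_infty_ger.
near=> n; have h : expR c <= n%:R by near: n.
rewrite -[leLHS]expRK ler_ln ?posrE ?expR_gt0//; exact: lt_le_trans (expR_gt0 c) h.
Unshelve. all: by end_near. Qed.

Lemma ln_small (e : R) : 0 < e -> \forall n \near \oo, ln (n%:R : R) / n%:R <= e.
Proof.
move=> e0; near=> n.
have n0 : 0 < n%:R :> R by rewrite ltr0n; near: n; exact: nbhs_infty_gt.
have l0 : 0 <= ln (n%:R : R) by near: n; exact: ln_large.
have le : 2 * (2 / e) <= ln (n%:R : R) by near: n; exact: ln_large.
have h2 : 0 < 2^-1 :> R by rewrite invr_gt0.
have := mul_exp_le h2 l0; rewrite invrK => h.
set x := ln n%:R in l0 le h *; have nE : n%:R = expR (2^-1 * x) * expR (2^-1 * x) :> R.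
  by rewrite -expRD -mulrDl -[_^-1]div1r -splitr mul1r lnK// posrE.
have E1 : 2 / e <= expR (2^-1 * x).
  apply: (@le_trans _ _ (2^-1 * x)); last by apply: le_trans (expR_ge1Dx _); rewrite lerDr.
  by rewrite ler_pdivlMl.
have e20 := expR_gt0 (2^-1 * x).
rewrite ler_pdivrMr// nE mulrA; apply: (le_trans h); rewrite ler_wpM2r ?(ltW e20)//.
by rewrite mulrC -ler_pdivrMr.
Unshelve. all: by end_near. Qed.

(** Within a block the logarithm changes by at most [t]. *)
Lemma ln_block (lo n : nat) (t : R) : 0 < t -> (0 < lo)%N -> (0 < n)%N ->
  n%:R <= (1 + t) * lo%:R -> ln n%:R <= ln lo%:R + t.
Proof.
move=> t0 l0 n0 h; have lR : 0 < lo%:R :> R by rewrite ltr0n.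
apply: (@le_trans _ _ (ln ((1 + t) * lo%:R))).
  by rewrite ler_ln ?posrE ?mulr_gt0 ?addr_gt0 ?ltr0n.
rewrite lnM ?posrE ?addr_gt0// addrC lerD2l.
by have := @ln_le_sub1 R (1 + t) (addr_gt0 ltr01 t0); lra.
Qed.

(** Exponent of the number of places, [s * J], against the rate, in a block
    where the sample size varies by the factor [1 + t]. *)
Lemma upper_exponent (s J Psi lnhi lnq t dl : R) : 0 <= s -> 0 <= J <= 1 ->
  - lnq <= lnhi -> lnhi <= s + t -> 0 < t -> J + dl <= Psi ->
  - (lnq * J) - s * Psi <= t - dl * s.
Proof.
move=> s0 /andP[J0 J1] h1 h2 t0 h3.
have a1 : - lnq * J <= (s + t) * J by rewrite ler_wpM2r//; exact: le_trans h2.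
have a2 : t * J <= t by rewrite ler_piMr// ltW.
have a3 : s * (J + dl) <= s * Psi by rewrite ler_wpM2l.
rewrite mulNr mulrDl in a1; rewrite mulrDr in a3.
rewrite [dl * s]mulrC; move: (lnq * J) (s * J) (t * J) (s * dl) (s * Psi) a1 a2 a3 => *; lra.
Qed.

End growth.

Section almost_sure_bounds.
Variables (R : realType) (d : nat) (m : nat) (a : 'I_m -> 'rV[R]_d) (b : 'I_m -> R).
Local Notation A := (polyhedron a b).
Hypothesis d_gt0 : (0 < d)%N.
Hypothesis compactA : compact A.
Variables (mu : probability 'rV[R]_d R) (f : 'rV[R]_d -> R).
Hypothesis mu_A : mu A = 1%E.
Hypothesis mu_density : is_density mu f.
Hypothesis f_cont : forall x, boundary A x -> f y @[y --> within A (nbhs x)] --> f x.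
Hypothesis f0_gt0 : (0 < ess_inf_on A f)%E.
Variables (dO : measure_display) (Omega : measurableType dO) (P : probability Omega R).
Variable X : nat -> {RV P >-> 'rV[R]_d}.
Hypothesis X_indep : mutually_independent P X.
Hypothesis X_distr : forall (i : nat) (B : set 'rV[R]_d),
  measurable B -> distribution P (X i) B = mu B.

Local Notation mass_of := (face_mass a b f).
Definition dim_ratio (F : set 'rV[R]_d) : R := (affine_dim F)%:R / d%:R.

Lemma dim_ratio_bound F : 0 <= dim_ratio F <= 1.
Proof.
rewrite divr_ge0//= ler_pdivrMr ?ltr0n// mul1r ler_nat; exact: affine_dim_le.
Qed.

Lemma faces_star_pface F : faces_star A F -> exists I, F = pface a b I.
Proof.
move=> FF; have [z [_ _ FE _ _]] := faces_star_generic compactA mu_A mu_density FF.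
by exists (active a b z).
Qed.

Lemma exists_right (x : R) (Q : {set 'I_m} -> R -> Prop) :
  (forall I, faces_star A (pface a b I) -> \forall t \near x^'+, Q I t) ->
  exists t, x < t /\ forall I, faces_star A (pface a b I) -> Q I t.
Proof.
move=> h; have H : \forall t \near x^'+, forall I, faces_star A (pface a b I) -> Q I t.
  apply: (@filter_forall _ _ (fun I t => faces_star A (pface a b I) -> Q I t)) => I.
  have [FI|nFI] := pselect (faces_star A (pface a b I)).
    by apply: filterS (h I FI) => t + _.
  by apply: nearW => t /nFI.
exact: (filter_ex (filterI (nbhs_right_gt x) H)).
Qed.

(** Radii are parametrised by their [d]-th power [q]. *)
Definition all_served (kn n : nat) (q : R) w :=
  forall x, A x -> (kn < hits X n (eball x (radius d q)) w)%N.

Definition some_unserved (kn n : nat) (q : R) w :=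
  exists2 i, (i < n)%N & (hits X n (eball (X i w) (radius d q)) w <= kn)%N.

(** Version of [upper_event] for all sample sizes in a block and all larger
    radii, by monotonicity of the counts. *)
Lemma upper_block (t b1 u : R) : 0 < t -> 0 < b1 -> 0 < u ->
  (forall F, faces_star A F -> b1 < (mass_of F - t) * (u / (1 + t))) ->
  exists2 C : R, 0 <= C & exists2 r0 : R, 0 < r0 & forall (lo hi : nat) (s e : R),
    (0 < lo)%N -> (lo <= hi)%N -> hi%:R <= (1 + t) * lo%:R -> 0 < s -> 1 <= u * s ->
    u * s / lo%:R <= r0 ->
    (forall F q, faces_star A F -> - ln q <= ln (hi%:R : R) ->
      - (ln q * dim_ratio F) - s * Psi ((mass_of F - t) * (u / (1 + t))) b1 <= e) ->
  exists2 E, measurable E /\ (P E <= (C * expR e)%:E)%E &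
    forall w, ~ E w -> forall n (q : R), (lo <= n)%N -> u * s / hi%:R <= q ->
      forall x, A x -> b1 * s < (hits X n (eball x (radius d q)) w)%:R.
Proof.
move=> t0 b10 u0 hF.
have [C C0 [r0 r00 hr]] := upper_event compactA mu_A mu_density f_cont f0_gt0 X_indep X_distr t0.
have t1 : 0 < 1 + t by rewrite addr_gt0.
exists (\sum_(I : {set 'I_m} | `[< faces_star A (pface a b I) >]) C).
  by apply: sumr_ge0 => I _; exact: ltW.
exists (r0 ^+ d); first exact: exprn_gt0.
move=> lo hi s e lo0 lohi hilo s0 us1 small he.
have loR : 0 < lo%:R :> R by rewrite ltr0n.
have hiR : 0 < hi%:R :> R by rewrite ltr0n (leq_trans lo0).
have us0 : 0 < u * s by rewrite mulr_gt0.
have q0 : 0 < u * s / hi%:R by rewrite divr_gt0//.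
have lnq : - ln (u * s / hi%:R) <= ln hi%:R.
  rewrite -lnV ?posrE// ler_ln ?posrE ?invr_gt0// invf_div ler_pdivrMr// ler_peMr//; exact: ltW.
have [||||||E [mE PE] hE] := hr lo (radius d (u * s / hi%:R)) s b1 (u / (1 + t)).
- rewrite radius_gt0/=; apply: radius_le => //; apply: le_trans small.
  by rewrite ler_pM2l// lef_pV2 ?posrE// ler_nat.
- exact: ltW.
- exact: b10.
- by rewrite divr_ge0// ltW.
- exact: hF.
- rewrite radiusX// -[leLHS]mulrAC [leRHS]mulrCA ler_pM2l//.
  by rewrite -[leLHS]div1r ler_pdivrMr// mulrAC ler_pdivlMr// mul1r mulrC.
exists E; first split => //.
  apply: (le_trans PE); rewrite lee_fin mulr_suml; apply: ler_sum => I /asboolP FI.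
  rewrite -mulrA ler_pM2l// radius_inv -expRD ler_expR; exact: he FI lnq.
move=> w nE n q lon qq x Ax; apply: (lt_le_trans (hE w nE x Ax)); rewrite ler_nat.
apply: (leq_trans (hits_le_size _ _ _ lon)); apply: hits_subset; apply: eball_sub.
by rewrite subrr enorm0 add0r; apply: le_radius.
Qed.

(** Above the critical constant of every face, the rate exceeds [j / d], so
    that the number of places times the probability of a failure is a negative
    power of the sample size. *)
Lemma upper_log (k : nat -> nat) (u beta : R) : 0 <= beta -> 0 < u ->
  (forall b1, beta < b1 -> \forall n \near \oo, (k n)%:R <= b1 * ln (n%:R : R)) ->
  (forall F, faces_star A F -> Hhat beta (dim_ratio F) < u * mass_of F) ->
  {ae P, forall w, \forall n \near \oo, all_served (k n) n (u * ln (n%:R : R) / n%:R) w}.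
Proof.
move=> beta0 u0 khi hF.
pose G I := mass_of (pface a b I); pose J I := dim_ratio (pface a b I).
pose y t I := (G I - t) * (u / (1 + t)).
have [t [t0 ht]] : exists t, 0 < t /\ forall I, faces_star A (pface a b I) -> Hhat beta (J I) < y t I.
  apply: exists_right => I FI.
  have h := hF _ FI; rewrite mulrC in h.
  have h2 : G I * u < G I * u + 1 by rewrite ltrDl.
  by apply: filterS (small_slack 0 h h2) => t [+ _]; rewrite /y mulrA.
have t1 : 0 < 1 + t by rewrite addr_gt0.
have [b1 [bb1 hb1]] : exists b1, beta < b1 /\ forall I, faces_star A (pface a b I) ->
    b1 < y t I /\ J I + (Psi (y t I) beta - J I) / 2 <= Psi (y t I) b1 /\ 0 < Psi (y t I) beta - J I.
  apply: exists_right => I FI.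
  have [J0 _] := andP (dim_ratio_bound (pface a b I)).
  have [c bc hc] := Psi_above_Hhat beta0 J0 (ht I FI).
  near=> b1; apply: hc; apply/andP; split; near: b1; [exact: nbhs_right_gt|exact: nbhs_right_le].
have [dl [dl0 hdl]] : exists dl, 0 < dl /\ forall I, faces_star A (pface a b I) ->
    dl <= (Psi (y t I) beta - J I) / 2.
  apply: exists_right => I FI.
  have [_ [_ h]] := hb1 I FI.
  near=> dl; near: dl; apply: nbhs_right_le; rewrite divr_gt0//.
have b10 : 0 < b1 by exact: le_lt_trans bb1.
have [|C C0 [r0 r00 hr]] := @upper_block t b1 u t0 b10 u0.
  by move=> F FF; have [I FE] := faces_star_pface FF; rewrite FE in FF *; have [] := hb1 I FF.
apply: (@blocks _ _ _ P _ (C * expR t) dl t _ dl0 t0); first by rewrite mulr_ge0// expR_ge0.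
pose bm := (beta + b1) / 2; have bm1 : beta < bm < b1 by rewrite /bm; lra.
have [bmb bmb1] := andP bm1; have bm0 : 0 <= bm by rewrite (le_trans beta0)// ltW.
have [N _ hk] := khi bm bmb.
near=> lo => hi lo0 lohi hilo.
have s1 : 1 / u <= ln (lo%:R : R) by near: lo; exact: ln_large.
have s2 : bm * t / (b1 - bm) <= ln (lo%:R : R) by near: lo; exact: ln_large.
have Nlo : (N <= lo)%N by near: lo; exact: nbhs_infty_ge.
have sm : ln (lo%:R : R) / lo%:R <= r0 / u by near: lo; apply: ln_small; rewrite divr_gt0//.
rewrite ler_pdivrMr// in s1.
have s0 : 0 < ln (lo%:R : R).
  by have : 0 < ln (lo%:R : R) * u by [exact: lt_le_trans s1]; rewrite pmulr_lgt0.
have hi0 : (0 < hi)%N by exact: leq_trans lohi.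
have lnhi := ln_block t0 lo0 hi0 hilo.
have [||F q FF hq|E [mE PE] hE] := hr lo hi (ln lo%:R) (t - dl * ln lo%:R) lo0 lohi hilo s0.
- by rewrite mulrC.
- by rewrite -mulrA mulrC -ler_pdivlMr.
- have [I FE] := faces_star_pface FF; rewrite FE in FF *; have [_ [h _]] := hb1 I FF.
  apply: upper_exponent hq lnhi t0 _; [exact: ltW|exact: dim_ratio_bound|].
  by apply: le_trans h; rewrite lerD2l; exact: hdl.
exists E; first by rewrite -mulrA -expRD.
move=> w nE n /andP[lon nhi] x Ax; rewrite -(ltr_nat R).
have n0 : (0 < n)%N by exact: leq_trans lon.
have nlo : n%:R <= (1 + t) * lo%:R by apply: le_trans hilo; rewrite ler_nat.
apply: le_lt_trans (hE w nE n _ lon _ x Ax).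
  have h1 : (k n)%:R <= bm * ln (n%:R : R) by apply: hk => /=; exact: leq_trans lon.
  have h2 : bm * ln (n%:R : R) <= bm * (ln lo%:R + t) by rewrite ler_wpM2l// (ln_block t0).
  apply: (le_trans h1); apply: (le_trans h2); rewrite mulrDr -lerBrDl -mulrBl mulrC -ler_pdivrMl ?subr_gt0//.
  by rewrite [leLHS]mulrC [X in X * _]mulrC.
apply: ler_pM; rewrite ?invr_ge0 ?mulr_ge0 ?(ltW u0) ?(ltW s0)//.
  by rewrite ler_pM2l// ler_ln ?posrE ?ltr0n// ler_nat.
by rewrite lef_pV2 ?posrE ?ltr0n// ler_nat.
Unshelve. all: by end_near. Qed.

(** Here the rate is multiplied by [k n], which outgrows every multiple of
    [ln n], so that the bounds are summable over all sample sizes. *)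
Lemma upper_linear (k : nat -> nat) (u : R) : 0 < u ->
  (forall c : R, \forall n \near \oo, c * ln (n%:R : R) <= (k n)%:R) ->
  (forall e : R, 0 < e -> \forall n \near \oo, (k n)%:R / n%:R <= e) ->
  (forall F, faces_star A F -> 1 < u * mass_of F) ->
  {ae P, forall w, \forall n \near \oo, all_served (k n) n (u * (k n)%:R / n%:R) w}.
Proof.
move=> u0 klog klin hF.
pose G I := mass_of (pface a b I).
pose y t I := (G I - t) * (u / (1 + t)).
have [t [t0 ht]] : exists t, 0 < t /\ forall I, faces_star A (pface a b I) -> 1 < y t I.
  apply: exists_right => I FI.
  have h := hF _ FI; rewrite mulrC in h.
  have h2 : G I * u < G I * u + 1 by rewrite ltrDl.
  by apply: filterS (small_slack 0 h h2) => t [+ _]; rewrite /y mulrA.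
have [dl [dl0 hdl]] : exists dl, 0 < dl /\ forall I, faces_star A (pface a b I) ->
    dl <= Psi (y t I) 1.
  apply: exists_right => I FI.
  near=> dl; near: dl; apply: nbhs_right_le.
  by rewrite -(Psi_diag 1) Psi_lt// ht.
have [|C C0 [r0 r00 hr]] := @upper_block t 1 u t0 ltr01 u0.
  by move=> F FF; have [I FE] := faces_star_pface FF; rewrite FE in FF *; exact: ht I FF.
have [N _ hN] : \forall n \near \oo, [/\ (3 / dl) * ln (n%:R : R) <= (k n)%:R,
    u^-1 * ln (n%:R : R) <= (k n)%:R, 1 <= ln (n%:R : R) & (k n)%:R / n%:R <= r0 / u].
  near=> n; split; near: n; [exact: klog|exact: klog|exact: ln_large|].
  by apply: klin; rewrite divr_gt0.
apply: (@borel_cantelli _ _ _ P _ C N C0) => n Nn n0.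
have [k1 k2 l1 kn] := hN n Nn.
have nR : 0 < n%:R :> R by rewrite ltr0n.
have ku : 1 <= u * (k n)%:R.
  rewrite ler_pdivrMl// in k2; exact: le_trans l1 k2.
have k0 : 0 < (k n)%:R :> R by rewrite -(pmulr_rgt0 _ u0) (lt_le_trans ltr01).
have [||F q FF hq|E [mE PE] hE] := hr n n (k n)%:R (- (2 * ln n%:R)) n0 (leqnn n) _ k0 ku.
- by rewrite ler_peMl// lerDl ltW.
- by rewrite -mulrA mulrC -ler_pdivlMr.
- have [I FE] := faces_star_pface FF; rewrite FE in FF *.
  have h1 : - ln q * dim_ratio (pface a b I) <= ln n%:R.
    have /andP[J0 J1] := dim_ratio_bound (pface a b I).
    apply: (@le_trans _ _ (ln n%:R * dim_ratio (pface a b I))); first by rewrite ler_wpM2r.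
    by rewrite ler_piMr// (le_trans ler01).
  have h2 : 3 * ln n%:R <= (k n)%:R * Psi (y t I) 1.
    apply: (@le_trans _ _ ((k n)%:R * dl)); last by rewrite ler_pM2l// hdl.
    by rewrite -ler_pdivrMr// mulrAC.
  rewrite -/(G I) -/(y t I) -mulNr; apply: (le_trans (lerB h1 h2)).
  by rewrite -[X in X - _]mul1r -mulrBl -mulNr ler_wpM2r ?(le_trans ler01)//; lra.
exists E.
  split => //; apply: (le_trans PE).
  by rewrite expRN expRM_natl lnK ?posrE.
by move=> w nE x Ax; rewrite -(ltr_nat R) -[X in X < _]mul1r; exact: (hE w nE n _ (leqnn n) (lexx _) x Ax).
Unshelve. all: by end_near. Qed.

(** Version of [lower_event_single] for all sample sizes in a block. *)
Lemma lower_single_block F (t u y b1 : R) : faces_star A F -> 0 < t -> 0 < u -> 0 < y ->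
  y < b1 -> (mass_of F + t) * (1 + t) ^+ d.+1 * u <= y ->
  exists2 c1 : R, 0 < c1 & exists2 r0 : R, 0 < r0 & forall (lo hi : nat) (s : R),
    (0 < lo)%N -> (lo <= hi)%N -> hi%:R <= (1 + t) * lo%:R -> 0 < s -> u * s / lo%:R <= r0 ->
  exists2 E, measurable E /\ (P E <= (2 * expR (- (c1 * s)))%:E)%E &
    forall w, ~ E w -> forall n (q : R), (lo <= n <= hi)%N -> 0 < q -> q <= u * s / lo%:R ->
      exists2 i, (i < n)%N & (hits X n (eball (X i w) (radius d q)) w)%:R < b1 * s.
Proof.
move=> FF t0 u0 y0 yb hy.
have [c c0 [r0 r00 hr]] :=
  lower_event_single compactA mu_A mu_density f_cont f0_gt0 X_indep X_distr FF t0 t0.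
have Pb : 0 < Psi y b1.
  have b10 : 0 < b1 by exact: lt_trans yb.
  rewrite /Psi; have yb0 : 0 < y / b1 by rewrite divr_gt0.
  have yb1 : y / b1 != 1 by rewrite lt_eqF// ltr_pdivrMr// mul1r.
  have := ln_lt_sub1 yb0 yb1; rewrite -(ltr_pM2l b10) mulrBr mulrCA divff ?gt_eqF// !mulr1.
  by rewrite subr_gt0.
have t1 : 0 < 1 + t by rewrite addr_gt0.
exists (Num.min (Psi y b1) (c * u)); first by rewrite lt_min Pb mulr_gt0.
exists ((r0 / 2) ^+ d); first by rewrite exprn_gt0// divr_gt0.
move=> lo hi s lo0 lohi hilo s0 small.
have loR : 0 < lo%:R :> R by rewrite ltr0n.
have q0 : 0 < u * s / lo%:R by rewrite divr_gt0// mulr_gt0.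
set r := radius d (u * s / lo%:R).
have rX : r ^+ d = u * s / lo%:R by exact: radiusX.
have [|||||||E [mE PE] hE] := hr lo hi r r s y b1 => //.
- exact: radius_gt0.
- apply: (@le_lt_trans _ _ (r0 / 2)); last by rewrite ltr_pdivrMr// ltr_pMr// ltr1n.
  by apply: radius_le => //; rewrite divr_gt0.
- exact: ltW.
- rewrite exprMn rX.
  apply: (@le_trans _ _ ((1 + t) * lo%:R * ((mass_of F + t) * ((1 + t) ^+ d * (u * s / lo%:R))))).
    apply: ler_wpM2r => //; rewrite mulr_ge0 ?addr_ge0 ?(ltW t0)//.
      by rewrite ltW//; exact: (face_mass_gt0 compactA mu_A mu_density f_cont f0_gt0 FF).
    by rewrite mulr_ge0 ?exprn_ge0 ?(ltW q0) ?(ltW t1).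
  apply: (@le_trans _ _ ((mass_of F + t) * (1 + t) ^+ d.+1 * u * s)); last by rewrite ler_pM2r.
  rewrite le_eqVlt exprS; apply/orP; left; apply/eqP.
  by move: (mass_of F) ((1 + t) ^+ d) (lo%:R) loR => M D L L0; field; rewrite gt_eqF.
exists E; first split => //.
  apply: (le_trans PE); rewrite lee_fin [leRHS]mulrDl mul1r; apply: lerD; rewrite ler_expR lerN2.
    by rewrite mulrC ler_pM2l// ge_min lexx.
  rewrite rX mulrCA [lo%:R * _]mulrC divfK ?gt_eqF// [leRHS]mulrA ler_pM2r// ge_min lexx orbT//.
move=> w nE n q /andP[lon nhi] q00 qq; have [i ilo hi'] := hE w nE.
exists i; first exact: leq_trans lon.
apply: le_lt_trans hi'; rewrite ler_nat; apply: (leq_trans (hits_le_size _ _ _ nhi)).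
apply: hits_subset; apply: eball_sub.
by rewrite subrr enorm0 add0r; apply: le_radius.
Qed.

End almost_sure_bounds.

(** * Sample points with few neighbours *)

Section weight.
Variable R : realType.

(** Reciprocal of the expected number of places: the three exponential factors
    are the number of places, the Poisson approximation of the binomial
    coefficient, and the probability that all other points miss the place. *)
Lemma weight_bound (c tj rj B pm pk h s J y1 y2 Ps u G kap dl : R) :
  0 < c -> 0 < tj -> 0 < rj -> 0 < B -> 0 < pm -> 0 < pk -> 0 < h -> 0 < s -> 0 < u -> 0 < G ->
  0 < y1 -> 0 < kap -> kap <= y1 * s ->
  expR (s * J) <= rj * (u * s) -> expR (s * (y1 - Ps)) <= B * (pm * pk) * (kap * expR 1) ->
  expR (- (y2 * s)) <= h -> y2 - y1 + Ps <= J - dl ->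
  (c * (tj * rj) * B * (pm / G) * pk * h)^-1 <= G * u * y1 * expR 1 / (c * tj) * s ^+ 2 * expR (- (dl * s)).
Proof.
move=> c0 tj0 rj0 B0 pm0 pk0 h0 s0 u0 G0 y10 kap0 kapy H1 H2 H3 H4.
have e0 := expR_gt0 (1 : R).
have H2' : expR (s * (y1 - Ps)) <= B * (pm * pk) * (y1 * s * expR 1).
  by apply: (le_trans H2); rewrite ler_pM2l ?mulr_gt0// ler_pM2r.
have := ler_pM (mulr_ge0 (expR_ge0 _) (expR_ge0 _)) (expR_ge0 _) (ler_pM (expR_ge0 _) (expR_ge0 _) H1 H2') H3.
rewrite -!expRD => H5.
have H6 : expR (dl * s) <= rj * (u * s) * (B * (pm * pk) * (y1 * s * expR 1)) * h.
  apply: le_trans H5; rewrite ler_expR.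
  have : (dl + y2 - y1 + Ps) * s <= J * s by rewrite ler_pM2r//; lra.
  by rewrite !mulrDl mulrDr [s * J]mulrC [s * y1]mulrC mulrN [s * Ps]mulrC mulNr;
    move: (_ * s) (_ * s) (_ * s) (_ * s) (_ * s) => *; lra.
have M0 : 0 < c * (tj * rj) * B * (pm / G) * pk * h by rewrite !mulr_gt0// invr_gt0.
rewrite -[leLHS]div1r ler_pdivrMr// expRN mulrAC -[leLHS](divff (lt0r_neq0 (expR_gt0 (dl * s)))).
rewrite ler_pM2r ?invr_gt0 ?expR_gt0//; apply: (le_trans H6).
rewrite le_eqVlt; apply/orP; left; apply/eqP.
move: (expR 1) e0 => e e0; field.
by rewrite !gt_eqF.
Qed.

Lemma sqr_exp_le (s dl : R) : 0 < dl -> 0 <= s -> s ^+ 2 <= (4 / dl) ^+ 2 * expR (dl / 2 * s).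
Proof.
move=> dl0 s0; have d4 : 0 < dl / 4 by rewrite divr_gt0.
have h := mul_exp_le d4 s0; rewrite invf_div in h.
apply: (@le_trans _ _ ((4 / dl * expR (dl / 4 * s)) ^+ 2)).
  by apply: lerXn2r; rewrite ?nnegrE// (le_trans s0).
rewrite exprMn -expRM_natl ler_wpM2l ?exprn_ge0 ?divr_ge0 ?(ltW dl0)// ler_expR.
by rewrite le_eqVlt; apply/orP; left; apply/eqP; field.
Qed.

(** From [1 / (1 - p) = 1 + p / (1 - p) <= expR (p / (1 - p))]. *)
Lemma miss_bound (p t y : R) (hi : nat) : 0 <= p -> 0 < t -> p * (1 + t) <= t ->
  hi%:R * (1 + t) * p <= y -> expR (- y) <= (1 - p) ^+ hi.
Proof.
move=> p0 t0 pt hy; have t1 : 0 < 1 + t by rewrite addr_gt0.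
have p1 : 0 < 1 - p by move: pt; rewrite mulrDr mulr1 => pt; nra.
apply: (@le_trans _ _ (expR (- ((1 + t) * p)) ^+ hi)).
  by rewrite -expRM_natl ler_expR mulrN lerN2 mulrA.
apply: lerXn2r; rewrite ?nnegrE ?expR_ge0 ?(ltW p1)//.
rewrite expRN -[leRHS]invrK lef_pV2 ?posrE ?invr_gt0 ?expR_gt0//.
apply: le_trans (expR_ge1Dx _); rewrite -[leLHS]div1r ler_pdivrMr//.
by move: pt; rewrite mulrDr mulr1 => pt; nra.
Qed.

(** Enlarging the constant from [u] to [u2] compensates the growth of the
    logarithm within a block. *)
Lemma block_radius (u u2 t : R) (lo n : nat) : 0 < u -> u < u2 -> 0 < t -> (0 < lo)%N ->
  (lo <= n)%N -> 0 < ln (lo%:R : R) -> n%:R <= (1 + t) * lo%:R ->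
  u * t / (u2 - u) <= ln (lo%:R : R) ->
  u * ln (n%:R : R) / n%:R <= u2 * ln lo%:R / lo%:R.
Proof.
move=> u0 uu2 t0 lo0 lon sp nlo s2; have n0 : (0 < n)%N by exact: leq_trans lon.
have lnn : ln (lo%:R : R) <= ln n%:R by rewrite ler_ln ?posrE ?ltr0n// ler_nat.
apply: ler_pM; [|by rewrite invr_ge0| |by rewrite lef_pV2 ?posrE ?ltr0n// ler_nat].
  by apply: mulr_ge0; [exact: ltW|apply: le_trans lnn; exact: ltW].
apply: (@le_trans _ _ (u * (ln lo%:R + t))); first by rewrite ler_pM2l// (ln_block t0).
rewrite ler_pdivrMr ?subr_gt0// in s2.
by rewrite mulrDr -lerBrDl -mulrBl [leRHS]mulrC.
Qed.

End weight.

Section almost_sure_lower_bounds.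
Variables (R : realType) (d : nat) (m : nat) (a : 'I_m -> 'rV[R]_d) (b : 'I_m -> R).
Local Notation A := (polyhedron a b).
Hypothesis d_gt0 : (0 < d)%N.
Hypothesis compactA : compact A.
Variables (mu : probability 'rV[R]_d R) (f : 'rV[R]_d -> R).
Hypothesis mu_A : mu A = 1%E.
Hypothesis mu_density : is_density mu f.
Hypothesis f_cont : forall x, boundary A x -> f y @[y --> within A (nbhs x)] --> f x.
Hypothesis f0_gt0 : (0 < ess_inf_on A f)%E.
Variables (dO : measure_display) (Omega : measurableType dO) (P : probability Omega R).
Variable X : nat -> {RV P >-> 'rV[R]_d}.
Hypothesis X_indep : mutually_independent P X.
Hypothesis X_distr : forall (i : nat) (B : set 'rV[R]_d),
  measurable B -> distribution P (X i) B = mu B.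

Local Notation mass_of := (face_mass a b f).

Lemma mass_of_gt0 F : faces_star A F -> 0 < mass_of F.
Proof. exact: (face_mass_gt0 compactA mu_A mu_density f_cont f0_gt0). Qed.

Lemma exists_slack (g u y1 y2 : R) (N : nat) : y1 < g * u -> g * u < y2 ->
  exists t, [/\ 0 < t, y1 < (g - t) * u / (1 + t) & (g + t) * (1 + t) ^+ N * u < y2].
Proof.
move=> h1 h2; have [t [t0 [ht1 ht2]]] :=
  filter_ex (filterI (nbhs_right_gt (0 : R)) (small_slack N h1 h2)).
by exists t.
Qed.

Lemma lower_linear (k : nat -> nat) (u : R) F : 0 < u -> faces_star A F ->
  (forall c : R, \forall n \near \oo, c * ln (n%:R : R) <= (k n)%:R) ->
  (forall e : R, 0 < e -> \forall n \near \oo, (k n)%:R / n%:R <= e) ->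
  u * mass_of F < 1 ->
  {ae P, forall w, \forall n \near \oo, some_unserved X (k n) n (u * (k n)%:R / n%:R) w}.
Proof.
move=> u0 FF klog klin hF; have g0 := mass_of_gt0 FF.
set g := mass_of F in hF g0.
pose y := (1 + u * g) / 2; have [yg y1] : u * g < y /\ y < 1 by rewrite /y; split; lra.
have y0 : 0 < y by apply: lt_trans yg; exact: mulr_gt0.
have gy : g * u < y by rewrite mulrC.
have gy1 : g * u - 1 < g * u by rewrite gtrBl.
have [t [t0 _ ht]] := exists_slack d.+1 gy1 gy.
have [c c0 [r0 r00 hr]] := lower_single_block d_gt0 compactA mu_A mu_density f_cont f0_gt0
  X_indep X_distr FF t0 u0 y0 y1 (ltW ht).
have [N _ hN] : \forall n \near \oo, [/\ (2 / c) * ln (n%:R : R) <= (k n)%:R,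
    1 * ln (n%:R : R) <= (k n)%:R, 1 <= ln (n%:R : R) & (k n)%:R / n%:R <= r0 / u].
  near=> n; split; near: n; [exact: klog|exact: klog|exact: ln_large|].
  by apply: klin; rewrite divr_gt0.
apply: (@borel_cantelli _ _ _ P _ 2 N) => // n Nn n0.
have [k1 k2 l1 kn] := hN n Nn.
have nR : 0 < n%:R :> R by rewrite ltr0n.
have k0 : 0 < (k n)%:R :> R by rewrite mul1r in k2; rewrite (lt_le_trans ltr01)// (le_trans l1).
have [||E [mE PE] hE] := hr n n (k n)%:R n0 (leqnn n) _ k0.
- by rewrite ler_peMl// lerDl ltW.
- by rewrite -mulrA mulrC -ler_pdivlMr.
exists E.
  split => //; apply: (le_trans PE); rewrite lee_fin ler_wpM2l//.
  rewrite expRN lef_pV2 ?posrE ?exprn_gt0 ?expR_gt0//.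
  rewrite -[X in X ^+ 2](@lnK _ (n%:R)) ?posrE// -expRM_natl ler_expR.
  by rewrite -ler_pdivrMl// mulrC mulrAC.
move=> w nE; have q0 : 0 < u * (k n)%:R / n%:R by rewrite divr_gt0// mulr_gt0.
have nn : (n <= n <= n)%N by rewrite leqnn.
have [i ilt hi] := hE w nE n _ nn q0 (lexx _).
by exists i => //; move: hi; rewrite mul1r ltr_nat; exact: ltnW.
Unshelve. all: by end_near. Qed.

(** The expected count at a single place is below [k n] by a constant factor,
    so that the upper tail bound applies. *)
Lemma lower_log_below (k : nat -> nat) (u beta : R) F : 0 < u -> faces_star A F ->
  (forall b1, b1 < beta -> \forall n \near \oo, b1 * ln (n%:R : R) <= (k n)%:R) ->
  u * mass_of F < beta ->
  {ae P, forall w, \forall n \near \oo, some_unserved X (k n) n (u * ln (n%:R : R) / n%:R) w}.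
Proof.
move=> u0 FF klo hF; have g0 := mass_of_gt0 FF.
set g := mass_of F in hF g0.
pose gap := beta - u * g; have gap0 : 0 < gap by rewrite subr_gt0.
pose u2 := u + gap / (4 * g).
have uu2 : u < u2 by rewrite ltrDl divr_gt0// mulr_gt0.
have u20 : 0 < u2 by exact: lt_trans uu2.
have gu2 : g * u2 = u * g + gap / 4 by rewrite /u2; field; rewrite gt_eqF.
pose y := u * g + gap / 2; pose b1 := u * g + 3 / 4 * gap.
have [gy yb1 b1b] : [/\ g * u2 < y, y < b1 & b1 < beta].
  by rewrite gu2 /y /b1; move: gap0; rewrite /gap; move: (u * g) => v hv; split; lra.
have y0 : 0 < y by apply: lt_trans gy; rewrite mulr_gt0.
have gy1 : g * u2 - 1 < g * u2 by rewrite gtrBl.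
have [t [t0 _ ht]] := exists_slack d.+1 gy1 gy.
have [c c0 [r0 r00 hr]] := lower_single_block d_gt0 compactA mu_A mu_density f_cont f0_gt0
  X_indep X_distr FF t0 u20 y0 yb1 (ltW ht).
apply: (@blocks _ _ _ P _ 2 c t) => //.
have [N _ hk] := klo b1 b1b.
near=> lo => hi lo0 lohi hilo.
have s0 : 1 <= ln (lo%:R : R) by near: lo; exact: ln_large.
have s2 : u * t / (u2 - u) <= ln (lo%:R : R) by near: lo; exact: ln_large.
have Nlo : (N <= lo)%N by near: lo; exact: nbhs_infty_ge.
have sm : ln (lo%:R : R) / lo%:R <= r0 / u2 by near: lo; apply: ln_small; rewrite divr_gt0.
have sp : 0 < ln (lo%:R : R) by exact: lt_le_trans s0.
have [|E [mE PE] hE] := hr lo hi _ lo0 lohi hilo sp.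
  by rewrite -mulrA mulrC -ler_pdivlMr.
exists E => // w nE n /andP[lon nhi].
have n0 : (0 < n)%N by exact: leq_trans lon.
have nlo : n%:R <= (1 + t) * lo%:R by apply: le_trans hilo; rewrite ler_nat.
have lnn : ln (lo%:R : R) <= ln n%:R by rewrite ler_ln ?posrE ?ltr0n// ler_nat.
have q0 : 0 < u * ln (n%:R : R) / n%:R.
  by rewrite divr_gt0 ?ltr0n// mulr_gt0//; exact: lt_le_trans lnn.
have qq : u * ln (n%:R : R) / n%:R <= u2 * ln lo%:R / lo%:R by exact: block_radius nlo s2.
have nn : (lo <= n <= hi)%N by rewrite lon.
have [i ilt hi'] := hE w nE n _ nn q0 qq.
exists i => //; rewrite -(ler_nat R); apply: (le_trans (ltW hi')).
have b10 : 0 < b1 by exact: lt_trans yb1.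
apply: le_trans (hk n (leq_trans Nlo lon)); by rewrite ler_pM2l.
Unshelve. all: by end_near. Qed.

End almost_sure_lower_bounds.

Section arithmetic.
Variable R : realType.

Lemma half_sub (s : R) : 1 / 2 * s <= - (2^-1 * s) + s.
Proof. lra. Qed.

Lemma le_half (x s : R) : x * 2 <= s -> x <= 1 + 2^-1 * s.
Proof. lra. Qed.

Lemma ratio_exponent (s l J : R) : 0 <= l -> J <= 1 -> s * J <= - ((l - s) * J) + l.
Proof.
by move=> l0 J1; have : l * J <= l; [rewrite ler_piMr|rewrite mulrBl; lra].
Qed.

Lemma min_rate_l (dl s : R) : 0 <= s -> dl / 2 * s + - (dl * s) <= - (Num.min (dl / 2) 2^-1 * s).
Proof.
move=> s0; have : Num.min (dl / 2) 2^-1 * s <= dl / 2 * s by rewrite ler_wpM2r// ge_min lexx.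
by move: (Num.min _ _ * s) => v; lra.
Qed.

End arithmetic.

Section almost_sure_lower_bounds_many.
Variables (R : realType) (d : nat) (m : nat) (a : 'I_m -> 'rV[R]_d) (b : 'I_m -> R).
Local Notation A := (polyhedron a b).
Hypothesis d_gt0 : (0 < d)%N.
Hypothesis compactA : compact A.
Variables (mu : probability 'rV[R]_d R) (f : 'rV[R]_d -> R).
Hypothesis mu_A : mu A = 1%E.
Hypothesis mu_density : is_density mu f.
Hypothesis f_cont : forall x, boundary A x -> f y @[y --> within A (nbhs x)] --> f x.
Hypothesis f0_gt0 : (0 < ess_inf_on A f)%E.
Variables (dO : measure_display) (Omega : measurableType dO) (P : probability Omega R).
Variable X : nat -> {RV P >-> 'rV[R]_d}.
Hypothesis X_indep : mutually_independent P X.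
Hypothesis X_distr : forall (i : nat) (B : set 'rV[R]_d),
  measurable B -> distribution P (X i) B = mu B.

Local Notation mass_of := (face_mass a b f).

(** An admissible number of neighbours, close to [b' * s] and positive even
    when [b' = 0]. *)
Definition critical_count (b' s : R) : nat := (Num.truncn (b' * s)).+1.

Lemma critical_count_bounds b' s : 0 <= b' -> 0 <= s ->
  b' * s <= (critical_count b' s)%:R /\ (critical_count b' s)%:R <= b' * s + 1.
Proof.
move=> b0 s0; have bs : 0 <= b' * s by rewrite mulr_ge0.
split; first by rewrite ltW// truncnS_gt.
by rewrite /critical_count -natr1 lerD2r truncn_le.
Qed.

(** The expected number of places with few points is of order
    [lo ^ (j / d - Psi y1 b' - (y2 - y1))] up to powers of the logarithm,
    hence at least [lo ^ (dl / 2)]; the error of the second moment method is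
    of order [ln lo ^ 2 / lo]. *)
Lemma lower_multi_block F (t u b' y1 y2 dl : R) : faces_star A F -> 0 < t -> 0 < u ->
  0 <= b' < y1 -> y1 < (mass_of F - t) * u / (1 + t) ->
  (mass_of F + t) * (1 + t) ^+ d.+2 * u < y2 -> 0 < dl ->
  y2 - y1 + Psi y1 b' <= dim_ratio F - dl ->
  exists2 C : R, 0 <= C & \forall lo \near \oo, forall hi : nat,
    (0 < lo)%N -> (lo <= hi)%N -> hi%:R <= (1 + t) * lo%:R ->
  exists2 E, measurable E /\
    (P E <= (C * expR (- (Num.min (dl / 2) 2^-1 * ln lo%:R)))%:E)%E &
    forall w, ~ E w -> exists2 i, (i < lo)%N &
      (hits X hi (eball (X i w) (radius d (u * ln (lo%:R : R) / lo%:R))) w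
        <= critical_count b' (ln lo%:R))%N.
Proof.
move=> FF t0 u0 /andP[b'0 b'y1] hy1 hy2 dl0 hPsi.
have [c c0 [r0 r00 hr]] :=
  lower_event_multi compactA mu_A mu_density f_cont f0_gt0 X_indep X_distr FF t0 t0.
have g0 : 0 < mass_of F by exact: (face_mass_gt0 compactA mu_A mu_density f_cont f0_gt0 FF).
set g := mass_of F in hr g0 hy1 hy2; set j := affine_dim F in hr.
have J01 : 0 <= dim_ratio F <= 1 by exact: dim_ratio_bound.
set J := dim_ratio F in hPsi J01; have [J0 J1] := andP J01.
have y10 : 0 < y1 by exact: le_lt_trans b'y1.
have t1 : 0 < 1 + t by rewrite addr_gt0.
have t1d : 1 <= (1 + t) ^+ d by rewrite exprn_ege1// lerDl ltW.
have gt0 : 0 < g - t.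
  have : 0 < (g - t) * u / (1 + t) by exact: lt_trans hy1.
  by rewrite pmulr_lgt0 ?invr_gt0// pmulr_lgt0.
have [G GE G0] : exists2 G, G = (g - t) * (1 + t) ^+ d & 0 < G.
  by exists ((g - t) * (1 + t) ^+ d); rewrite // mulr_gt0// (lt_le_trans ltr01).
have [Y YE Y0] : exists2 Y, Y = (g + t) * (1 + t) ^+ d & 0 < Y.
  by exists ((g + t) * (1 + t) ^+ d); rewrite // mulr_gt0 ?addr_gt0// (lt_le_trans ltr01).
have Yu : Y * (1 + t) * (1 + t) * u <= y2 by move: (ltW hy2); rewrite YE !exprSr !mulrA.
have Yu' : Y * u <= y2.
  apply: le_trans Yu; rewrite ler_pM2r// -mulrA ler_pMr// -[leLHS]mulr1.
  by apply: ler_pM => //; rewrite lerDl ltW.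
have y20 : 0 < y2 by apply: lt_le_trans Yu'; rewrite mulr_gt0.
have Gu : y1 * (1 + t) <= G * u.
  rewrite ltr_pdivlMr// in hy1; apply: (le_trans (ltW hy1)); rewrite ler_pM2r// GE ler_peMr//.
  exact: ltW.
have e0 := expR_gt0 (1 : R).
have [tj tjE tj0] : exists2 tj, tj = (1 + t)^-1 ^+ j & 0 < tj.
  by exists ((1 + t)^-1 ^+ j); rewrite // exprn_gt0// invr_gt0.
have [K1 K1E K10] : exists2 K1, K1 = G * u * y1 * expR 1 / (c * tj) & 0 < K1.
  by eexists; first reflexivity; apply: divr_gt0; rewrite !mulr_gt0.
have [K2 K2E K20] : exists2 K2, K2 = 4 * y1 * y2 & 0 < K2.
  by eexists; first reflexivity; rewrite !mulr_gt0.
have C1 : 0 <= K1 * (4 / dl) ^+ 2 by rewrite mulr_ge0 ?(ltW K10)// exprn_ge0// divr_ge0// ltW.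
have C2 : 0 <= K2 * (4 / 1) ^+ 2 by rewrite mulr_ge0 ?(ltW K20)// exprn_ge0.
exists (K1 * (4 / dl) ^+ 2 + K2 * (4 / 1) ^+ 2); first exact: addr_ge0.
near=> lo => hi lo0 lohi hilo.
have s1 : 1 <= ln (lo%:R : R) by near: lo; exact: ln_large.
have s2 : u^-1 <= ln (lo%:R : R) by near: lo; exact: ln_large.
have s3 : (y1 - b')^-1 <= ln (lo%:R : R) by near: lo; exact: ln_large.
have s4 : K2 * (4 / 1) ^+ 2 * 2 <= ln (lo%:R : R) by near: lo; exact: ln_large.
have s5 : ln (lo%:R : R) / lo%:R <= (r0 / 2) ^+ d / u.
  by near: lo; apply: ln_small; rewrite divr_gt0// exprn_gt0// divr_gt0.
have s6 : ln (lo%:R : R) / lo%:R <= t / (1 + t) / y1.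
  by near: lo; apply: ln_small; rewrite divr_gt0// divr_gt0.
have s7 : ln (lo%:R : R) / lo%:R <= t / (1 + t) / y2.
  by near: lo; apply: ln_small; rewrite divr_gt0// divr_gt0.
set s := ln (lo%:R : R) in s1 s2 s3 s4 s5 s6 s7 *.
have s0 : 0 < s by exact: lt_le_trans s1.
have loR : 0 < lo%:R :> R by rewrite ltr0n.
have loE : lo%:R = expR s :> R by rewrite lnK// posrE.
set kap := critical_count b' s.
have [kap1 kap2] := critical_count_bounds b'0 (ltW s0).
have kapy : kap%:R <= y1 * s.
  apply: (le_trans kap2); rewrite -lerBrDl -mulrBl -ler_pdivrMl ?subr_gt0// mulr1.
  exact: s3.
pose q := u * s / lo%:R; have q0 : 0 < q by rewrite divr_gt0// mulr_gt0.
set r := radius d q; have rX : r ^+ d = q by exact: radiusX.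
have rhoX : ((1 + t) * r) ^+ d = (1 + t) ^+ d * q by rewrite exprMn rX.
have pmaxE : (g + t) * ((1 + t) * r) ^+ d = Y * q by rewrite rhoX mulrA YE.
have pminE : (g - t) * ((1 + t) * r) ^+ d = G * q by rewrite rhoX mulrA GE.
have us1 : 1 <= u * s by rewrite -ler_pdivrMl// mulr1.
have pmax2 : Y * q <= y2 * (s / lo%:R).
  by rewrite /q -[u * s / _]mulrA mulrA ler_pM2r// divr_gt0.
have pmaxt : Y * q * (1 + t) <= t.
  rewrite -ler_pdivlMr//; apply: (le_trans pmax2); rewrite mulrC -ler_pdivlMr//.
have kapmax : 4 * (kap%:R * (Y * q)) <= K2 * (4 / 1) ^+ 2 * expR (- (2^-1 * s)).
  apply: (@le_trans _ _ (K2 * (s ^+ 2 / lo%:R))).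
    have -> : K2 * (s ^+ 2 / lo%:R) = 4 * (y1 * s * (y2 * (s / lo%:R))).
      by rewrite K2E; field; rewrite gt_eqF.
    rewrite ler_pM2l//; apply: ler_pM => //; rewrite mulr_ge0 ?(ltW Y0)// ltW//.
  rewrite -[leRHS]mulrA ler_pM2l// ler_pdivrMr//.
  apply: (le_trans (sqr_exp_le ltr01 (ltW s0))); rewrite -[leRHS]mulrA ler_wpM2l ?exprn_ge0//.
  by rewrite loE -expRD ler_expR half_sub.
have kapmax1 : 4 * (kap%:R * (Y * q)) <= 1.
  apply: (le_trans kapmax); rewrite expRN ler_pdivrMr ?expR_gt0// mul1r.
  apply: le_trans (expR_ge1Dx _); exact: le_half.
have klo : kap%:R <= lo%:R * (t / (1 + t)) :> R.
  apply: (le_trans kapy); rewrite ler_pdivlMr// in s6.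
  have -> : y1 * s = lo%:R * (s / lo%:R * y1) by rewrite mulrA mulrCA mulrC divff ?gt_eqF// mulr1 mulrC.
  by rewrite ler_pM2l.
have kaplo : (kap <= lo)%N.
  rewrite -(ler_nat R); apply: (le_trans klo); rewrite ler_piMr ?(ltW loR)// ler_pdivrMr// mul1r.
  by rewrite lerDr.
have lokap : lo%:R / (1 + t) <= (lo - kap)%:R :> R.
  rewrite natrB//; move: klo; rewrite lerBrDr => klo; apply: (le_trans (lerD (lexx _) klo)).
  by rewrite le_eqVlt; apply/orP; left; apply/eqP; field; rewrite gt_eqF.
have mean : y1 * s <= (lo - kap)%:R * (G * q).
  apply: (@le_trans _ _ (lo%:R / (1 + t) * (G * q))); last first.
    by rewrite ler_pM2r// mulr_gt0.
  have -> : lo%:R / (1 + t) * (G * q) = G * u / (1 + t) * s.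
    by rewrite /q; field; rewrite !gt_eqF.
  by rewrite ler_pM2r// ler_pdivlMr.
have [||||||||E [mE PE] hE] := hr lo hi kap r r; rewrite ?pmaxE ?pminE //.
- exact: radius_gt0.
- apply: (@le_lt_trans _ _ (r0 / 2)); last by rewrite ltr_pdivrMr// ltr_pMr// ltr1n.
  apply: radius_le => //; first by rewrite divr_gt0.
  by rewrite /q -mulrA mulrC -ler_pdivlMr.
- by rewrite mulr_gt0.
exists E; first split => //; last exact: hE.
apply: (le_trans PE); rewrite pmaxE pminE lee_fin.
have pq0 : 0 < G * q by rewrite mulr_gt0.
have lnhiq : expR (s * J) <= r^-1 ^+ j * (u * s).
  rewrite radius_inv -/(dim_ratio F) -/J.
  have us0 : 0 < u * s by rewrite mulr_gt0.
  have usE : u * s = expR (ln (u * s)) by rewrite lnK ?posrE.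
  rewrite [X in _ <= _ * X]usE -expRD ler_expR.
  rewrite /q ln_div ?posrE// -/s; apply: ratio_exponent => //.
  by rewrite ln_ge0.
have hB := binomial_lower s0 b'0 (ltW pq0) y10 (isT : (0 < kap)%N) kap1 kapy mean.
have kapE : (G * q) ^+ kap = G * q * (G * q) ^+ kap.-1 by rewrite -exprS.
rewrite kapE in hB.
have hm : expR (- (y2 * s)) <= (1 - Y * q) ^+ hi.
  apply: (miss_bound _ t0 pmaxt); first by rewrite ltW// mulr_gt0.
  apply: (@le_trans _ _ ((1 + t) * lo%:R * (1 + t) * (Y * q))).
    by apply: ler_wpM2r; [rewrite ltW// mulr_gt0|rewrite ler_pM2r].
  have -> : (1 + t) * lo%:R * (1 + t) * (Y * q) = Y * (1 + t) * (1 + t) * u * s.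
    by rewrite /q; field; rewrite gt_eqF.
  by rewrite ler_pM2r.
have B0 : 0 < 'C(lo, kap)%:R :> R by rewrite ltr0n bin_gt0.
have h0 : 0 < (1 - Y * q) ^+ hi by apply: lt_le_trans hm; rewrite expR_gt0.
have kapR : 0 < kap%:R :> R by rewrite ltr0n.
have rj0 : 0 < r^-1 ^+ j by rewrite exprn_gt0// invr_gt0 radius_gt0.
have W := weight_bound c0 tj0 rj0 B0 pq0 (exprn_gt0 kap.-1 pq0) h0 s0 u0 G0 y10 kapR kapy
  lnhiq hB hm hPsi.
have mE' : ((1 + t) * r)^-1 ^+ j = tj * r^-1 ^+ j by rewrite invfM exprMn tjE.
have rd : r ^+ d = G * q / G by rewrite rX [RHS]mulrAC divff ?mul1r// gt_eqF.
rewrite mE' rd [leRHS]mulrDl; apply: lerD.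
  apply: (le_trans W); rewrite -K1E.
  apply: (@le_trans _ _ (K1 * (4 / dl) ^+ 2 * (expR (dl / 2 * s) * expR (- (dl * s))))).
    rewrite [leRHS]mulrA ler_pM2r ?expR_gt0// -[leRHS]mulrA ler_pM2l//.
    exact: sqr_exp_le (ltW s0).
  by rewrite -expRD; apply: ler_wpM2l => //; rewrite ler_expR min_rate_l// ltW.
apply: (le_trans kapmax); apply: ler_wpM2l => //; rewrite ler_expR lerN2.
by rewrite ler_pM2r// ge_min lexx orbT.
Unshelve. all: by end_near. Qed.

Lemma critical_count_le (k : nat -> nat) (b' beta : R) : 0 <= b' -> b' < beta \/ b' = 0 /\ beta = 0 ->
  (forall n, (0 < n)%N -> (0 < k n)%N) ->
  (forall b1, b1 < beta -> \forall n \near \oo, b1 * ln (n%:R : R) <= (k n)%:R) ->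
  \forall lo \near \oo, forall n, (lo <= n)%N -> (critical_count b' (ln (lo%:R : R)) <= k n)%N.
Proof.
move=> b'0 [b'b|[-> _]] k0 klo; last first.
  near=> lo => n lon; rewrite /critical_count mul0r truncn0; apply: k0.
  by apply: leq_trans lon; near: lo; exact: nbhs_infty_gt.
pose b1 := (b' + beta) / 2; have b1b : b1 < beta by rewrite /b1; lra.
have b'b1 : b' < b1 by rewrite /b1; lra.
have [N _ hk] := klo b1 b1b.
near=> lo => n lon.
have lo0 : (0 < lo)%N by near: lo; exact: nbhs_infty_gt.
have s0 : 0 <= ln (lo%:R : R) by near: lo; exact: ln_large.
have s1 : (b1 - b')^-1 <= ln (lo%:R : R) by near: lo; exact: ln_large.
have Nlo : (N <= lo)%N by near: lo; exact: nbhs_infty_ge.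
have [_ h] := critical_count_bounds b'0 s0.
rewrite -(ler_nat R); apply: (le_trans h); apply: le_trans (hk n (leq_trans Nlo lon)).
apply: (@le_trans _ _ (b1 * ln lo%:R)).
  by rewrite -lerBrDl -mulrBl -ler_pdivrMl ?subr_gt0// mulr1.
apply: ler_wpM2l; first exact: le_trans (ltW b'b1).
by rewrite ler_ln ?posrE ?ltr0n// ?ler_nat// (leq_trans lo0).
Unshelve. all: by end_near. Qed.

(** When [u * mass_of F] is below [beta] a single place suffices; from there
    up to the critical value many places are needed. *)
Lemma lower_log (k : nat -> nat) (u beta : R) F : 0 <= beta -> 0 < u -> faces_star A F ->
  (forall n, (0 < n)%N -> (0 < k n)%N) ->
  (forall b1, b1 < beta -> \forall n \near \oo, b1 * ln (n%:R : R) <= (k n)%:R) ->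
  u * mass_of F < Hhat beta (dim_ratio F) ->
  {ae P, forall w, \forall n \near \oo, some_unserved X (k n) n (u * ln (n%:R : R) / n%:R) w}.
Proof.
move=> beta0 u0 FF k0 klo hF.
have g0 : 0 < mass_of F by exact: (face_mass_gt0 compactA mu_A mu_density f_cont f0_gt0 FF).
have [ug|ug] := ltP (u * mass_of F) beta.
  exact: (lower_log_below d_gt0 compactA mu_A mu_density f_cont f0_gt0 X_indep X_distr u0 FF klo ug).
have [J0 _] := andP (dim_ratio_bound d_gt0 F).
set g := mass_of F in hF g0 ug.
(* Raising [u] makes room for the spread of the sample size within a block. *)
pose y0 := (u * g + Hhat beta (dim_ratio F)) / 2.
have [uy y0b] : u * g < y0 /\ y0 < Hhat beta (dim_ratio F).
  by rewrite /y0; move: (u * g) (Hhat _ _) hF => v h hv; split; lra.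
have by0 : beta < y0 by exact: le_lt_trans uy.
have [b' [y1 [y2 [dl [hb' b'b /andP[y1y y2y] dl0 hPsi]]]]] := Psi_below_Hhat beta0 J0 by0 y0b.
pose u2 := y0 / g; have gu2 : g * u2 = y0 by rewrite /u2 mulrCA divff ?mulr1// gt_eqF.
have uu2 : u < u2 by rewrite ltr_pdivlMr.
have u20 : 0 < u2 by exact: lt_trans uu2.
rewrite -gu2 in y1y y2y.
have [t [t0 ht1 ht2]] := exists_slack d.+2 y1y y2y.
have [C C0 hC] := lower_multi_block FF t0 u20 hb' ht1 ht2 dl0 hPsi.
have b'0 : 0 <= b' by case/andP: hb'.
apply: (@blocks _ _ _ P _ C (Num.min (dl / 2) 2^-1) t) => //.
  by rewrite lt_min divr_gt0/=.
have hcrit := critical_count_le b'0 b'b k0 klo.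
near=> lo => hi lo0 lohi hilo.
have s0 : 0 < ln (lo%:R : R).
  by apply: (@lt_le_trans _ _ 1) => //; near: lo; exact: ln_large.
have s2 : u * t / (u2 - u) <= ln (lo%:R : R) by near: lo; exact: ln_large.
have [E [mE PE] hE] : exists2 E, measurable E /\
    (P E <= (C * expR (- (Num.min (dl / 2) 2^-1 * ln lo%:R)))%:E)%E &
    forall w, ~ E w -> exists2 i, (i < lo)%N &
      (hits X hi (eball (X i w) (radius d (u2 * ln (lo%:R : R) / lo%:R))) w
        <= critical_count b' (ln lo%:R))%N.
  by move: hi lo0 lohi hilo; near: lo; exact: hC.
exists E => // w nE n /andP[lon nhi]; have [i ilo hi'] := hE w nE.
exists i; first exact: leq_trans lon.
have n0 : (0 < n)%N by exact: leq_trans lon.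
have nlo : n%:R <= (1 + t) * lo%:R by apply: le_trans hilo; rewrite ler_nat.
have lnn : ln (lo%:R : R) <= ln n%:R by rewrite ler_ln ?posrE ?ltr0n// ler_nat.
have kn : (critical_count b' (ln (lo%:R : R)) <= k n)%N.
  by move: n lon {nhi n0 nlo lnn}; near: lo; exact: hcrit.
apply: leq_trans kn; apply: leq_trans hi'.
apply: (leq_trans (hits_le_size _ _ _ nhi)); apply: hits_subset; apply: eball_sub.
rewrite subrr enorm0 add0r; apply: le_radius.
  by rewrite divr_gt0 ?ltr0n// mulr_gt0//; exact: lt_le_trans lnn.
exact: (block_radius u0 uu2 t0 lo0 lon s0 nlo s2).
Unshelve. all: by end_near. Qed.

End almost_sure_lower_bounds_many.

(** * From counts to the link length *)

Section maximum_attained.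
Variable R : realType.

(** A finite set of values has a greatest element, so that [maximum] returns
    it. *)
Lemma maximum_finite (T : Type) (S : set T) (I : finType) (p : I -> T) (h : T -> R) :
  S !=set0 -> (forall F, S F -> exists i, F = p i) ->
  exists2 F, S F & maximum [set h F | F in S] = h F /\ forall G, S G -> h G <= h F.
Proof.
move=> [F0 SF0] hp; pose Q i := `[< S (p i) >].
have [i0 F0E] := hp F0 SF0.
have Qi0 : Q i0 by apply/asboolP; rewrite -F0E.
have [i Qi imax] : exists2 i, Q i & forall j, Q j -> h (p j) <= h (p i).
  pose D := [seq i <- enum I | Q i].
  have : exists2 i, i \in D & forall j, j \in D -> h (p j) <= h (p i).
    have : i0 \in D by rewrite mem_filter Qi0 mem_enum.
    elim: D i0 {F0E Qi0} => // x s IH i0 _.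
    case: s IH => [|x' s] IH; first by exists x; rewrite ?mem_head// => j; rewrite inE => /eqP ->.
    have [y ys ymax] := IH x' (mem_head _ _).
    have [xy|yx] := leP (h (p x)) (h (p y)).
      exists y; first by rewrite inE ys orbT.
      by move=> j; rewrite inE => /orP[/eqP ->//|/ymax].
    exists x; first exact: mem_head.
    by move=> j; rewrite inE => /orP[/eqP ->//|/ymax/le_trans]; apply; exact: ltW.
  move=> [i iD imax]; exists i; first by move: iD; rewrite mem_filter => /andP[].
  by move=> j Qj; apply: imax; rewrite mem_filter Qj mem_enum.
have ex : exists M, [set M | [set h F | F in S] M /\ ubound [set h F | F in S] M] M.
  exists (h (p i)); split; first by exists (p i) => //; exact/asboolP.
  by move=> _ [F SF <-]; have [j Fj] := hp F SF; rewrite Fj; apply: imax; apply/asboolP; rewrite -Fj.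
have [[F SF hF] ub] := getPex ex; exists F => //.
split; first by rewrite hF.
by move=> G SG; rewrite hF; apply: ub; exists G.
Qed.

End maximum_attained.

Section extended_reals.
Variable R : realType.

Lemma lee_expe (x y : \bar R) n : (0 <= x)%E -> (x <= y)%E -> (x ^+ n <= y ^+ n)%E.
Proof.
move=> x0 xy; elim: n => [|n IH]; first by rewrite !expe0.
by rewrite !expeS; apply: lee_pmul => //; exact: expe_ge0.
Qed.

Lemma cvg_squeeze_steps (v : nat -> \bar R) (c : R) :
  (forall q : nat, \forall n \near \oo, (v n <= (c + q.+1%:R^-1)%:E)%E) ->
  (forall q : nat, \forall n \near \oo, ((c - q.+1%:R^-1)%:E <= v n)%E) ->
  v n @[n --> \oo] --> c%:E.
Proof.
move=> hu hl.
have fin q : \forall n \near \oo, v n \is a fin_num /\ `|c - fine (v n)| <= q.+1%:R^-1.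
  near=> n.
  have u : (v n <= (c + q.+1%:R^-1)%:E)%E by near: n.
  have l : ((c - q.+1%:R^-1)%:E <= v n)%E by near: n.
  move: u l; case: (v n) => [r||]//=; rewrite !lee_fin => u l; split => //.
  by rewrite ler_distl; move: (q.+1%:R^-1) u l => z u l; apply/andP; split; lra.
apply/fine_cvgP; split; first by apply: filterS (fin 0%N) => n [].
apply/cvgrPdist_lt => e e0.
have [q _ hq] := near_infty_natSinv_lt (PosNum e0).
apply: filterS (fin q) => n [_ h]; apply: le_lt_trans h _.
exact: (hq q (leqnn q)).
Unshelve. all: by end_near. Qed.

End extended_reals.

Section link.
Variables (R : realType) (d : nat) (m : nat) (a : 'I_m -> 'rV[R]_d) (b : 'I_m -> R).
Local Notation A := (polyhedron a b).
Hypothesis d_gt0 : (0 < d)%N.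
Variables (dO : measure_display) (Omega : measurableType dO) (P : probability Omega R).
Variable X : nat -> {RV P >-> 'rV[R]_d}.

Lemma sample_count_hits n w D : (forall i j, i != j -> X i w != X j w) ->
  sample_count X n w D = hits X n D w.
Proof.
move=> Xd; pose s := [seq X i w | i <- iota 0 n & X i w \in D].
have us : uniq s.
  rewrite map_inj_uniq ?filter_uniq ?iota_uniq// => i j h.
  by apply/eqP; apply: contraT => /Xd; rewrite h eqxx.
have -> : sample_count X n w D = #|` [fset x in s]%fset|.
  rewrite /sample_count -[X in fset_set X](_ : [set` [fset x in s]%fset] = _) ?set_fsetK//.
  apply/seteqP; split => x /=; rewrite !inE.
    move=> /mapP[i]; rewrite mem_filter mem_iota add0n => /andP[iD /= ilt] ->.
    by split; [exists i|exact/set_mem].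
  move=> [[i /= ilt <-] Dx]; apply/mapP; exists i => //.
  by rewrite mem_filter mem_iota add0n ilt mem_set.
rewrite card_fseq undup_id// size_map size_filter /hits.
rewrite -sum1_count big_mkcond/= -(big_mkord xpredT (fun i => (X i w \in D) : nat)).
by rewrite /index_iota subn0; apply: eq_bigr => i _; case: ifP.
Qed.

Lemma link_le k n q w : (forall i j, i != j -> X i w != X j w) -> (forall i, A (X i w)) ->
  all_served a b X k n q w -> (knn_link X n k w <= (radius d q)%:E)%E.
Proof.
move=> Xd XA h; apply: ereal_inf_lbound; exists (radius d q) => //; split; first exact: radius_gt0.
by move=> x [i _ <-]; rewrite sample_count_hits//; exact: h.
Qed.

Lemma link_ge k n q w : (forall i j, i != j -> X i w != X j w) ->
  some_unserved X k n q w -> ((radius d q)%:E <= knn_link X n k w)%E.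
Proof.
move=> Xd [i ilt hi]; apply: le_ereal_inf_tmp => _ [r [r0 hr] <-]; rewrite lee_fin.
rewrite leNgt; apply/negP => lt.
have : sample X n w (X i w) by exists i.
move=> /hr; rewrite sample_count_hits// leqNgt ltnS => /negP; apply.
apply: leq_trans hi; apply: hits_subset; apply: eball_sub.
by rewrite subrr enorm0 add0r ltW.
Qed.

Lemma link_ge0 k n w : (0 <= knn_link X n k w)%E.
Proof. by apply: le_ereal_inf_tmp => _ [r [r0 hr] <-]; rewrite lee_fin ltW. Qed.

Lemma normalised_le (L : \bar R) (u s : R) n : (0 < n)%N -> 0 < s -> 0 < u -> (0 <= L)%E ->
  (L <= (radius d (u * s / n%:R))%:E)%E -> (n%:R%:E * L ^+ d / s%:E <= u%:E)%E.
Proof.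
move=> n0 s0 u0 L0 h; have nR : 0 < n%:R :> R by rewrite ltr0n.
rewrite inver gt_eqF// lee_pdivrMr// -EFinM.
apply: (@le_trans _ _ (n%:R%:E * (radius d (u * s / n%:R))%:E ^+ d)%E).
  by apply: lee_wpmul2l; [rewrite lee_fin|exact: lee_expe].
rewrite -EFin_expe radiusX ?divr_gt0 ?mulr_gt0// -EFinM lee_fin mulrC divfK// gt_eqF//.
Qed.

Lemma normalised_ge (L : \bar R) (u s : R) n : (0 < n)%N -> 0 < s -> 0 < u ->
  ((radius d (u * s / n%:R))%:E <= L)%E -> (u%:E <= n%:R%:E * L ^+ d / s%:E)%E.
Proof.
move=> n0 s0 u0 h; have nR : 0 < n%:R :> R by rewrite ltr0n.
rewrite inver gt_eqF// lee_pdivlMr// -EFinM.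
apply: (@le_trans _ _ (n%:R%:E * (radius d (u * s / n%:R))%:E ^+ d)%E).
  by rewrite -EFin_expe radiusX ?divr_gt0 ?mulr_gt0// -EFinM lee_fin [leRHS]mulrC divfK// gt_eqF//.
apply: lee_wpmul2l; first by rewrite lee_fin.
by apply: lee_expe => //; rewrite lee_fin ltW// radius_gt0.
Qed.

(** Let [u] run through the constants [c + 1 / (q + 1)] and [c - 1 / (q + 1)];
    when the latter is not positive, the lower bound is trivial. *)
Lemma link_cvg (k : nat -> nat) (s : nat -> R) (c : R) w : 0 <= c ->
  (\forall n \near \oo, 0 < s n) ->
  (forall i j, i != j -> X i w != X j w) -> (forall i, A (X i w)) ->
  (forall q : nat, \forall n \near \oo,
    all_served a b X (k n) n ((c + q.+1%:R^-1) * s n / n%:R) w) ->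
  (forall q : nat, 0 < c - q.+1%:R^-1 -> \forall n \near \oo,
    some_unserved X (k n) n ((c - q.+1%:R^-1) * s n / n%:R) w) ->
  (n%:R%:E * knn_link X n (k n) w ^+ d / (s n)%:E)%E @[n --> \oo] --> c%:E.
Proof.
move=> c0 sp Xd XA hu hl; have hl' q : \forall n \near \oo, 0 < c - q.+1%:R^-1 ->
    some_unserved X (k n) n ((c - q.+1%:R^-1) * s n / n%:R) w.
  have [u0|u0] := ltP 0 (c - q.+1%:R^-1); last exact: nearW.
  by apply: filterS (hl q u0) => n + _.
apply: cvg_squeeze_steps => q; near=> n.
- have n0 : (0 < n)%N by near: n; exact: nbhs_infty_gt.
  have s0 : 0 < s n by near: n.
  apply: normalised_le => //; [by rewrite ltr_wpDl// invr_gt0 ltr0n|exact: link_ge0|].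
  by apply: link_le => //; near: n; exact: hu.
- have n0 : (0 < n)%N by near: n; exact: nbhs_infty_gt.
  have s0 : 0 < s n by near: n.
  have [u0|u0] := ltP 0 (c - q.+1%:R^-1).
    by apply: normalised_ge => //; apply: link_ge => //; move: u0; near: n; exact: hl'.
  apply: (@le_trans _ _ 0%E); first by rewrite lee_fin.
  apply: mule_ge0; last by rewrite inve_ge0 lee_fin ltW.
  by apply: mule_ge0; [rewrite lee_fin|exact: expe_ge0 (link_ge0 _ _ _)].
Unshelve. all: by end_near. Qed.

End link.

(** * The almost sure limits *)

Section limits.
Variables (R : realType) (d : nat) (m : nat) (a : 'I_m -> 'rV[R]_d) (b : 'I_m -> R).
Local Notation A := (polyhedron a b).
Hypothesis d_gt0 : (0 < d)%N.
Hypothesis compactA : compact A.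
Variables (mu : probability 'rV[R]_d R) (f : 'rV[R]_d -> R).
Hypothesis mu_A : mu A = 1%E.
Hypothesis mu_density : is_density mu f.
Hypothesis f_cont : forall x, boundary A x -> f y @[y --> within A (nbhs x)] --> f x.
Hypothesis f0_gt0 : (0 < ess_inf_on A f)%E.
Variables (dO : measure_display) (Omega : measurableType dO) (P : probability Omega R).
Variable X : nat -> {RV P >-> 'rV[R]_d}.
Hypothesis X_indep : mutually_independent P X.
Hypothesis X_distr : forall (i : nat) (B : set 'rV[R]_d),
  measurable B -> distribution P (X i) B = mu B.
Variable k : nat -> nat.
Hypothesis k_gt0 : forall n, (0 < n)%N -> (0 < k n)%N.

Local Notation mass_of := (face_mass a b f).

Lemma sample_in_polytope : {ae P, forall w, forall i, A (X i w)}.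
Proof.
apply: ae_foralln => i; exists (X i @^-1` ~` A); split.
- by apply: measurable_RV; apply: measurableC; exact: measurable_polyhedron.
- have mC : measurable (~` A) by apply: measurableC; exact: measurable_polyhedron.
  apply: etrans (X_distr i mC) _.
  by rewrite probability_setC ?mu_A ?subee//; exact: measurable_polyhedron.
- by move=> w.
Qed.

Lemma sample_distinct : {ae P, forall w, forall i j, i != j -> X i w != X j w}.
Proof.
apply: (sample_points_distinct X_indep X_distr) => x.
apply: (density_null mu_density); last exact: lebesgue_row_point.
rewrite (_ : [set x] = eball x 0); first exact: measurable_eball.
apply/seteqP; split => y; rewrite eballE /=; first by move=> ->; rewrite subrr enorm0.
move=> h; apply/eqP; rewrite -subr_eq0; apply/eqP/enorm_eq0.
by apply/le_anti; rewrite h enorm_ge0.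
Qed.

Lemma greatest_face (h : set 'rV[R]_d -> R) : exists2 F, faces_star A F &
  maximum [set h F | F in faces_star A] = h F /\ forall G, faces_star A G -> h G <= h F.
Proof.
apply: (maximum_finite (p := pface a b)); first by exists A; right.
by move=> F; exact: (faces_star_pface compactA mu_A mu_density).
Qed.

(** The critical constant of a face is the solution [u] of
    [u * mass_of F = 1]. *)
Lemma limit_linear :
  (forall c : R, \forall n \near \oo, c * ln (n%:R : R) <= (k n)%:R) ->
  (forall e : R, 0 < e -> \forall n \near \oo, (k n)%:R / n%:R <= e) ->
  {ae P, forall w, (n%:R%:E * knn_link X n (k n) w ^+ d / (k n)%:R%:E)%E @[n --> \oo] -->
      (maximum [set 1 / mass_of F | F in faces_star A])%:E}.
Proof.
move=> klog klin; have [F FF [-> Fmax]] := greatest_face (fun F => 1 / mass_of F).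
have pos G (GG : faces_star A G) : 0 < mass_of G.
  exact: (face_mass_gt0 compactA mu_A mu_density f_cont f0_gt0 GG).
set c := 1 / mass_of F.
have c0 : 0 < c by rewrite divr_gt0// pos.
have hu (q : nat) : {ae P, forall w, \forall n \near \oo,
    all_served a b X (k n) n ((c + q.+1%:R^-1) * (k n)%:R / n%:R) w}.
  apply: (upper_linear d_gt0 compactA mu_A mu_density f_cont f0_gt0 X_indep X_distr) => //.
    by rewrite addr_gt0// invr_gt0 ltr0n.
  move=> G GG; rewrite -ltr_pdivrMr ?pos//; apply: le_lt_trans (Fmax G GG) _.
  by rewrite ltrDl invr_gt0 ltr0n.
have hl (q : nat) : {ae P, forall w, 0 < c - q.+1%:R^-1 -> \forall n \near \oo,
    some_unserved X (k n) n ((c - q.+1%:R^-1) * (k n)%:R / n%:R) w}.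
  have [u0|u0] := ltP 0 (c - q.+1%:R^-1); last by apply: aeW.
  apply: filterS (lower_linear d_gt0 compactA mu_A mu_density f_cont f0_gt0 X_indep X_distr
    u0 FF klog klin _) => [w + _ //|].
  by rewrite -ltr_pdivlMr ?pos// gtrBl invr_gt0 ltr0n.
apply: filterS3 (ae_foralln hu) (ae_foralln hl) (filterI sample_distinct sample_in_polytope).
move=> w huw hlw [Xd XA]; apply: (link_cvg d_gt0 _ _ Xd XA huw hlw); first exact: ltW.
by near=> n; rewrite ltr0n; apply: k_gt0; near: n; exact: nbhs_infty_gt.
Unshelve. all: by end_near. Qed.

(** The critical constant of a face is the solution [u] of
    [u * mass_of F = Hhat beta (dim_ratio F)]. *)
Lemma limit_log (beta : R) : 0 <= beta ->
  (forall b1, beta < b1 -> \forall n \near \oo, (k n)%:R <= b1 * ln (n%:R : R)) ->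
  (forall b1, b1 < beta -> \forall n \near \oo, b1 * ln (n%:R : R) <= (k n)%:R) ->
  {ae P, forall w, (n%:R%:E * knn_link X n (k n) w ^+ d / (ln (n%:R : R))%:E)%E @[n --> \oo] -->
      (maximum [set Hhat beta (dim_ratio F) / mass_of F | F in faces_star A])%:E}.
Proof.
move=> beta0 khi klo.
have [F FF [-> Fmax]] := greatest_face (fun F => Hhat beta (dim_ratio F) / mass_of F).
have pos G (GG : faces_star A G) : 0 < mass_of G.
  exact: (face_mass_gt0 compactA mu_A mu_density f_cont f0_gt0 GG).
set c := Hhat beta (dim_ratio F) / mass_of F.
have c0 : 0 <= c.
  have [J0 _] := andP (dim_ratio_bound d_gt0 F).
  have [h _] := Hhat_spec beta0 J0.
  by apply: divr_ge0; [exact: le_trans h|exact: ltW (pos _ FF)].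
have hu (q : nat) : {ae P, forall w, \forall n \near \oo,
    all_served a b X (k n) n ((c + q.+1%:R^-1) * ln (n%:R : R) / n%:R) w}.
  apply: (upper_log d_gt0 compactA mu_A mu_density f_cont f0_gt0 X_indep X_distr beta0 _ khi).
    by rewrite ltr_wpDl// invr_gt0 ltr0n.
  move=> G GG; rewrite -ltr_pdivrMr ?pos//; apply: le_lt_trans (Fmax G GG) _.
  by rewrite ltrDl invr_gt0 ltr0n.
have hl (q : nat) : {ae P, forall w, 0 < c - q.+1%:R^-1 -> \forall n \near \oo,
    some_unserved X (k n) n ((c - q.+1%:R^-1) * ln (n%:R : R) / n%:R) w}.
  have [u0|u0] := ltP 0 (c - q.+1%:R^-1); last by apply: aeW.
  apply: filterS (lower_log d_gt0 compactA mu_A mu_density f_cont f0_gt0 X_indep X_distr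
    beta0 u0 FF k_gt0 klo _) => [w + _ //|].
  by rewrite -ltr_pdivlMr ?pos// gtrBl invr_gt0 ltr0n.
apply: filterS3 (ae_foralln hu) (ae_foralln hl) (filterI sample_distinct sample_in_polytope).
move=> w huw hlw [Xd XA]; apply: (link_cvg d_gt0 c0 _ Xd XA huw hlw).
by near=> n; apply: (@lt_le_trans _ _ 1) => //; near: n; exact: ln_large.
Unshelve. all: by end_near. Qed.

End limits.

Section growth_of_k.
Variable R : realType.
Implicit Types k : nat -> nat.

Lemma ratio_ubound k (b b1 : R) :
  ((k n)%:R / ln n%:R : R)%:E @[n --> \oo] --> b%:E -> b < b1 ->
  \forall n \near \oo, (k n)%:R <= b1 * ln (n%:R : R).
Proof.
move=> /fine_cvg h bb1; near=> n.
have s0 : 0 < ln (n%:R : R).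
  by apply: (@lt_le_trans _ _ 1) => //; near: n; exact: ln_large.
by rewrite -ler_pdivrMr//; near: n; exact: cvgr_le h _ bb1.
Unshelve. all: by end_near. Qed.

Lemma ratio_lbound k (b b1 : R) :
  ((k n)%:R / ln n%:R : R)%:E @[n --> \oo] --> b%:E -> b1 < b ->
  \forall n \near \oo, b1 * ln (n%:R : R) <= (k n)%:R.
Proof.
move=> /fine_cvg h bb1; near=> n.
have s0 : 0 < ln (n%:R : R).
  by apply: (@lt_le_trans _ _ 1) => //; near: n; exact: ln_large.
by rewrite -ler_pdivlMr//; near: n; exact: cvgr_ge h _ bb1.
Unshelve. all: by end_near. Qed.

Lemma ratio_pinfty k (c : R) :
  ((k n)%:R / ln n%:R : R)%:E @[n --> \oo] --> +oo%E ->
  \forall n \near \oo, c * ln (n%:R : R) <= (k n)%:R.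
Proof.
move=> /cvgeryP/cvgryPge h; near=> n.
have s0 : 0 < ln (n%:R : R).
  by apply: (@lt_le_trans _ _ 1) => //; near: n; exact: ln_large.
by rewrite -ler_pdivlMr//; near: n; exact: h.
Unshelve. all: by end_near. Qed.

Lemma ratio_small k (e : R) :
  ((k n)%:R / n%:R : R) @[n --> \oo] --> (0 : R) -> 0 < e ->
  \forall n \near \oo, (k n)%:R / n%:R <= e.
Proof. by move=> h e0; exact: cvgr_le h _ e0. Qed.

End growth_of_k.

Theorem theorem2p1 (R : realType) (d : nat) (d_gt0 : (0 < d)%N)
    (A : set 'rV[R]_d) (A_polytope : convex_polytope A)
    (mu : probability 'rV[R]_d R) (mu_A : mu A = 1%E)
    (f : 'rV[R]_d -> R) (mu_density : is_density mu f)
    (dO : measure_display) (Omega : measurableType dO) (P : probability Omega R)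
    (X : nat -> {RV P >-> 'rV[R]_d})
    (X_indep : mutually_independent P X)
    (X_distr : forall (i : nat) (B : set 'rV[R]_d),
      measurable B -> distribution P (X i) B = mu B)
    (f_cont : forall x : 'rV[R]_d, boundary A x ->
      f y @[y --> within A (nbhs x)] --> f x)
    (f0_gt0 : (0 < ess_inf_on A f)%E)
    (beta : \bar R) (beta_ge0 : (0 <= beta)%E)
    (k : nat -> nat) (k_gt0 : forall n : nat, (0 < n)%N -> (0 < k n)%N)
    (k_log : ((k n)%:R / ln n%:R : R)%:E @[n --> \oo] --> beta)
    (k_lin : ((k n)%:R / n%:R : R) @[n --> \oo] --> (0 : R)) :
  {ae P, forall w : Omega,
    (beta = +oo%E ->
      (n%:R%:E * knn_link X n (k n) w ^+ d / (k n)%:R%:E)%E @[n --> \oo] -->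
      (maximum [set 1 / (face_inf A f F * angular_volume A F)
               | F in faces_star A])%:E)
    /\
    (forall b : R, beta = b%:E ->
      (n%:R%:E * knn_link X n (k n) w ^+ d / (ln n%:R)%:E)%E @[n --> \oo] -->
      (maximum [set Hhat b ((affine_dim F)%:R / d%:R)
                    / (face_inf A f F * angular_volume A F)
               | F in faces_star A])%:E)}.
Proof.
case: A_polytope => compactA [m [a [b AE]]].
change (A = polyhedron a b) in AE; subst A.
case: beta beta_ge0 k_log => [beta| |]//.
- rewrite lee_fin => beta0 k_log.
  apply: filterS (limit_log d_gt0 compactA mu_A mu_density f_cont f0_gt0 X_indep X_distr k_gt0
    beta0 (fun b1 => ratio_ubound k_log) (fun b1 => ratio_lbound k_log)) => w hw.
  by split=> // b' [<-].
- move=> _ k_log.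
  apply: filterS (limit_linear d_gt0 compactA mu_A mu_density f_cont f0_gt0 X_indep X_distr k_gt0
    (fun c => ratio_pinfty c k_log) (fun e => ratio_small k_lin)) => w hw.
  by split.
Qed.
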